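(* Let $k$ be a field, let $\mathfrak q=(q_{ij})$ be an $n\times n$ multiplicatively antisymmetric matrix with entries in $k^\times$, and let $\Lambda_{\mathfrak q}$ be the corresponding $n$-dimensional quantum torus with generators $X_1^{\pm1},\dots,X_n^{\pm1}$. Let $p_1,\dots,p_n\in k^\times$ and let $\sigma$ be the scalar automorphism of $\Lambda_{\mathfrak q}$ defined by $\sigma(X_i)=p_iX_i$ for $i=1,\dots,n$. Consider the skew Laurent extension $\Lambda^\ast_{\mathfrak q,\sigma}=\Lambda_{\mathfrak q}[Y^{\pm1};\sigma]$. Let $\mathscr G(\Lambda_{\mathfrak q})$ be the subgroup of $k^\times$ generated by all the $q_{ij}$, and let $\mathscr H_\sigma$ be the subgroup of $k^\times$ generated by $p_1,\dots,p_n$. Assume $\mathscr G(\Lambda_{\mathfrak q})\cap\mathscr H_\sigma=\{1\}$. Let $\mathscr V(\Lambda_{\mathfrak q})$ be the set of Gelfand–Kirillov dimensions of simple $\Lambda_{\mathfrak q}$-modules and $\mathscr V(\Lambda^\ast_{\mathfrak q,\sigma})$ the set of Gelfand–Kirillov dimensions of simple $\Lambda^\ast_{\mathfrak q,\sigma}$-modules. Then \[\mathscr V(\Lambda^\ast_{\mathfrak q,\sigma})\subseteq\{\operatorname{rk}(\mathscr H_\sigma),\operatorname{rk}(\mathscr H_\sigma)+1,\dots,n\}\cup\{u+1\mid u\in\mathscr V(\Lambda_{\mathfrak q})\}.\]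
   Context: An $n\times n$ matrix $\mathfrak q=(q_{ij})$ over $k^\times=k\setminus\{0\}$ is multiplicatively antisymmetric if $q_{ii}=1$ and $q_{ji}=q_{ij}^{-1}$ for all $i,j$. The $n$-dimensional quantum torus $\Lambda_{\mathfrak q}$ is the associative $k$-algebra generated by $X_1,\dots,X_n$ and their inverses subject to $X_iX_j=q_{ij}X_jX_i$ for all $i,j$. The skew Laurent extension $\Lambda_{\mathfrak q}[Y^{\pm1};\sigma]$ is the ring of Laurent polynomials in $Y$ with coefficients in $\Lambda_{\mathfrak q}$, with multiplication determined by $Ya=\sigma(a)Y$ for $a\in\Lambda_{\mathfrak q}$. $\operatorname{rk}$ denotes the torsion-free rank of an abelian group. Gelfand–Kirillov dimension is measured relative to $k$. *)

(* Defs.v *)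
From HB Require Import structures.
From mathcomp Require Import all_boot all_order all_algebra.
From mathcomp Require Import boolp classical_sets reals ereal topology normedtype sequences exp Rstruct.
Set Implicit Arguments. Unset Strict Implicit. Unset Printing Implicit Defensive.
Import Order.TTheory GRing.Theory Num.Theory.
Local Open Scope ring_scope.
Local Open Scope classical_set_scope.

Notation GKR := Rdefinitions.R.

Section Defs.
Variable k : fieldType.

Definition mult_antisym n (q : 'I_n -> 'I_n -> k) : Prop :=
  [/\ forall i j, q i j != 0, forall i, q i i = 1 & forall i j, q j i = (q i j)^-1].

Definition lin_map (V : lmodType k) (f : V -> V) : Prop :=
  forall (a : k) (u v : V), f (a *: u + v) = a *: f u + f v.

Definition inverse_maps (V : Type) (f g : V -> V) : Prop := cancel f g /\ cancel g f.

Definition qtorus_module n (q : 'I_n -> 'I_n -> k) (V : lmodType k)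
    (X Xi : 'I_n -> V -> V) : Prop :=
  [/\ forall i, lin_map (X i), forall i, inverse_maps (X i) (Xi i)
    & forall i j v, X i (X j v) = q i j *: X j (X i v)].

(* A module over the skew Laurent extension Lambda_q[Y^{+-1}; sigma], where
   sigma(X_i) = p_i X_i: a Lambda_q-module with an invertible linear Y such
   that Y a = sigma(a) Y, i.e. Y X_i = p_i X_i Y. *)
Definition skew_laurent_module n (q : 'I_n -> 'I_n -> k) (p : 'I_n -> k)
    (V : lmodType k) (X Xi : 'I_n -> V -> V) (Y Yi : V -> V) : Prop :=
  [/\ qtorus_module q X Xi, lin_map Y, inverse_maps Y Yi
    & forall i v, Y (X i v) = p i *: X i (Y v)].

Definition subspace (V : lmodType k) (W : set V) : Prop :=
  W 0 /\ forall (a : k) u v, W u -> W v -> W (a *: u + v).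

Definition simple_module (V : lmodType k) (gens : seq (V -> V)) : Prop :=
  (exists v : V, v != 0) /\
  forall W : set V, subspace W ->
    (forall g w, List.In g gens -> W w -> W (g w)) ->
    W = [set 0] \/ W = setT.

Definition free_seq (V : lmodType k) (s : seq V) : Prop :=
  forall c : 'I_(size s) -> k,
    \sum_(i < size s) c i *: s`_i = 0 -> forall i, c i = 0.

Definition span_dim (V : lmodType k) (s : seq V) : nat :=
  \max_(m < (size s).+1 | `[< exists t, [/\ subseq t s, free_seq t & size t = m] >]) m.

(* word_span gens m0 N spans V^N M0, where V = span(1, gens), M0 = span m0 *)
Fixpoint word_span (V : lmodType k) (gens : seq (V -> V)) (m0 : seq V) (N : nat)
    : seq V :=
  if N is N'.+1 then
    let s := word_span gens m0 N' in s ++ flatten [seq map g s | g <- gens]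
  else m0.

(* Gelfand-Kirillov dimension of a module over the algebra generated by gens:
   sup over finite-dim. subspaces M0 of limsup_N log dim(V^N M0) / log N *)
Definition GKdim (V : lmodType k) (gens : seq (V -> V)) : \bar GKR :=
  ereal_sup [set limn_esup (fun N : nat =>
       ((ln (span_dim (word_span gens m0 N))%:R) / ln (N%:R : GKR))%:E)
     | m0 in [set: seq V]].

Definition qtorus_gens n (V : lmodType k) (X Xi : 'I_n -> V -> V) : seq (V -> V) :=
  [seq X i | i <- enum 'I_n] ++ [seq Xi i | i <- enum 'I_n].

Definition GK_values_qtorus n (q : 'I_n -> 'I_n -> k) : set (\bar GKR) :=
  [set d | exists (V : lmodType k) (X Xi : 'I_n -> V -> V),
      [/\ qtorus_module q X Xi, simple_module (qtorus_gens X Xi)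
        & GKdim (qtorus_gens X Xi) = d]].

Definition GK_values_skew n (q : 'I_n -> 'I_n -> k) (p : 'I_n -> k)
    : set (\bar GKR) :=
  [set d | exists (V : lmodType k) (X Xi : 'I_n -> V -> V) (Y Yi : V -> V),
      [/\ skew_laurent_module q p X Xi Y Yi,
          simple_module (qtorus_gens X Xi ++ [:: Y; Yi])
        & GKdim (qtorus_gens X Xi ++ [:: Y; Yi]) = d]].

Definition group_q n (q : 'I_n -> 'I_n -> k) : set k :=
  [set x | exists a : 'I_n -> 'I_n -> int,
      x = \prod_(i < n) \prod_(j < n) q i j ^ a i j].

Definition group_p n (p : 'I_n -> k) : set k :=
  [set x | exists a : 'I_n -> int, x = \prod_(i < n) p i ^ a i].

Definition mult_indep r (h : 'I_r -> k) : Prop :=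
  forall a : 'I_r -> int, \prod_(i < r) h i ^ a i = 1 -> forall i, a i = 0.

Definition tf_rank (H : set k) (r : nat) : Prop :=
  (exists h : 'I_r -> k, (forall i, H (h i)) /\ mult_indep h) /\
  (forall r' (h : 'I_r' -> k), (forall i, H (h i)) -> mult_indep h -> (r' <= r)%N).

End Defs.

(* Main.v *)
(* The monomials in the [X_i] and [Y] generate a quantum torus in [n + 1]
   variables. The GK dimension of a cyclic module [k<X> v] over a quantum torus is
   the largest [|J|] such that the [X^a v] with [a] supported on [J] are linearly
   independent, since torsion relations for all larger [J] confine a spanning set
   of monomials to few unbounded exponents.

   Let [V] be simple and let [J] be a largest set of indices of the [X_i] such that
   [V] is torsion-free over the torus [L_J]; let [D] be the division ring of
   fractions of [L_J].

   If [V] has [L_J[Y]]-torsion, then for [i] outside [J] the cyclic [D[Y]]-modules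
   generated by the [X_i^l v] ([v] annihilated by some [F] of minimal degree in [Y])
   are simple and not independent, so two of them are isomorphic. Their
   annihilators are then similar, hence have equal determinants modulo
   [G . H_J], where [G] is generated by the [q_ij] and [H_J] by the [p_j], [j] in
   [J]. Since conjugation by [X_i] scales [Y] by a power of [p_i], some non-trivial
   power of [p_i] lies in [G . H_J], hence in [H_J] as [G] and [H] meet trivially.
   So [rk H <= |J| <= GKdim V].

   If [V] is torsion-free over [L_J[Y]], a cyclic module [U] over the torus of the
   [X_i] of minimal rank over [L_J] satisfies [V = (+)_i Y^i U]: otherwise the rank
   of [V] over [L_J] would be finite. Simplicity of [V] forces [U] to be simple,
   and [GKdim V = GKdim U + 1]. *)

Require Import Defs.
From HB Require Import structures.
From mathcomp Require Import all_boot all_order all_algebra.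
From mathcomp Require Import boolp classical_sets functions reals ereal topology normedtype sequences exp Rstruct.
From mathcomp Require Import zify ring.
Set Implicit Arguments. Unset Strict Implicit. Unset Printing Implicit Defensive.
Import Order.TTheory GRing.Theory Num.Theory.
Local Open Scope ring_scope.
Local Open Scope classical_set_scope.

(* [topology] also exports a [subspace]. *)
Local Notation subspace := Defs.subspace.

(** * Spans and free families *)

Section LinearSpan.
Variables (k : fieldType) (V : lmodType k).
Implicit Types (P W : set V) (x y : V).

(** The division ring [D] is never built. Rank over [D] is replaced by independence of finite
    families with coefficients in [L_J], and linear algebra over [D] becomes a count over [k]: boxes
    of exponents of side [r] provide more unknowns than equations once [r] is large. This yields the
    Ore condition and division with remainder, denominators cleared. Up to the units [Y^j], the
    degree in [Y] is [width]. The determinant of an element of [D[Y]] would be a class in the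
    abelianised unit group of [D]; only a scalar shadow of it is used, the quotient of the leading
    coefficients of one element for two monomial orders that differ in the direction of [Y]. It is
    multiplicative modulo any subgroup containing the commutation scalars of the variables in play,
    and this suffices to compare an annihilator with its conjugates. In the torsion-free case the
    obstacle is that no dimension over [D] is known to be finite. The bounds come from growth: too
    many independent vectors in boundedly many layers would produce more independent monomials than
    there are spanning ones. *)

Lemma subspace0 W : subspace W -> W 0. Proof. by case. Qed.

Lemma subspaceD W x y : subspace W -> W x -> W y -> W (x + y).
Proof. by move=> [_ sW] Wx Wy; have := sW 1 _ _ Wx Wy; rewrite scale1r. Qed.

Lemma subspaceZ W (a : k) x : subspace W -> W x -> W (a *: x).
Proof. by move=> [W0 sW] Wx; have := sW a _ _ Wx W0; rewrite addr0. Qed.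

Lemma subspace_sum W (I : Type) (r : seq I) (Q : pred I) (F : I -> V) :
  subspace W -> (forall i, Q i -> W (F i)) -> W (\sum_(i <- r | Q i) F i).
Proof.
move=> sW WF; elim/big_rec : _ => [|i x Qi Wx]; first exact: subspace0.
by apply: subspaceD => //; apply: WF.
Qed.

(** The intersection of all subspaces containing [P]: inclusions of spans then need no
    coefficients. *)
Definition lspan P : set V :=
  [set x | forall W, subspace W -> P `<=` W -> W x].

Lemma lspan_subspace P : subspace (lspan P).
Proof.
split=> [W sW _|a u v uP vP W sW PW]; first exact: subspace0.
by apply: subspaceD => //; [apply: subspaceZ => //; apply: uP | apply: vP].
Qed.

Lemma lspan0 P : lspan P 0.
Proof. exact: subspace0 (lspan_subspace P). Qed.

Lemma lspanD P x y : lspan P x -> lspan P y -> lspan P (x + y).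
Proof. exact: subspaceD (lspan_subspace P). Qed.

Lemma lspanZ P a x : lspan P x -> lspan P (a *: x).
Proof. exact: subspaceZ (lspan_subspace P). Qed.

Lemma lspan_sum P (I : Type) (r : seq I) (Q : pred I) (F : I -> V) :
  (forall i, Q i -> lspan P (F i)) -> lspan P (\sum_(i <- r | Q i) F i).
Proof. exact: subspace_sum (lspan_subspace P). Qed.

Lemma sub_lspan P : P `<=` lspan P.
Proof. by move=> x Px W _; apply. Qed.

Lemma lspan_le P W : subspace W -> P `<=` W -> lspan P `<=` W.
Proof. by move=> sW PW x; apply. Qed.

Lemma lspan_mono P P' : P `<=` lspan P' -> lspan P `<=` lspan P'.
Proof. by apply: lspan_le; apply: lspan_subspace. Qed.

Lemma lspan_image (f : V -> V) P P' : lin_map f ->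
  (forall x, P x -> lspan P' (f x)) -> forall x, lspan P x -> lspan P' (f x).
Proof.
move=> linf fP; apply: lspan_le => //; split=> [|a u v uP vP].
  suff -> : f 0 = 0 by exact: lspan0.
  by have := linf (-1) 0 0; rewrite scaler0 addr0 scaleN1r addNr.
rewrite /= linf; have [_] := lspan_subspace P'; exact.
Qed.

Lemma lspan_family (T : finType) (w : T -> V) x :
  lspan (range w) x -> exists c : T -> k, x = \sum_t c t *: w t.
Proof.
apply: (@lspan_le _ [set x | exists c : T -> k, x = \sum_t c t *: w t]).
  split=> [|a _ _ [c ->] [d ->]].
    by exists (fun=> 0); rewrite big1 // => t _; rewrite scale0r.
  exists (fun t => a * c t + d t); rewrite scaler_sumr -big_split /=.
  by apply: eq_bigr => t _; rewrite scalerDl scalerA.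
move=> _ [t _ <-]; exists (fun t' => (t' == t)%:R).
rewrite (bigD1 t) //= eqxx scale1r big1 ?addr0 // => t' /negPf ->.
by rewrite scale0r.
Qed.

(** Indexed by a finite type, so that families over boxes of exponents and products of index types
    need no enumeration. *)
Definition free_family (T : finType) (u : T -> V) : Prop :=
  forall c : T -> k, \sum_t c t *: u t = 0 -> forall t, c t = 0.

(** More rows than columns leave a nonzero left kernel. Besides Steinitz exchange, this drives the
    fraction-free elimination over the torus and, over the rationals, the comparison of ranks of
    groups. *)
Lemma underdetermined_system (T T' : finType) (K : T -> T' -> k) :
  (#|T'| < #|T|)%N ->
  exists c : T -> k,
    (exists t, c t != 0) /\ forall t', \sum_t c t * K t t' = 0.
Proof.
move=> ltT.
pose A : 'M[k]_(#|T|, #|T'|) := \matrix_(i, j) K (enum_val i) (enum_val j).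
have kA0 : kermx A != 0.
  apply/negP => /eqP k0; move: (mxrank_ker A); rewrite k0 mxrank0.
  by have := rank_leq_col A; lia.
case/rowV0Pn: kA0 => u /sub_kermxP uA u0.
exists (fun t => u 0 (enum_rank t)); split.
  have [j uj] : exists j, u 0 j != 0.
    apply: contrapT => h; case/negP: u0; apply/eqP/rowP => j; rewrite mxE.
    by apply: contrapT => uj; apply: h; exists j; apply/eqP.
  by exists (enum_val j); rewrite enum_valK.
move=> t'; have /rowP/(_ (enum_rank t')) := uA; rewrite !mxE => uE.
rewrite -[RHS]uE.
rewrite (reindex (@enum_val T predT)) /=; last first.
  by exists enum_rank => i _; rewrite ?enum_valK ?enum_rankK.
by apply: eq_bigr => i _; rewrite enum_valK mxE enum_rankK.
Qed.

Lemma steinitz (T T' : finType) (u : T -> V) (w : T' -> V) :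
  free_family u -> (forall t, lspan (range w) (u t)) -> (#|T| <= #|T'|)%N.
Proof.
move=> uf uw; rewrite leqNgt; apply/negP => ltT.
have /choice[K uK] : forall t, exists c : T' -> k, u t = \sum_t' c t' *: w t'.
  by move=> t; apply: lspan_family.
have [c [[t ct] cK]] := underdetermined_system K ltT.
case/negP: ct; apply/eqP; apply: (uf c).
under eq_bigr do rewrite uK scaler_sumr.
rewrite exchange_big big1 //= => t' _.
by under eq_bigr do rewrite scalerA; rewrite -scaler_suml cK scale0r.
Qed.

Lemma span_dim_le (T : finType) (w : T -> V) (s : seq V) :
  (forall x, x \in s -> lspan (range w) x) -> (span_dim s <= #|T|)%N.
Proof.
move=> sw; apply/bigmax_leqP => m /asboolP[t [ts tf <-]].
rewrite -[X in (X <= _)%N]card_ord; apply: (@steinitz _ _ (fun i : 'I_(size t) => t`_i) w).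
  exact: tf.
by move=> i; apply: sw; apply: (mem_subseq ts); apply: mem_nth.
Qed.

Lemma free_seq_cons x (s : seq V) :
  free_seq s -> ~ lspan [set` s] x -> free_seq (x :: s).
Proof.
move=> sf nx c; rewrite big_ord_recl /= => c0.
have cx : c ord0 = 0.
  apply: contrapT => /eqP c0n; apply: nx.
  have -> : x = - (c ord0)^-1 *: \sum_(i < size s) c (lift ord0 i) *: s`_i.
    move/eqP: c0; rewrite addr_eq0 => /eqP/(congr1 ( *:%R (c ord0)^-1)).
    by rewrite scalerA mulVf // scale1r => ->; rewrite scalerN scaleNr.
  by apply: lspanZ; apply: lspan_sum => i _; apply: lspanZ; apply: sub_lspan => /=; apply: mem_nth.
move: c0; rewrite cx scale0r add0r => /sf c0 i.
by case: (unliftP ord0 i) => [j ->|->].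
Qed.

(** [span_dim] is a maximum over free subsequences, so a lower bound needs a subsequence of the
    given list that still spans; greedy selection from the right finds it. *)
Lemma free_spanning_subseq (s : seq V) :
  exists t, [/\ subseq t s, free_seq t & forall x, x \in s -> lspan [set` t] x].
Proof.
elim: s => [|x s [t [ts tf tsp]]].
  by exists [::]; split => // c _ [].
have [xt|nxt] := pselect (lspan [set` t] x).
  exists t; split => //; first exact: subseq_trans ts (subseq_cons s x).
  by move=> z; rewrite inE => /orP[/eqP->//|/tsp].
exists (x :: t); split; first by rewrite /= eqxx.
  exact: free_seq_cons.
have tx : [set` t] `<=` lspan [set` x :: t].
  by move=> y yt; apply: sub_lspan; rewrite /= inE yt orbT.
move=> z; rewrite inE => /orP[/eqP->|/tsp].
  by apply: sub_lspan; rewrite /= inE eqxx.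
exact: lspan_mono.
Qed.

Lemma span_dim_ge (T : finType) (u : T -> V) (s : seq V) :
  free_family u -> (forall t, lspan [set` s] (u t)) -> (#|T| <= span_dim s)%N.
Proof.
move=> uf us; have [t [ts tf tsp]] := free_spanning_subseq s.
have leT : (#|T| <= size t)%N.
  rewrite -[X in (_ <= X)%N]card_ord.
  apply: (@steinitz _ _ u (fun i : 'I_(size t) => t`_i) uf) => z.
  apply: lspan_mono (us z) => x /= /tsp; apply: lspan_mono => y /= yt.
  have yi : (index y t < size t)%N by rewrite index_mem.
  by apply: sub_lspan; exists (Ordinal yi) => //=; rewrite nth_index.
apply: leq_trans leT _.
have st : (size t < (size s).+1)%N by rewrite ltnS size_subseq.
apply: (@leq_bigmax_cond _ _ (fun m : 'I_(size s).+1 => m : nat) (Ordinal st)).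
by apply/asboolP; exists t.
Qed.

End LinearSpan.

(** * Monomials of a quantum torus *)

Section LinMap.
Variables (k : fieldType) (V : lmodType k) (f : V -> V).
Hypothesis linf : lin_map f.

Lemma lin_map0 : f 0 = 0.
Proof. by have := linf (-1) 0 0; rewrite scaler0 addr0 scaleN1r addNr. Qed.

Lemma lin_mapD u v : f (u + v) = f u + f v.
Proof. by have := linf 1 u v; rewrite !scale1r. Qed.

Lemma lin_mapZ a u : f (a *: u) = a *: f u.
Proof. by have := linf a u 0; rewrite !addr0 lin_map0 addr0. Qed.

Lemma lin_map_sum (I : Type) (r : seq I) (P : pred I) (F : I -> V) :
  f (\sum_(i <- r | P i) F i) = \sum_(i <- r | P i) f (F i).
Proof. by elim/big_ind2 : _ => [|? ? ? ? <- <-|//]; rewrite ?lin_map0 ?lin_mapD. Qed.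

Lemma lin_map_inverse g : inverse_maps f g -> lin_map g.
Proof. by move=> [fK gK] a u v; apply: (can_inj fK); rewrite linf !gK. Qed.

End LinMap.

Section Cocycle.
Variables (k : fieldType) (N : nat) (q : 'I_N -> 'I_N -> k).
Implicit Types (a b : 'rV[int]_N) (i j : 'I_N) (s : seq 'I_N).

(* [X^a X^b = cocycle a b X^(a + b)] for the ordered monomials [X^a]. *)
Fixpoint cocycle_seq s a b : k :=
  if s is i :: s' then
    (\prod_(j <- s') q j i ^ (a 0 j * b 0 i)) * cocycle_seq s' a b
  else 1.

Definition cocycle := cocycle_seq (enum 'I_N).

(** The scalar in [X_i^m X^a = xcomm i m a X^a X_i^m]. *)
Definition xcomm i (m : int) a : k := \prod_j q i j ^ (m * a 0 j).

Hypothesis q0 : forall i j, q i j != 0.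

Lemma cocycle_neq0 a b : cocycle a b != 0.
Proof.
rewrite /cocycle; elim: (enum _) => [|i s IHs] /=; first exact: oner_neq0.
rewrite mulf_neq0 // prodf_seq_neq0; apply/allP => j _ /=.
by rewrite expfz_neq0.
Qed.

Lemma xcomm_neq0 i m a : xcomm i m a != 0.
Proof. by apply/prodf_neq0 => j _; rewrite expfz_neq0. Qed.

(** Both exponents enter linearly: the cocycle is a bicharacter, and this is what makes the twisted
    product associative. *)
Lemma cocycleDl a a' b : cocycle (a + a') b = cocycle a b * cocycle a' b.
Proof.
rewrite /cocycle; elim: (enum _) => [|i s IHs] /=; first by rewrite mulr1.
rewrite IHs mulrACA -big_split /=; congr (_ * _); apply: eq_bigr => j _.
by rewrite mxE mulrDl expfzDr.
Qed.

Lemma cocycleDr a b b' : cocycle a (b + b') = cocycle a b * cocycle a b'.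
Proof.
rewrite /cocycle; elim: (enum _) => [|i s IHs] /=; first by rewrite mulr1.
rewrite IHs mulrACA -big_split /=; congr (_ * _); apply: eq_bigr => j _.
by rewrite mxE mulrDr expfzDr.
Qed.

Lemma cocycle0r a : cocycle a 0 = 1.
Proof.
by apply: (mulfI (cocycle_neq0 a 0)); rewrite -cocycleDr addr0 mulr1.
Qed.

Lemma cocycle0l a : cocycle 0 a = 1.
Proof.
by apply: (mulfI (cocycle_neq0 0 a)); rewrite -cocycleDl addr0 mulr1.
Qed.

Lemma xcommDr i m a b : xcomm i m (a + b) = xcomm i m a * xcomm i m b.
Proof.
rewrite /xcomm -big_split /=; apply: eq_bigr => j _.
by rewrite mxE mulrDr expfzDr.
Qed.

Lemma xcommDl i m m' a : xcomm i (m + m') a = xcomm i m a * xcomm i m' a.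
Proof.
rewrite /xcomm -big_split /=; apply: eq_bigr => j _.
by rewrite mulrDl expfzDr.
Qed.

Definition subgroup (Gam : set k) : Prop :=
  [/\ Gam 1, forall x y, Gam x -> Gam y -> Gam (x * y)
    & forall x, Gam x -> Gam x^-1].

Lemma subgroupX (Gam : set k) x (m : int) : subgroup Gam -> Gam x -> Gam (x ^ m).
Proof.
move=> [G1 GM GV] Gx.
have GX n : Gam (x ^+ n) by elim: n => [|n IHn]; rewrite ?expr0 // exprS; apply: GM.
by case: m => n; [rewrite -exprnP | rewrite NegzE -exprnN; apply: GV].
Qed.

Lemma subgroup_prod (Gam : set k) (I : eqType) (r : seq I) (P : pred I) (F : I -> k) :
  subgroup Gam -> (forall z, z \in r -> P z -> Gam (F z)) ->
  Gam (\prod_(z <- r | P z) F z).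
Proof.
move=> [G1 GM GV] GF; rewrite big_seq_cond; elim/big_rec : _ => // z x.
by move=> /andP[zr Pz] Gx; apply: GM => //; apply: GF.
Qed.

Lemma subgroup_cocycle (Gam : set k) a b : subgroup Gam ->
  (forall i j, a 0 i != 0 -> b 0 j != 0 -> Gam (q i j)) -> Gam (cocycle a b).
Proof.
move=> sG Gq; have [G1 GM _] := sG.
rewrite /cocycle; elim: (enum _) => [|i s IHs] //=; apply: GM => //.
apply: subgroup_prod => // j _ _.
have [->|aj] := eqVneq (a 0 j) 0; first by rewrite mul0r expr0z.
have [->|bi] := eqVneq (b 0 i) 0; first by rewrite mulr0 expr0z.
by apply: subgroupX => //; apply: Gq.
Qed.

End Cocycle.

Section Monomials.
Variables (k : fieldType) (N : nat) (q : 'I_N -> 'I_N -> k).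
Variables (V : lmodType k) (X Xi : 'I_N -> V -> V).
Hypotheses (q_as : mult_antisym q) (XM : qtorus_module q X Xi).
Implicit Types (a b : 'rV[int]_N) (i j : 'I_N) (v : V).

Let q0 i j : q i j != 0. Proof. by case: q_as. Qed.

Definition xpow i (m : int) : V -> V :=
  match m with Posz m => iter m (X i) | Negz m => iter m.+1 (Xi i) end.

Fixpoint monomial_seq (s : seq 'I_N) a v : V :=
  if s is i :: s' then xpow i (a 0 i) (monomial_seq s' a v) else v.

Definition monomial := monomial_seq (enum 'I_N).

Lemma linX i : lin_map (X i). Proof. by case: XM. Qed.

Lemma XK i : cancel (X i) (Xi i). Proof. by case: XM => _ /(_ i)[]. Qed.

Lemma XiK i : cancel (Xi i) (X i). Proof. by case: XM => _ /(_ i)[]. Qed.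

Lemma linXi i : lin_map (Xi i).
Proof. by apply: (lin_map_inverse (linX i)); split; [apply: XK | apply: XiK]. Qed.

Lemma lin_iter (f : V -> V) n : lin_map f -> lin_map (iter n f).
Proof. by move=> linf; elim: n => [|n IHn] a u v //=; rewrite IHn linf. Qed.

Lemma lin_xpow i m : lin_map (xpow i m).
Proof. by case: m => m; apply: lin_iter; [apply: linX | apply: linXi]. Qed.

Lemma xpowS i m v : xpow i (m + 1) v = X i (xpow i m v).
Proof.
case: m => [m|[|m]]; first by rewrite -PoszD addn1.
  by rewrite /= XiK.
have -> : (Negz m.+1 + 1)%R = Negz m by lia.
by rewrite /= XiK.
Qed.

Lemma xpowP i m v : xpow i (m - 1) v = Xi i (xpow i m v).
Proof. by rewrite -{2}(subrK 1 m) xpowS XK. Qed.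

Lemma xpowD i m l v : xpow i (m + l) v = xpow i m (xpow i l v).
Proof.
elim/int_ind : m => [|m IHm|m IHm]; first by rewrite add0r.
  by rewrite -addn1 PoszD addrAC xpowS IHm -xpowS.
by rewrite -addn1 PoszD opprD addrAC xpowP IHm -xpowP.
Qed.

Lemma X_xpow i j l v : X i (xpow j l v) = q i j ^ l *: xpow j l (X i v).
Proof.
have [_ _ XX] := XM.
elim/int_ind : l => [|l IHl|l IHl]; first by rewrite expr0z scale1r.
  rewrite -addn1 PoszD !xpowS XX IHl (lin_mapZ (linX j)) scalerA.
  by rewrite expfzDr // expr1z mulrC.
rewrite -addn1 PoszD opprD !xpowP; apply: (can_inj (XK j)).
rewrite (lin_mapZ (linX j)) XiK expfzDr // mulrC -scalerA -IHl.
set u := Xi j _; have -> : xpow j (- l%:Z) v = X j u by rewrite XiK.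
by rewrite (XX i j) scalerA exprN1 mulVf // scale1r.
Qed.

Lemma xpow_xpow i j m l v :
  xpow i m (xpow j l v) = q i j ^ (m * l) *: xpow j l (xpow i m v).
Proof.
elim/int_ind : m => [|m IHm|m IHm]; first by rewrite mul0r expr0z scale1r.
  rewrite -addn1 PoszD !xpowS IHm (lin_mapZ (linX i)) X_xpow scalerA.
  by rewrite mulrDl mul1r expfzDr.
rewrite -addn1 PoszD opprD !xpowP; apply: (can_inj (XK i)).
rewrite (lin_mapZ (linX i)) XiK X_xpow XiK IHm scalerA -expfzDr //.
by congr (q i j ^ _ *: _); ring.
Qed.

Lemma lin_monomial a : lin_map (monomial a).
Proof.
rewrite /monomial; elim: (enum _) => [|i s IHs] c u v //=.
by rewrite IHs (lin_xpow i _).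
Qed.

Lemma monomial_seq_xpow s i m a v : monomial_seq s a (xpow i m v) =
  (\prod_(j <- s) q j i ^ (a 0 j * m)) *: xpow i m (monomial_seq s a v).
Proof.
elim: s => [|j s IHs] /=; first by rewrite big_nil scale1r.
by rewrite IHs (lin_mapZ (lin_xpow _ _)) xpow_xpow scalerA big_cons mulrC.
Qed.

(** Each power in [X^b] is carried leftwards past the later factors of [X^a] and merges with its own
    variable; the cocycle collects the scalars. *)
Lemma monomialD a b v :
  monomial a (monomial b v) = cocycle q a b *: monomial (a + b) v.
Proof.
rewrite /monomial /cocycle; elim: (enum _) v => [|i s IHs] v /=.
  by rewrite scale1r.
rewrite monomial_seq_xpow (lin_mapZ (lin_xpow _ _)) -xpowD IHs.
by rewrite (lin_mapZ (lin_xpow _ _)) scalerA mxE.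
Qed.

Lemma xpow_monomial i m a v :
  xpow i m (monomial a v) = xcomm q i m a *: monomial a (xpow i m v).
Proof.
rewrite /monomial /xcomm -big_enum /=.
elim: (enum _) v => [|j s IHs] v /=; first by rewrite big_nil scale1r.
by rewrite xpow_xpow IHs (lin_mapZ (lin_xpow _ _)) scalerA big_cons.
Qed.

Lemma monomial0 v : monomial 0 v = v.
Proof.
by rewrite /monomial; elim: (enum _) => [//|i s IHs] /=; rewrite mxE IHs.
Qed.

Lemma monomial_eq0 a v : monomial a v = 0 -> v = 0.
Proof.
move=> av; have := monomialD (- a) a v.
rewrite av (lin_map0 (lin_monomial _)) addNr monomial0 => /esym/eqP.
by rewrite scaler_eq0 (negPf (cocycle_neq0 q0 _ _)) => /eqP.
Qed.

Definition unit_exp i (m : int) : 'rV[int]_N := \row_j (if j == i then m else 0).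

Lemma monomial_unit_exp i m v : monomial (unit_exp i m) v = xpow i m v.
Proof.
have H s : uniq s ->
    monomial_seq s (unit_exp i m) v = if i \in s then xpow i m v else v.
  elim: s => [//|j s IHs] /= /andP[js us]; rewrite IHs // mxE inE.
  have [ji|ji] := eqVneq j i; first by rewrite -ji (negPf js) /=.
  by case: (i \in s).
by rewrite /monomial H ?enum_uniq // mem_enum.
Qed.

Definition l1norm a : nat := (\sum_i `|a ord0 i|)%N.

Lemma l1normD a b : (l1norm (a + b) <= l1norm a + l1norm b)%N.
Proof.
rewrite /l1norm -big_split /=; apply: leq_sum => i _; rewrite mxE.
by move: (a ord0 i) (b ord0 i) => x y; lia.
Qed.

Lemma l1norm_unit_exp i m : l1norm (unit_exp i m) = `|m|%N.
Proof.
rewrite /l1norm (bigD1 i) //= mxE eqxx big1 ?addn0 // => j /negPf ji.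
by rewrite mxE ji.
Qed.

Definition l1ball v R : set V := [set monomial a v | a in [set a | (l1norm a <= R)%N]].

Lemma l1ball_le v R R' : (R <= R')%N -> l1ball v R `<=` l1ball v R'.
Proof. by move=> RR _ [a aR <-]; exists a => //; apply: leq_trans RR. Qed.

(** Only membership in the list of generators is constrained, so that one development serves both
    [qtorus_gens] and the list extended by [Y] and its inverse. *)
Variable gens : seq (V -> V).
Hypothesis gensP : forall g, List.In g gens <-> exists i, g = X i \/ g = Xi i.

Lemma mem_word_step (s : seq V) x :
  reflect (exists g, List.In g gens /\ exists2 y, y \in s & x = g y)
          (x \in flatten [seq map g s | g <- gens]).
Proof.
clear gensP; elim: gens => [|g gs IHg] /=.
  by constructor => -[? []].
rewrite mem_cat; apply: (iffP orP).
  case=> [/mapP[y ys ->]|xg].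
    by exists g; split; [left | exists y].
  have [h [hg [y ys xE]]] := elimT IHg xg.
  by exists h; split; [right | exists y].
case=> h [[<-|hg] [y ys xE]]; first by left; rewrite xE; apply: map_f.
by right; apply: (introT IHg); exists h; split => //; exists y.
Qed.

Lemma lin_gens g : List.In g gens -> lin_map g.
Proof. by move=> /gensP[i [->|->]]; [apply: linX | apply: linXi]. Qed.

Lemma gens_ball g v R x : List.In g gens ->
  lspan (l1ball v R) x -> lspan (l1ball v R.+1) (g x).
Proof.
move=> gg; apply: lspan_image; first exact: lin_gens.
move=> z [a aR <-].
have [i [m [m1 ->]]] : exists i m, `|m|%N = 1%N /\ g = xpow i m.
  by have [i [->|->]] := (gensP g).1 gg; exists i; [exists 1 | exists (-1)].
rewrite -monomial_unit_exp monomialD; apply: lspanZ; apply: sub_lspan.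
exists (unit_exp i m + a) => //=; apply: leq_trans (l1normD _ _) _.
by rewrite l1norm_unit_exp m1 add1n ltnS.
Qed.

Lemma word_span_ball v (m0 : seq V) K R :
  (forall x, x \in m0 -> lspan (l1ball v K) x) ->
  forall x, x \in word_span gens m0 R -> lspan (l1ball v (K + R)) x.
Proof.
move=> m0K; elim: R => [|R IHR] x /=; first by rewrite addn0; apply: m0K.
rewrite mem_cat => /orP[/IHR|/mem_word_step[g [gg [y /IHR yR ->]]]].
  apply: lspan_mono => z zb; apply: sub_lspan; apply: l1ball_le zb.
  by rewrite addnS.
by rewrite addnS; apply: gens_ball.
Qed.

(** [word_span] gains one letter per level and each level removes one letter of the monomial, so
    radius and word length match exactly. *)
Lemma monomial_word_span v R a : (l1norm a <= R)%N ->
  lspan [set` word_span gens [:: v] R] (monomial a v).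
Proof.
elim: R a => [|R IHR] a /=.
  rewrite leqn0 sum_nat_eq0 => /forall_inP a0.
  suff -> : a = 0 by rewrite monomial0; apply: sub_lspan; rewrite /= inE.
  by apply/rowP => i; rewrite mxE; apply/eqP; rewrite -absz_eq0; apply: a0.
move=> aR; have [a0|[i ai]] : (l1norm a = 0%N) \/ exists i, a 0 i != 0.
- have [->|an] := eqVneq a 0; first by left; rewrite /l1norm big1 // => i _; rewrite mxE.
  right; apply: contrapT => h; case/negP: an; apply/eqP/rowP => i; rewrite mxE.
  by apply: contrapT => ai; apply: h; exists i; apply/eqP.
- have : (l1norm a <= R)%N by rewrite a0.
  move=> /IHR; apply: lspan_mono => x /= xR; apply: sub_lspan => /=.
  by rewrite mem_cat xR.
(* [m] is the sign of the exponent, so subtracting it shortens the monomial by one letter. *)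
have [m [m1 am]] : exists m : int, `|m|%N = 1%N /\ (`|(a 0 i - m)%R| < `|(a 0 i)%R|)%N.
  move: (a 0 i) ai => x x0; have : (0 < x) || (x < 0) by lia.
  by case/orP => ?; [exists 1 | exists (-1)]; split => //; lia.
have a'R : (l1norm (a - unit_exp i m) <= R)%N.
  rewrite -ltnS; apply: leq_trans aR; rewrite /l1norm (bigD1 i) //=.
  rewrite [X in (_ < X)%N](bigD1 i) //= !mxE eqxx -addSn leq_add //.
  by apply: eq_leq; apply: eq_bigr => j /negPf ji; rewrite !mxE ji subr0.
have -> : monomial a v = (cocycle q (unit_exp i m) (a - unit_exp i m))^-1 *:
    xpow i m (monomial (a - unit_exp i m) v).
  rewrite -monomial_unit_exp monomialD scalerA mulVf ?cocycle_neq0 // scale1r.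
  by rewrite addrC subrK.
apply: lspanZ; have [g gg ->] : exists2 g, List.In g gens & xpow i m = g.
  have : m = 1 \/ m = -1 by lia.
  by case=> ->; [exists (X i) | exists (Xi i)] => //; apply/gensP; exists i; [left|right].
apply: lspan_image (IHR _ a'R); first exact: lin_gens.
move=> x xR; apply: sub_lspan => /=; rewrite mem_cat; apply/orP; right.
by apply/mem_word_step; exists g; split => //; exists x.
Qed.

(** The union of the spans of the balls contains [v] and is stable under the generators. *)
Lemma simple_cyclic v : simple_module gens -> v != 0 ->
  forall x, exists R, lspan (l1ball v R) x.
Proof.
move=> [_ simV] v0.
pose W := [set x | exists R, lspan (l1ball v R) x].
have WT : W = setT.
  have sW : subspace W.
    split; first by exists 0%N; apply: lspan0.
    move=> c x y [R xR] [R' yR]; exists (R + R')%N.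
    apply: lspanD; first apply: lspanZ.
      by apply: lspan_mono xR => z /(l1ball_le (leq_addr R' R)); apply: sub_lspan.
    by apply: lspan_mono yR => z /(l1ball_le (leq_addl R R')); apply: sub_lspan.
  case: (simV W sW) => // [g x gg [R xR]|W0].
    by exists R.+1; apply: gens_ball.
  case/negP: v0; apply/eqP; have : W v.
    exists 0%N; apply: sub_lspan; exists 0; last exact: monomial0.
    by rewrite /= /l1norm big1 // => i _; rewrite mxE.
  by rewrite W0.
by move=> x; have : setT x by []; rewrite -WT.
Qed.

End Monomials.

(** * Growth and Gelfand-Kirillov dimension *)

Section BaseDigits.
Variable B : nat.

Lemma digits_lt N (m : 'I_N -> nat) :
  (forall i, m i < B)%N -> (\sum_i m i * B ^ i < B ^ N)%N.
Proof.
elim: N m => [|N IHN] m mB; first by rewrite big_ord0.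
rewrite big_ord_recr /= expnS.
have := IHN (fun i => m (widen_ord (leqnSn N) i)) (fun=> mB _).
have := mB ord_max; set s := (\sum_i _)%N; set b := (B ^ N)%N; nia.
Qed.

(** Base [B] expansions break ties between exponent vectors of equal total degree in the weight that
    governs the rewriting of monomials. *)
Lemma digits_inj N (m m' : 'I_N -> nat) :
  (forall i, m i < B)%N -> (forall i, m' i < B)%N ->
  (\sum_i m i * B ^ i = \sum_i m' i * B ^ i)%N -> m =1 m'.
Proof.
elim: N m m' => [|N IHN] m m' mB mB'; first by move=> _ [].
pose sh (m : 'I_N.+1 -> nat) i := m (widen_ord (leqnSn N) i).
have shB l : (forall i, l i < B)%N -> (\sum_i sh l i * B ^ i < B ^ N)%N.
  by move=> lB; apply: digits_lt => i; apply: lB.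
rewrite !big_ord_recr /= => E.
have mN : m ord_max = m' ord_max.
  have := shB _ mB; have := shB _ mB'; move: E; rewrite /sh.
  set s := (\sum_i _)%N; set s' := (\sum_i _)%N; set b := (B ^ N)%N.
  move=> E sb s'b; have b0 : (0 < b)%N by lia.
  have := congr1 (fun x => x %/ b)%N E.
  by rewrite ![(_ + _ * b)%N]addnC !divnMDl // !divn_small // !addn0.
move: E; rewrite mN => /addIn E.
have {}E := IHN (sh m) (sh m') (fun=> mB _) (fun=> mB' _) E.
move=> i; have [iN|iN] := ltnP i N.
  have -> : i = widen_ord (leqnSn N) (Ordinal iN) by apply: val_inj.
  exact: (E (Ordinal iN)).
have -> : i = ord_max by apply: val_inj => /=; have := ltn_ord i; lia.
exact: mN.
Qed.

End BaseDigits.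

Section Box.
Variables (N : nat) (J : {set 'I_N}) (R : nat).
Implicit Type f : {ffun {i : 'I_N | i \in J} -> 'I_R}.

Definition box f : 'rV[int]_N :=
  \row_i (if insub i is Some z then (f z : nat)%:Z else 0).

Lemma box_val f (z : {i : 'I_N | i \in J}) : box f 0 (val z) = (f z : nat)%:Z.
Proof. by rewrite mxE valK. Qed.

Lemma box_out f i : i \notin J -> box f 0 i = 0.
Proof. by move=> iJ; rewrite mxE insubN. Qed.

Lemma box_bounds f i : 0 <= box f 0 i <= R%:Z.
Proof. by rewrite mxE; case: insub => [z|]; [have := ltn_ord (f z)|]; lia. Qed.

Lemma box_inj : injective box.
Proof.
move=> f g fg; apply/ffunP => z; apply/val_inj/eqP; rewrite -eqz_nat.
by rewrite -!box_val fg.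
Qed.

Lemma box_onto (a : 'rV[int]_N) : (forall i, i \notin J -> a 0 i = 0) ->
  (forall i, i \in J -> 0 <= a 0 i < R%:Z) -> exists f, box f = a.
Proof.
move=> aJ aR.
have lt_a (z : {i : 'I_N | i \in J}) : (`|(a 0 (val z))%R| < R)%N.
  by have := aR _ (valP z); move: (a 0 (val z)) => x; lia.
exists [ffun z => Ordinal (lt_a z)]; apply/rowP => i.
have [iJ|iJ] := boolP (i \in J); last by rewrite box_out // aJ.
have -> : i = val (exist _ i iJ : {i : 'I_N | i \in J}) by [].
rewrite box_val ffunE /=; have := aR i iJ; move: (a 0 i) => x; lia.
Qed.

Lemma card_box : #|{ffun {i : 'I_N | i \in J} -> 'I_R}| = (R ^ #|J|)%N.
Proof. by rewrite card_ffun card_sig card_ord; congr (_ ^ _)%N; apply: eq_card. Qed.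

Lemma l1norm_box f : (l1norm (box f) <= #|J| * R)%N.
Proof.
rewrite /l1norm (bigID (mem J)) /= [X in (_ + X)%N]big1 => [|i iJ].
  rewrite addn0 -sum_nat_const; apply: leq_sum => i _.
  by have := box_bounds f i; move: (box f _ i) => x; lia.
by rewrite (box_out _ iJ).
Qed.

End Box.

Section GKDimension.
Variables (k : fieldType) (N : nat) (q : 'I_N -> 'I_N -> k).
Variables (V : lmodType k) (X Xi : 'I_N -> V -> V).
Hypotheses (q_as : mult_antisym q) (XM : qtorus_module q X Xi).
Implicit Types (a b : 'rV[int]_N) (v : V) (J : {set 'I_N}).

Let q0 i j : q i j != 0. Proof. by case: q_as. Qed.
Local Notation Xmon := (monomial X Xi).

(* The quantum torus on the [X_j], [j] in [J], acts freely on [v]. *)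
Definition free_monomials J v : Prop :=
  forall (T : finType) (e : T -> 'rV[int]_N), injective e ->
    (forall t i, i \notin J -> e t 0 i = 0) ->
    free_family (fun t => Xmon (e t) v).

(** Inside the orthant with signs [eps] exponents are natural numbers, so divisibility of monomials
    and termination make sense despite the inverses. *)
Definition signed (eps : 'I_N -> bool) (m : 'I_N -> nat) : 'rV[int]_N :=
  \row_i (if eps i then - (m i)%:Z else (m i)%:Z).

Lemma signedD eps m m' :
  signed eps (fun i => m i + m' i)%N = signed eps m + signed eps m'.
Proof. by apply/rowP => i; rewrite !mxE; case: (eps i); lia. Qed.

(** The variables act invertibly, so one relation can be multiplied into every orthant, with a bound
    [t0] on its exponents that is uniform in the orthant. *)
Lemma orthant_relation J v : ~ free_monomials J v ->
  exists t0, forall eps, exists (T : finType) (m : T -> 'I_N -> nat) (c : T -> k),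
    [/\ exists t, c t != 0, forall t t', m t =1 m t' -> t = t',
        forall t i, i \notin J -> m t i = 0%N, forall t i, (m t i <= t0)%N
      & \sum_t c t *: Xmon (signed eps (m t)) v = 0].
Proof.
move=> /existsNP[T /existsNP[e /not_implyP[einj /not_implyP[eJ]]]].
move=> /existsNP[c /not_implyP[c0 /existsNP[t /eqP ct]]].
pose L := (\max_t l1norm (e t))%N.
have eL t' i : (`|(e t' 0 i)%R| <= L)%N.
  apply: leq_trans (leq_bigmax t'); rewrite /l1norm (bigD1 i) //=.
  exact: leq_addr.
exists (L + L)%N => eps.
(* [L] bounds the exponents of the relation; a shift by [L] towards the orthant gives all of them
   the prescribed sign and size at most [L + L]. *)
pose b : 'rV[int]_N := \row_i (if i \in J then (if eps i then - L%:Z else L%:Z) else 0).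
pose m t' i := `|(b 0 i + e t' 0 i)%R|%N.
have be t' : signed eps (m t') = b + e t'.
  apply/rowP => i; rewrite !mxE /m mxE.
  have [iJ|iJ] := boolP (i \in J); last by rewrite (eJ _ _ iJ); case: (eps i).
  by have := eL t' i; move: (e t' 0 i) => x; case: (eps i); lia.
exists T, m, (fun t' => c t' * cocycle q b (e t')); split.
- by exists t; rewrite mulf_neq0 // cocycle_neq0.
- move=> t1 t2 mt; apply: einj; apply: (addrI b); rewrite -!be.
  by apply/rowP => i; rewrite !mxE mt.
- by move=> t' i iJ; rewrite /m mxE (negPf iJ) eJ.
- move=> t' i; rewrite /m mxE; have := eL t' i; move: (e t' 0 i) => x.
  by case: ifP => // _; case: (eps i); lia.
under eq_bigr => t' _ do rewrite be -scalerA -(monomialD q_as XM).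
transitivity (Xmon b (\sum_t' c t' *: Xmon (e t') v)); last first.
  by rewrite c0 (lin_map0 (lin_monomial XM _)).
rewrite (lin_map_sum (lin_monomial XM _)); apply: eq_bigr => t' _.
by rewrite (lin_mapZ (lin_monomial XM _)).
Qed.

(** Rewriting inside a fixed orthant: a monomial with more than [D] large exponents is divisible by
    the leading monomial of a relation supported on some of those positions, and the relation trades
    it for monomials of smaller weight. What survives has at most [D] large exponents, which leaves
    of the order of [R ^ D] possibilities. *)
Lemma monomial_growth (I : {set 'I_N}) D v :
  (forall J, J \subset I -> #|J| = D.+1 -> ~ free_monomials J v) ->
  exists C, forall R, exists (T : finType) (w : T -> V),
    (#|T| <= C * R.+1 ^ D)%N /\
    forall a, (forall i, i \notin I -> a 0 i = 0) -> (l1norm a <= R)%N ->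
      lspan (range w) (Xmon a v).
Proof.
move=> torsI.
have /choice[t0 t0P] : forall J, exists t0, J \subset I -> #|J| = D.+1 ->
    forall eps, exists (T : finType) (m : T -> 'I_N -> nat) (c : T -> k),
    [/\ exists t, c t != 0, forall t t', m t =1 m t' -> t = t',
        forall t i, i \notin J -> m t i = 0%N, forall t i, (m t i <= t0)%N
      & \sum_t c t *: Xmon (signed eps (m t)) v = 0].
  move=> J; have [[JI cJ]|nJ] := pselect (J \subset I /\ #|J| = D.+1).
    by have [t0 t0P] := orthant_relation (torsI J JI cJ); exists t0.
  by exists 0%N => JI cJ; case: nJ.
(* All relations have exponents below [t1], so a monomial with exponents at least [t1] on [J] is
   divisible by each of their terms. *)
pose t1 := (\max_J t0 J).+1.
exists (2 ^ N * N.+1 ^ D * t1.+1 ^ N)%N => R.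
pose T := ({ffun 'I_N -> bool} * {ffun 'I_D -> option 'I_N} *
           {ffun 'I_D -> 'I_R.+1} * {ffun 'I_N -> 'I_t1.+1})%type.
(* A monomial with at most [D] exponents [>= t1] is encoded by its signs, the
   positions and values of the large exponents, and the small exponents. *)
pose dec (x : T) i : nat :=
  if [pick j | x.1.1.2 j == Some i] is Some j then x.1.2 j : nat else x.2 i.
pose w (x : T) := Xmon (signed x.1.1.1 (dec x)) v.
exists T, w; split.
  rewrite !card_prod !card_ffun card_bool card_option !card_ord.
  by rewrite [X in (X <= _)%N]mulnAC.
suff H (eps : {ffun 'I_N -> bool}) (m : 'I_N -> nat) :
    (forall i, i \notin I -> m i = 0%N) -> (\sum_i m i <= R)%N ->
    lspan (range w) (Xmon (signed eps m) v).
  move=> a aI aR.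
  have -> : a = signed [ffun i => a 0 i < 0] (fun i => `|(a 0 i)%R|%N).
    by apply/rowP => i; rewrite mxE ffunE; move: (a 0 i) => x; case: ifP; lia.
  by apply: H => // i /aI ->.
(* [B] exceeds both [R] and the exponents of the relations, so base [B] digits never overflow. *)
pose B := (R + t1).+1.
(* Total degree dominates and the digits break ties. The weight is additive, so a leading term stays
   leading after multiplication by a monomial. *)
pose wt (m : 'I_N -> nat) := (\sum_i m i * (B ^ N + B ^ i))%N.
have wtE m' : wt m' = ((\sum_i m' i) * B ^ N + \sum_i m' i * B ^ i)%N.
  by rewrite big_distrl -big_split; apply: eq_bigr => i _; rewrite mulnDr.
have [n] := ubnP (wt m); elim: n m => // n IHn m; rewrite ltnS => wtn mI mR.
have mR' i : (m i <= R)%N.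
  by apply: leq_trans mR; rewrite (bigD1 i) //=; apply: leq_addr.
pose K : {set 'I_N} := [set i | (t1 <= m i)%N]%SET.
have [cK|cK] := leqP #|K| D.
  pose kap : {ffun 'I_D -> option 'I_N} := [ffun j : 'I_D => nth None (map Some (enum K)) j].
  pose val : {ffun 'I_D -> 'I_R.+1} :=
    [ffun j : 'I_D => inord (if kap j is Some i then m i else 0%N)].
  pose x : T := (eps, kap, val, [ffun i => inord (m i)]).
  apply: sub_lspan; exists x => //; rewrite /w /=; congr (Xmon _ _).
  apply/rowP => i; rewrite !mxE; suff -> : dec x i = m i by [].
  rewrite /dec /=; case: pickP => [j /eqP kj|nj].
    by rewrite ffunE kj inordK // ltnS.
  rewrite ffunE inordK // ltnS; apply: ltnW.
  rewrite ltnNge; apply/negP => t1m.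
  have iK : i \in enum K by rewrite mem_enum inE.
  have iD : (index i (enum K) < D)%N.
    by apply: leq_trans cK; rewrite cardE index_mem.
  have := nj (Ordinal iD); rewrite ffunE /= (nth_map i) ?index_mem //.
  by rewrite nth_index // eqxx.
have [J JK cJ] : exists2 J : {set 'I_N}, J \subset K & #|J| = D.+1.
  have /card_geqP[s [us ss sK]] := cK.
  exists [set i in s]%SET; first by apply/fintype.subsetP => i; rewrite inE; apply: sK.
  by rewrite cardsE -ss; apply/card_uniqP.
have JI : J \subset I.
  apply/fintype.subsetP => i /(fintype.subsetP JK); rewrite inE => t1m; apply: contraTT t1m.
  by move=> /mI ->.
have [T' [m_ [c [[t ct] minj mJ mt0 rel]]]] := t0P J JI cJ eps.
have mt1 t' i : (m_ t' i < t1)%N.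
  by rewrite ltnS; apply: leq_trans (mt0 _ _) (leq_bigmax J).
have [ts cts tsmax] :
    exists2 ts, c ts != 0 & forall t', c t' != 0 -> (wt (m_ t') <= wt (m_ ts))%N.
  by case: (@arg_maxnP _ t (fun t' => c t' != 0) (fun t' => wt (m_ t')) ct) => ts; exists ts.
pose m' i := (m i - m_ ts i)%N.
have mE i : m i = (m' i + m_ ts i)%N.
  rewrite subnK //; have [iJ|iJ] := boolP (i \in J); last by rewrite mJ.
  by have := fintype.subsetP JK i iJ; rewrite inE; have := mt1 ts i; lia.
have wtD m1 m2 : wt (fun i => m1 i + m2 i)%N = (wt m1 + wt m2)%N.
  by rewrite /wt -big_split; apply: eq_bigr => i _; rewrite mulnDl.
have wtm : wt m = (wt m' + wt (m_ ts))%N.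
  by rewrite -wtD; apply: eq_bigr => i _; rewrite mE.
have wt_lt t' : c t' != 0 -> t' != ts -> (wt (m_ t') < wt (m_ ts))%N.
  move=> ct' t'ts; rewrite ltn_neqAle tsmax // andbT; apply: contraNneq t'ts => E.
  have mB t2 i : (m_ t2 i < B)%N by have := mt1 t2 i; rewrite /B; lia.
  apply/eqP/minj/(digits_inj (mB _) (mB _)).
  move: E; rewrite !wtE => /(congr1 (fun x => x %% B ^ N)%N).
  by rewrite !modnMDl !modn_small //; apply: digits_lt.
have Xm : Xmon (signed eps m) v = - \sum_(t' | t' != ts)
    ((c ts * cocycle q (signed eps m') (signed eps (m_ ts)))^-1 * c t' *
      cocycle q (signed eps m') (signed eps (m_ t'))) *:
    Xmon (signed eps (fun i => m' i + m_ t' i)%N) v.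
  have Z0 : c ts * cocycle q (signed eps m') (signed eps (m_ ts)) != 0.
    by rewrite mulf_neq0 // cocycle_neq0.
  have := congr1 (Xmon (signed eps m')) rel.
  rewrite (lin_map_sum (lin_monomial XM _)) (lin_map0 (lin_monomial XM _)).
  rewrite (bigD1 ts) //= (lin_mapZ (lin_monomial XM _)) (monomialD q_as XM) scalerA.
  move=> /eqP; rewrite addr_eq0 => /eqP.
  move=> /(congr1 ( *:%R (c ts * cocycle q (signed eps m') (signed eps (m_ ts)))^-1)).
  rewrite scalerA mulVf // scale1r -signedD => E.
  have -> : signed eps m = signed eps (fun i => m' i + m_ ts i)%N.
    by apply/rowP => i; rewrite !mxE mE.
  rewrite [LHS]E scalerN scaler_sumr; congr (- _); apply: eq_bigr => t' _.
  by rewrite (lin_mapZ (lin_monomial XM _)) (monomialD q_as XM) !scalerA signedD.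
rewrite Xm -scaleN1r; apply: lspanZ; apply: lspan_sum => t' t'ts.
have [->|ct'] := eqVneq (c t') 0; first by rewrite mulr0 mul0r scale0r; apply: lspan0.
have lt_wt : (wt (fun i => m' i + m_ t' i) < wt m)%N.
  by rewrite wtD wtm ltn_add2l wt_lt.
apply: lspanZ; apply: IHn.
- exact: leq_trans lt_wt _.
- move=> i iI; rewrite mJ; last by apply: contra iI; apply: (fintype.subsetP JI).
  by rewrite addn0 /m' mI.
(* A smaller weight cannot come with a larger total degree, since the digits of [m] contribute less
   than [B ^ N]. The rewriting thus stays in the ball of radius [R]. *)
- apply: leq_trans mR.
  have : (\sum_i m i * B ^ i < B ^ N)%N.
    by apply: digits_lt => i; have := mR' i; rewrite /B; lia.
  move: lt_wt; rewrite !wtE; move: (\sum_i _ * _)%N (\sum_i _ * _)%N => x y.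
  move: (\sum_i _)%N (\sum_i _)%N (B ^ N)%N => s s' b lt1 lt2.
  by rewrite leqNgt; apply/negP => ss; nia.
Qed.

Lemma free_monomials_box J v R : free_monomials J v ->
  free_family (fun f : {ffun {i : 'I_N | i \in J} -> 'I_R} => Xmon (box f) v).
Proof. by apply; [apply: box_inj | move=> f i; apply: box_out]. Qed.

End GKDimension.

(** * Logarithmic growth rates *)

Section LogGrowth.
Variable R : realType.

Lemma ln_nat_unbounded (x : R) : exists n0, forall n, (n0 <= n)%N -> x <= ln (n%:R : R).
Proof.
exists (Num.bound (expR x)) => n le_n.
have le_x : expR x <= n%:R.
  apply: le_trans (_ : (Num.bound (expR x))%:R <= _); last by rewrite ler_nat.
  by apply: ltW; apply: archi_boundP; apply: expR_ge0.
rewrite -(expRK x) ler_ln //; rewrite posrE ?expR_gt0 //.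
exact: lt_le_trans (expR_gt0 x) le_x.
Qed.

Lemma limn_esup_log_le (f : nat -> nat) C K D :
  (forall n, f n <= C * (K + n).+1 ^ D)%N ->
  (limn_esup (fun n => (ln (f n)%:R / ln (n%:R : R))%:E) <= (D%:R)%:E)%E.
Proof.
move=> fC; apply/lee_addgt0Pr => e e0.
(* [(K + n).+1 <= K.+2 * n] for positive [n]; the outer successor keeps the constant positive when
   [C] is 0. *)
pose C' := (C * K.+2 ^ D).+1.
have [n0 n0P] := ln_nat_unbounded (ln (C'%:R : R) / e).
apply: (@le_trans _ _ (ereal_sup ((fun n => (ln (f n)%:R / ln (n%:R : R))%:E) @`
    [set n | (maxn n0 2 <= n)%N]))).
  apply: ereal_inf_lbound; exists [set n | (maxn n0 2 <= n)%N] => //.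
  exact: nbhs_infty_ge.
apply: ge_ereal_sup => _ [n /= n2 <-].
have n1 : (1 < n)%N by lia.
have ln0 : 0 < ln (n%:R : R) by rewrite ln_gt0 // ltr1n.
rewrite -EFinD lee_fin ler_pdivrMr // mulrDl.
have C'0 : (C'%:R : R) \is Num.pos by rewrite posrE ltr0n.
have nD0 : (n%:R ^+ D : R) \is Num.pos by rewrite posrE exprn_gt0 // ltr0n; lia.
have leC : ln (C'%:R : R) <= e * ln n%:R.
  by rewrite mulrC -ler_pdivrMr //; apply: n0P; lia.
rewrite mulr_natl -lnXn ?ltr0n; last by lia.
apply: (@le_trans _ _ (ln (C'%:R * n%:R ^+ D))); last first.
  by rewrite lnM // addrC lerD2l.
(* The value 0 is treated apart because monotonicity of [ln] asks for positive arguments. *)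
have [f0|f0] := posnP (f n).
  rewrite f0; apply: (@le_trans _ _ 0); first by apply: ln_le0; apply: ler01.
  apply: ln_ge0; rewrite -natrX -natrM ler1n muln_gt0 expn_gt0 /C'.
  by apply/andP; split => //; apply/orP; left; lia.
rewrite ler_ln; [|by rewrite posrE ltr0n|by rewrite posrE mulr_gt0 // -posrE].
rewrite -natrX -natrM ler_nat; apply: leq_trans (fC n) _.
apply: (@leq_trans (C * (K.+2 * n) ^ D)); last first.
  by rewrite expnMn mulnA leq_mul2r; apply/orP; right; rewrite /C'; lia.
rewrite leq_mul2l; apply/orP; right; case: D {fC C' n0P C'0 nD0 leC} => // D.
by rewrite leq_exp2r //; nia.
Qed.

Lemma limn_esup_log_ge (f : nat -> nat) c D :
  (forall n, n ^ D <= c * f n)%N ->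
  ((D%:R)%:E <= limn_esup (fun n => (ln (f n)%:R / ln (n%:R : R))%:E))%E.
Proof.
move=> fc; apply/lee_subgt0Pr => e e0.
apply: le_ereal_inf_tmp => _ [A [m _ mA] <-].
have [n0 n0P] := ln_nat_unbounded (ln (c%:R : R) / e).
(* One sufficiently large index of the tail already bounds its supremum from below. *)
pose n := maxn (maxn n0 2) m.
apply: (@le_trans _ _ (ln (f n)%:R / ln (n%:R : R))%:E); last first.
  apply: ereal_sup_ubound; exists n => //; apply: mA => /=; exact: leq_maxr.
have n1 : (1 < n)%N by rewrite /n; lia.
have ln0 : 0 < ln (n%:R : R) by rewrite ln_gt0 // ltr1n.
have cf0 : (0 < c * f n)%N by apply: leq_trans (fc n); rewrite expn_gt0; lia.
have [c0 f0] : (0 < c)%N /\ (0 < f n)%N by move: cf0; rewrite muln_gt0 => /andP[].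
rewrite -EFinB lee_fin ler_pdivlMr // mulrBl.
have leC : ln (c%:R : R) <= e * ln n%:R.
  by rewrite mulrC -ler_pdivrMr //; apply: n0P; rewrite /n; lia.
rewrite mulr_natl -lnXn ?ltr0n; last by lia.
rewrite lerBlDr; apply: le_trans (_ : ln (f n)%:R + ln c%:R <= _); last first.
  by rewrite lerD2l.
rewrite -lnM ?posrE ?ltr0n // ler_ln ?posrE ?mulr_gt0 ?exprn_gt0 ?ltr0n //; last by lia.
by rewrite -natrX -natrM ler_nat mulnC.
Qed.

End LogGrowth.

Section GKTheorem.
Variables (k : fieldType) (N : nat) (q : 'I_N -> 'I_N -> k).
Variables (V : lmodType k) (X Xi : 'I_N -> V -> V).
Hypotheses (q_as : mult_antisym q) (XM : qtorus_module q X Xi).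
Variable gens : seq (V -> V).
Hypothesis gensP : forall g, List.In g gens <-> exists i, g = X i \/ g = Xi i.

(** The upper bound concerns every finite list [m0]; as [v] generates, [m0] lies in a ball around
    [v], which only shifts the radius. The lower bound uses the single start [v] and boxes of
    monomials on [J]. *)
Lemma GKdim_free_monomials v (J : {set 'I_N}) :
  (forall x, exists R, lspan (l1ball X Xi v R) x) ->
  free_monomials X Xi J v ->
  (forall J', free_monomials X Xi J' v -> (#|J'| <= #|J|)%N) ->
  GKdim gens = (#|J|%:R)%:E.
Proof.
move=> cyc freeJ maxJ.
have [C CP] : exists C, forall R, exists (T : finType) (w : T -> V),
    (#|T| <= C * R.+1 ^ #|J|)%N /\
    forall a : 'rV[int]_N, (forall i, i \notin [set: 'I_N]%SET -> a 0 i = 0) -> (l1norm a <= R)%N ->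
      lspan (range w) (monomial X Xi a v).
  apply: (monomial_growth q_as XM) => J' _ cJ' /maxJ; rewrite cJ'; lia.
have upper (m0 : seq V) : exists K, forall R,
    (span_dim (word_span gens m0 R) <= C * (K + R).+1 ^ #|J|)%N.
  have [K KP] : exists K, forall x, x \in m0 -> lspan (l1ball X Xi v K) x.
    elim: m0 => [|y m0 [K KP]]; first by exists 0%N.
    have [K' yK'] := cyc y; exists (K + K')%N => x.
    rewrite inE => /orP[/eqP->|/KP xK].
      by apply: lspan_mono yK' => z /(l1ball_le (leq_addl K K')); apply: sub_lspan.
    by apply: lspan_mono xK => z /(l1ball_le (leq_addr K' K)); apply: sub_lspan.
  exists K => R; have [T [w [cT wP]]] := CP (K + R)%N.
  apply: leq_trans cT; apply: (@span_dim_le _ _ _ w) => x.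
  move=> /(word_span_ball q_as XM gensP KP); apply: lspan_mono => z [a aR <-].
  by apply: wP => // i; rewrite finset.in_setT.
apply/eqP; rewrite eq_le; apply/andP; split.
  apply: ge_ereal_sup => _ [m0 _ <-]; have [K KP] := upper m0.
  exact: limn_esup_log_le KP.
apply: le_trans (ereal_sup_ubound _); last by exists [:: v].
(* A box with exponents up to [R %/ d] in [d] coordinates fits in the ball of radius [R], and
   [R ^ d <= d ^ d * (R %/ d).+1 ^ d]. *)
apply: (@limn_esup_log_ge _ _ (#|J| ^ #|J|)) => R.
set d := #|J|; apply: (@leq_trans ((d * (R %/ d).+1) ^ d)).
  have [->|d0] := posnP d; first by rewrite !expn0.
  by rewrite leq_exp2r // {1}(divn_eq R d); have := ltn_pmod R d0; nia.
rewrite expnMn leq_mul2l; apply/orP; right.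
rewrite -(card_box J (R %/ d).+1).
apply: (span_dim_ge (free_monomials_box (R := (R %/ d).+1) freeJ)) => f.
have [d0|d0] := posnP d.
  apply: (monomial_word_span q_as XM gensP).
  by apply: leq_trans (l1norm_box f) _; rewrite -/d d0.
apply: (monomial_word_span q_as XM gensP).
apply: leq_trans (_ : d * (R %/ d) <= _)%N; last by rewrite mulnC leq_trunc_div.
rewrite /l1norm (bigID (mem J)) /= [X in (_ + X)%N]big1 => [|i iJ].
  rewrite addn0 /d -sum_nat_const; apply: leq_sum => i iJ.
  rewrite -[i]/(val (exist _ i iJ : {i | i \in J})) box_val /=.
  by rewrite -ltnS; apply: ltn_ord.
by rewrite (box_out _ iJ).
Qed.

End GKTheorem.

(** * Quantum tori as twisted group algebras *)

Section Submodule.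
Variables (k : fieldType) (V : lmodType k) (W : set V).

(** The subspace proof is an argument, so that the module structure of [submod] is found from its
    type. The construction serves twice: for the torus algebra and for the layer [U] of a module
    over the skew extension. *)
Definition submod_pred of subspace W : {pred V} := fun x => `[< W x >].

Variable sW : subspace W.

Lemma submod_predP : submod_closed (submod_pred sW).
Proof.
split=> [|a u v]; rewrite !unfold_in.
  by apply/asboolP; apply: subspace0.
move=> /asboolP Wu /asboolP Wv; apply/asboolP.
by have [_] := sW; apply.
Qed.

HB.instance Definition _ :=
  GRing.isSubmodClosed.Build k V (submod_pred sW) submod_predP.

Definition submod := {x : V | x \in submod_pred sW}.

HB.instance Definition _ := SubChoice.on submod.
HB.instance Definition _ := [SubChoice_isSubLmodule of submod by <:].

End Submodule.

Section TorusAlgebra.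
Variables (k : fieldType) (N : nat) (q : 'I_N -> 'I_N -> k).
Local Notation A := 'rV[int]_N.

Definition fin_support : set (A -> k^o) :=
  [set f | exists s : seq A, forall a, f a != 0 -> a \in s].

Lemma fin_support_subspace : subspace fin_support.
Proof.
split=> [|c f g [s sP] [t tP]]; first by exists [::] => a; rewrite eqxx.
exists (s ++ t) => a; rewrite mem_cat; apply: contraR; rewrite negb_or.
move=> /andP[as_ at_].
have /eqP f0 : f a == 0 by apply: contraNT as_; apply: sP.
have /eqP g0 : g a == 0 by apply: contraNT at_; apply: tP.
by rewrite /= !fctE f0 g0 scaler0 addr0.
Qed.

Hypothesis q0 : forall i j, q i j != 0.

(** Nonvanishing of [q] is part of the type because the ring axioms depend on it. *)
Definition torus of (forall i j, q i j != 0) := submod fin_support_subspace.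

HB.instance Definition _ := GRing.Lmodule.on (torus q0).

Local Notation T := (torus q0).
Implicit Types (F G H : T) (a b c : A).

Definition coef F : A -> k := val (F : submod fin_support_subspace).

Lemma tcoefD F G a : coef (F + G) a = coef F a + coef G a. Proof. by []. Qed.
Lemma tcoefN F a : coef (- F) a = - coef F a. Proof. by []. Qed.
Lemma tcoefB F G a : coef (F - G) a = coef F a - coef G a. Proof. by []. Qed.
Lemma tcoef0 a : coef 0 a = 0. Proof. by []. Qed.

Lemma tcoef_sum (I : Type) (r : seq I) (P : pred I) (F_ : I -> T) a :
  coef (\sum_(i <- r | P i) F_ i) a = \sum_(i <- r | P i) coef (F_ i) a.
Proof. by elim/big_ind2 : _ => // ? ? ? ? <- <-. Qed.

Lemma torusP F G : (forall a, coef F a = coef G a) -> F = G.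
Proof. by move=> FG; apply: val_inj; apply/funext. Qed.

Lemma coef_fin F : exists s : seq A, forall a, coef F a != 0 -> a \in s.
Proof. exact: (asboolW (valP (F : submod fin_support_subspace))). Qed.

Definition supp F : seq A := undup [seq a <- sval (cid (coef_fin F)) | coef F a != 0].

Lemma supp_uniq F : uniq (supp F). Proof. exact: undup_uniq. Qed.

Lemma mem_supp F a : (a \in supp F) = (coef F a != 0).
Proof.
rewrite mem_undup mem_filter; case: (boolP (coef F a != 0)) => //= Fa.
by case: cid => s /= /(_ a Fa).
Qed.

Lemma torus0P F : reflect (exists a, coef F a != 0) (F != 0).
Proof.
apply: (iffP idP) => [F0|[a Fa]]; last by apply: contraNneq Fa => ->.
apply: contrapT => h; case/negP: F0; apply/eqP/torusP => a; rewrite tcoef0.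
by apply: contrapT => /eqP Fa; apply: h; exists a.
Qed.

Definition mk_torus (f : A -> k) (ff : fin_support f) : T :=
  exist (fun x => x \in submod_pred fin_support_subspace) f (asboolT ff).

Lemma mono_fin (x : k) a : fin_support (fun b => if b == a then x else 0).
Proof. by exists [:: a] => b; case: ifP => [/eqP ->|]; rewrite ?inE ?eqxx. Qed.

Definition mono x a : T := mk_torus (mono_fin x a).

Lemma coef_mono x a b : coef (mono x a) b = if b == a then x else 0.
Proof. by []. Qed.

Lemma big_supp (M : nmodType) F (s : seq A) (f : A -> M) : uniq s ->
  {subset supp F <= s} -> (forall a, coef F a = 0 -> f a = 0) ->
  \sum_(a <- supp F) f a = \sum_(a <- s) f a.
Proof.
move=> us Fs f0; rewrite [RHS](bigID (fun a => coef F a != 0)) /=.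
rewrite [X in _ + X]big1 => [|a]; last by rewrite negbK => /eqP/f0.
rewrite addr0 -[RHS]big_filter; apply: perm_big; apply: uniq_perm.
- exact: supp_uniq.
- exact: filter_uniq.
move=> a; rewrite mem_filter mem_supp; case: (boolP (coef F a != 0)) => //= Fa.
by apply/esym/Fs; rewrite mem_supp.
Qed.

Lemma torus_monoE F : F = \sum_(a <- supp F) mono (coef F a) a.
Proof.
apply: torusP => b; rewrite tcoef_sum.
under eq_bigr do rewrite coef_mono.
have [Fb|Fb] := boolP (b \in supp F).
  rewrite (bigD1_seq b) ?supp_uniq //= eqxx big1 ?addr0 // => a.
  by rewrite eq_sym => /negPf ->.
rewrite big_seq big1 => [|a aF].
  by move: Fb; rewrite mem_supp negbK => /eqP.
by case: eqP => // ba; rewrite -ba (negPf Fb) in aF.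
Qed.

(** Convolution twisted by the cocycle. *)
Let conv F G c := \sum_(a <- supp F) coef F a * cocycle q a (c - a) * coef G (c - a).

Lemma mul_fin F G : fin_support (conv F G).
Proof.
exists [seq a + b | a <- supp F, b <- supp G] => c; apply: contraR => cFG.
rewrite /conv big_seq big1 // => a aF; have [->|Gca] := eqVneq (coef G (c - a)) 0.
  by rewrite mulr0.
case/negP: cFG; apply/allpairsP; exists (a, c - a).
by split; rewrite //= ?mem_supp // subrKC.
Qed.

Definition torus_mul F G : T := mk_torus (mul_fin F G).

Lemma coef_mul_seq F G (s : seq A) c : uniq s -> {subset supp F <= s} ->
  coef (torus_mul F G) c = \sum_(a <- s) coef F a * cocycle q a (c - a) * coef G (c - a).
Proof. by move=> us Fs; apply: big_supp => // a ->; rewrite !mul0r. Qed.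

Lemma torus_mulDl : left_distributive torus_mul +%R.
Proof.
move=> F G H; apply: torusP => c; rewrite tcoefD.
pose s := undup (supp F ++ supp G ++ supp (F + G)).
have us : uniq s by apply: undup_uniq.
have sF : {subset supp F <= s} by move=> a aF; rewrite mem_undup !mem_cat aF.
have sG : {subset supp G <= s}.
  by move=> a aG; rewrite mem_undup !mem_cat aG orbT.
have sFG : {subset supp (F + G) <= s}.
  by move=> a aFG; rewrite mem_undup !mem_cat aFG !orbT.
rewrite !(coef_mul_seq _ _ us) //.
by rewrite -big_split; apply: eq_bigr => a _; rewrite tcoefD !mulrDl.
Qed.

Lemma torus_mulDr : right_distributive torus_mul +%R.
Proof.
move=> F G H; apply: torusP => c; rewrite tcoefD -big_split.
by apply: eq_bigr => a _; rewrite tcoefD mulrDr.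
Qed.

Lemma torus_mul_suml (I : Type) (r : seq I) (F_ : I -> T) G :
  torus_mul (\sum_(i <- r) F_ i) G = \sum_(i <- r) torus_mul (F_ i) G.
Proof.
have m0 : torus_mul 0 G = 0.
  by apply: (addrI (torus_mul 0 G)); rewrite -torus_mulDl !addr0.
by elim: r => [|i r IHr]; rewrite ?big_nil // !big_cons torus_mulDl IHr.
Qed.

Lemma torus_mul_sumr (I : Type) (r : seq I) (F_ : I -> T) G :
  torus_mul G (\sum_(i <- r) F_ i) = \sum_(i <- r) torus_mul G (F_ i).
Proof.
have m0 : torus_mul G 0 = 0.
  by apply: (addrI (torus_mul G 0)); rewrite -torus_mulDr !addr0.
by elim: r => [|i r IHr]; rewrite ?big_nil // !big_cons torus_mulDr IHr.
Qed.

Lemma coef_mono_mul x a G c :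
  coef (torus_mul (mono x a) G) c = x * cocycle q a (c - a) * coef G (c - a).
Proof.
rewrite (@coef_mul_seq _ _ [:: a]) ?big_seq1 //; first by rewrite coef_mono eqxx.
by move=> b; rewrite mem_supp coef_mono inE; case: (b == a); rewrite ?eqxx.
Qed.

Lemma mono_mul x a y b :
  torus_mul (mono x a) (mono y b) = mono (x * y * cocycle q a b) (a + b).
Proof.
apply: torusP => c; rewrite coef_mono_mul !coef_mono.
have -> : (c - a == b) = (c == a + b) by rewrite subr_eq addrC.
by case: eqP => [->|]; rewrite ?mulr0 // [a + b]addrC addrK mulrAC.
Qed.

(** On monomials, associativity is the 2-cocycle identity, which every bicharacter satisfies. *)
Lemma torus_mulA : associative torus_mul.
Proof.
move=> F G H; rewrite (torus_monoE F) !torus_mul_suml; apply: eq_bigr => a _.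
rewrite (torus_monoE G) !torus_mul_sumr !torus_mul_suml torus_mul_sumr.
apply: eq_bigr => b _; rewrite (torus_monoE H) !torus_mul_sumr.
apply: eq_bigr => c _; rewrite !mono_mul addrA; congr mono.
rewrite cocycleDr // cocycleDl //; ring.
Qed.

Lemma torus_mul1l : left_id (mono 1 0) torus_mul.
Proof.
move=> F; apply: torusP => c.
by rewrite coef_mono_mul subr0 cocycle0l // !mul1r.
Qed.

Lemma torus_mul1r : right_id (mono 1 0) torus_mul.
Proof.
move=> F; rewrite {1}(torus_monoE F) torus_mul_suml [RHS]torus_monoE.
by apply: eq_bigr => a _; rewrite mono_mul addr0 cocycle0r // !mulr1.
Qed.

HB.instance Definition _ := GRing.Zmodule_isPzRing.Build T
  torus_mulA torus_mul1l torus_mul1r torus_mulDl torus_mulDr.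

Lemma tcoefM F G (s : seq A) c : uniq s -> {subset supp F <= s} ->
  coef (F * G) c = \sum_(a <- s) coef F a * cocycle q a (c - a) * coef G (c - a).
Proof. exact: coef_mul_seq. Qed.

Lemma tcoef_monoM x a G c :
  coef (mono x a * G) c = x * cocycle q a (c - a) * coef G (c - a).
Proof. exact: coef_mono_mul. Qed.

Lemma monoM x a y b : mono x a * mono y b = mono (x * y * cocycle q a b) (a + b).
Proof. exact: mono_mul. Qed.

Lemma torus_oneE : 1 = mono 1 0 :> T. Proof. by []. Qed.

Lemma tcoef_Mmono F x b a : coef (F * mono x b) (a + b) = coef F a * cocycle q a b * x.
Proof.
have [Fa|Fa] := boolP (a \in supp F); last first.
  have /eqP Fa0 : coef F a == 0 by rewrite -[_ == _]negbK -mem_supp.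
  rewrite Fa0 !mul0r (tcoefM _ _ (supp_uniq F)) // big_seq big1 // => c cF.
  rewrite coef_mono subr_eq [a + b]addrC (inj_eq (addrI _)).
  by case: eqP => [ac|]; rewrite ?mulr0 //; rewrite ac cF in Fa.
rewrite (tcoefM _ _ (supp_uniq F)) // (bigD1_seq a) ?supp_uniq //= coef_mono.
rewrite addrAC subrr add0r eqxx big1 ?addr0 // => c ca.
rewrite coef_mono subr_eq [a + b]addrC (inj_eq (addrI _)) eq_sym (negPf ca).
by rewrite mulr0.
Qed.

Definition tfilter (p : pred A) F : T :=
  \sum_(a <- supp F | p a) mono (coef F a) a.

Lemma coef_tfilter p F a : coef (tfilter p F) a = if p a then coef F a else 0.
Proof.
rewrite /tfilter tcoef_sum big_mkcond /=.
have [aF|aF] := boolP (a \in supp F).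
  rewrite (bigD1_seq a) ?supp_uniq //= coef_mono eqxx big1 ?addr0 // => b ba.
  by case: ifP => // _; rewrite coef_mono eq_sym (negPf ba).
have /eqP -> : coef F a == 0 by rewrite -[_ == _]negbK -mem_supp.
rewrite if_same big_seq big1 // => b bF; case: ifP => // _.
by rewrite coef_mono; case: eqP => // ab; rewrite ab bF in aF.
Qed.

Lemma mono_neq0 x a : x != 0 -> mono x a != 0.
Proof. by move=> x0; apply/torus0P; exists a; rewrite coef_mono eqxx. Qed.

Lemma torus1_neq0 : 1 != 0 :> T.
Proof. by apply: mono_neq0; apply: oner_neq0. Qed.

Lemma tcoefM_neq0 F G c : coef (F * G) c != 0 ->
  exists a b, [/\ coef F a != 0, coef G b != 0 & c = a + b].
Proof.
move=> FGc; apply: contrapT => h; case/negP: FGc; apply/eqP.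
rewrite (tcoefM _ _ (supp_uniq F)) // big_seq big1 // => a; rewrite mem_supp => Fa.
have [->|Gb] := eqVneq (coef G (c - a)) 0; first by rewrite mulr0.
by case: h; exists a, (c - a); rewrite subrKC.
Qed.

End TorusAlgebra.

Section SupportPredicates.
Variables (k : fieldType) (N : nat) (q : 'I_N -> 'I_N -> k).
Hypothesis q0 : forall i j, q i j != 0.
Local Notation A := 'rV[int]_N.
Local Notation T := (torus q0).
Implicit Types (F G : T) (a b : A) (P Q : A -> Prop) (J : {set 'I_N}).

Definition supp_in P F : Prop := forall a, coef F a != 0 -> P a.

Definition on_coords J a : Prop := forall i, i \notin J -> a 0 i = 0.

Lemma on_coordsD J a b : on_coords J a -> on_coords J b -> on_coords J (a + b).
Proof. by move=> aJ bJ i iJ; rewrite mxE aJ // bJ. Qed.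

Lemma supp_in_sub P Q F : (forall a, P a -> Q a) -> supp_in P F -> supp_in Q F.
Proof. by move=> PQ FP a /FP/PQ. Qed.

Lemma supp_in0 P : supp_in P 0.
Proof. by move=> a; rewrite tcoef0 eqxx. Qed.

Lemma supp_inD P F G : supp_in P F -> supp_in P G -> supp_in P (F + G).
Proof.
move=> FP GP a; rewrite tcoefD; have [F0|/FP//] := eqVneq (coef F a) 0.
by rewrite F0 add0r; apply: GP.
Qed.

Lemma supp_inN P F : supp_in P F -> supp_in P (- F).
Proof. by move=> FP a; rewrite tcoefN oppr_eq0; apply: FP. Qed.

Lemma supp_in_mono P x a : P a -> supp_in P (mono q0 x a).
Proof. by move=> Pa b; rewrite coef_mono; have [->//|_] := eqVneq b a; rewrite eqxx. Qed.

Lemma supp_in_sum P (I : Type) (r : seq I) (p : pred I) (F_ : I -> T) :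
  (forall i, p i -> supp_in P (F_ i)) -> supp_in P (\sum_(i <- r | p i) F_ i).
Proof.
by move=> FP; elim/big_rec : _ => [|i x pi xP]; [apply: supp_in0 | apply: supp_inD => //; apply: FP].
Qed.

Lemma supp_inM P Q S F G : (forall a b, P a -> Q b -> S (a + b)) ->
  supp_in P F -> supp_in Q G -> supp_in S (F * G).
Proof. by move=> PQS FP GQ c /tcoefM_neq0[a [b [/FP Pa /GQ Qb ->]]]; apply: PQS. Qed.

Lemma on_coordsM J F G :
  supp_in (on_coords J) F -> supp_in (on_coords J) G -> supp_in (on_coords J) (F * G).
Proof. by apply: supp_inM; apply: on_coordsD. Qed.

Lemma tcoefZ x F a : coef (x *: F) a = x * coef F a. Proof. by []. Qed.

Lemma supp_inZ P x F : supp_in P F -> supp_in P (x *: F).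
Proof.
by move=> FP a; rewrite tcoefZ; have [->|/FP//] := eqVneq (coef F a) 0; rewrite mulr0 eqxx.
Qed.

Lemma twist_fin i m F : fin_support (fun a => xcomm q i m a * coef F a : k^o).
Proof.
exists (supp F) => a; rewrite mem_supp; apply: contraNneq => ->.
by rewrite mulr0.
Qed.

(* Conjugation by [X_i^m]. *)
Definition twist i m F : T := mk_torus q0 (twist_fin i m F).

Lemma coef_twist i m F a : coef (twist i m F) a = xcomm q i m a * coef F a.
Proof. by []. Qed.

Lemma twist_eq0 i m F : (twist i m F == 0) = (F == 0).
Proof.
apply/eqP/eqP => [F0|->]; apply: torusP => a; last by rewrite coef_twist !tcoef0 mulr0.
have := congr1 (fun F => coef F a) F0; rewrite coef_twist tcoef0 => /eqP.
by rewrite mulf_eq0 (negPf (xcomm_neq0 q0 _ _ _)) => /eqP.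
Qed.

Lemma twist_supp P i m F : supp_in P F -> supp_in P (twist i m F).
Proof.
move=> FP a; rewrite coef_twist; have [->|/FP//] := eqVneq (coef F a) 0.
by rewrite mulr0 eqxx.
Qed.

End SupportPredicates.

(** * Action of the torus algebra on a module *)

Section Action.
Variables (k : fieldType) (N : nat) (q : 'I_N -> 'I_N -> k).
Hypothesis q0 : forall i j, q i j != 0.
Variables (V : lmodType k) (X Xi : 'I_N -> V -> V).
Hypotheses (q_as : mult_antisym q) (XM : qtorus_module q X Xi).
Local Notation A := 'rV[int]_N.
Local Notation T := (torus q0).
Local Notation Xmon := (monomial X Xi).
Implicit Types (F G : T) (a b : A) (v : V) (J : {set 'I_N}).

Definition act F v : V := \sum_(a <- supp F) coef F a *: Xmon a v.

Lemma actE F v : act F v = \sum_(a <- supp F) coef F a *: Xmon a v.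
Proof. by []. Qed.

Lemma act_big F v (s : seq A) : uniq s -> {subset supp F <= s} ->
  act F v = \sum_(a <- s) coef F a *: Xmon a v.
Proof. by move=> us Fs; apply: big_supp => // a ->; rewrite scale0r. Qed.

Lemma actD F G v : act (F + G) v = act F v + act G v.
Proof.
pose s := undup (supp F ++ supp G ++ supp (F + G)).
have us : uniq s by apply: undup_uniq.
have sF : {subset supp F <= s} by move=> a aF; rewrite mem_undup !mem_cat aF.
have sG : {subset supp G <= s}.
  by move=> a aG; rewrite mem_undup !mem_cat aG orbT.
have sFG : {subset supp (F + G) <= s}.
  by move=> a aFG; rewrite mem_undup !mem_cat aFG !orbT.
rewrite !(act_big _ us) // -big_split; apply: eq_bigr => a _.
by rewrite tcoefD scalerDl.
Qed.

Lemma act0 v : act 0 v = 0.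
Proof. by rewrite (@act_big _ _ [::]) ?big_nil // => a; rewrite mem_supp tcoef0 eqxx. Qed.

Lemma actN F v : act (- F) v = - act F v.
Proof. by apply/eqP; rewrite -subr_eq0 opprK -actD addNr act0. Qed.

Lemma actB F G v : act (F - G) v = act F v - act G v.
Proof. by rewrite actD actN. Qed.

Lemma act_sum (I : Type) (r : seq I) (F_ : I -> T) v :
  act (\sum_(i <- r) F_ i) v = \sum_(i <- r) act (F_ i) v.
Proof. by elim: r => [|i r IHr]; rewrite ?big_nil ?act0 // !big_cons actD IHr. Qed.

Lemma act_mono x a v : act (mono q0 x a) v = x *: Xmon a v.
Proof.
rewrite (@act_big _ _ [:: a]) ?big_seq1 ?coef_mono ?eqxx // => b.
by rewrite mem_supp coef_mono inE; case: (b == a); rewrite ?eqxx.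
Qed.

Lemma lin_act F : lin_map (act F).
Proof.
move=> c u v; rewrite /act scaler_sumr -big_split; apply: eq_bigr => a _ /=.
by rewrite (lin_monomial XM) scalerDr !scalerA mulrC.
Qed.

Lemma actM F G v : act (F * G) v = act F (act G v).
Proof.
rewrite {1}(torus_monoE F) mulr_suml act_sum [RHS]/act; apply: eq_bigr => a _.
rewrite {1}(torus_monoE G) mulr_sumr act_sum [in RHS]/act.
rewrite (lin_map_sum (lin_monomial XM _)) scaler_sumr; apply: eq_bigr => b _.
rewrite monoM act_mono (lin_mapZ (lin_monomial XM _)) (monomialD q_as XM).
by rewrite !scalerA.
Qed.

Lemma act1 v : act 1 v = v.
Proof. by rewrite torus_oneE act_mono scale1r monomial0. Qed.

Lemma actZ x F v : act (x *: F) v = x *: act F v.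
Proof.
rewrite [RHS]scaler_sumr (@act_big _ _ (supp F)) ?supp_uniq //.
  by apply: eq_bigr => a _; rewrite tcoefZ scalerA.
by move=> a; rewrite !mem_supp tcoefZ mulf_eq0 negb_or => /andP[].
Qed.

Lemma act_twist i m F v : act (twist i m F) (xpow X Xi i m v) = xpow X Xi i m (act F v).
Proof.
rewrite (@act_big _ _ (supp F)) ?supp_uniq //.
  rewrite (lin_map_sum (lin_xpow XM _ _)); apply: eq_bigr => a _.
  rewrite (lin_mapZ (lin_xpow XM _ _)) coef_twist (xpow_monomial q_as XM) scalerA.
  by rewrite mulrC.
by move=> a; rewrite !mem_supp coef_twist; apply: contraNneq => ->; rewrite mulr0.
Qed.

Lemma lspan_act P v x : lspan [set Xmon a v | a in P] x ->
  exists2 F, supp_in P F & x = act F v.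
Proof.
apply: (@lspan_le _ _ _ [set x | exists2 F, supp_in P F & x = act F v]).
  split; first by exists 0; rewrite ?act0 //; apply: supp_in0.
  move=> c _ _ [F FP ->] [G GP ->]; exists (c *: F + G); last by rewrite actD actZ.
  by apply: supp_inD => //; apply: supp_inZ.
move=> _ [a Pa <-]; exists (mono q0 1 a); last by rewrite act_mono scale1r.
exact: supp_in_mono.
Qed.

Lemma act_lspan (P : set A) F v : supp_in P F -> lspan [set Xmon a v | a in P] (act F v).
Proof.
move=> FP; rewrite /act big_seq; apply: lspan_sum => a; rewrite mem_supp => Fa.
by apply: lspanZ; apply: sub_lspan; exists a => //; apply: FP.
Qed.

(** Distinct exponents with coefficients are the same thing as an element of the algebra, so
    freeness of the monomials at [v] says that only 0 kills [v]. *)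
Lemma free_monomialsP J v : free_monomials X Xi J v <->
  forall F, supp_in (on_coords J) F -> act F v = 0 -> F = 0.
Proof.
split=> [fJ F FJ Fv|tf S e einj eJ c c0 t].
  pose e (t : 'I_(size (supp F))) := tnth (in_tuple (supp F)) t.
  have einj : injective e by apply/tuple_uniqP; apply: supp_uniq.
  have eJ t i : i \notin J -> e t 0 i = 0.
    by apply: FJ; rewrite -mem_supp; apply: mem_tnth.
  have := fJ _ e einj eJ (fun t => coef F (e t)).
  move: Fv; rewrite /act big_tnth => Fv /(_ Fv) Fe.
  apply: torusP => a; rewrite tcoef0; apply: contrapT => /eqP; rewrite -mem_supp.
  move=> aF; have := aF; rewrite mem_supp => /eqP; apply.
  have ai : (index a (supp F) < size (supp F))%N by rewrite index_mem.
  by have := Fe (Ordinal ai); rewrite /e (tnth_nth 0) /= nth_index.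
pose F : T := \sum_t mono q0 (c t) (e t).
have F0 : F = 0.
  apply: tf; first by apply: supp_in_sum => t' _; apply: supp_in_mono => i; apply: eJ.
  by rewrite act_sum -[RHS]c0; apply: eq_bigr => t' _; rewrite act_mono.
have := congr1 (fun F => coef F (e t)) F0; rewrite tcoef0 => <-.
rewrite tcoef_sum (bigD1 t) //= coef_mono eqxx big1 ?addr0 // => t' t't.
by rewrite coef_mono (inj_eq einj) eq_sym (negPf t't).
Qed.

Lemma free_monomials_set0 v : v != 0 -> free_monomials X Xi finset.set0 v.
Proof.
move=> v0; apply/free_monomialsP => F F0 Fv.
have FE : F = mono q0 (coef F 0) 0.
  apply: torusP => a; rewrite coef_mono; have [->//|a0] := eqVneq a 0.
  apply: contrapT => /eqP/F0 aJ; case/negP: a0; apply/eqP/rowP => i.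
  by rewrite mxE aJ // finset.in_set0.
move: Fv; rewrite FE act_mono monomial0 => /eqP; rewrite scaler_eq0 (negPf v0) orbF.
by move=> /eqP ->; apply: torusP => a; rewrite coef_mono tcoef0 if_same.
Qed.

End Action.

(** * Lexicographic orders on exponents *)

Section LexOrder.
Variables (N : nat) (sg : 'I_N -> bool).
Local Notation A := 'rV[int]_N.
Implicit Types (s : seq 'I_N) (a b : A).

(** The positive cone of a translation-invariant order; coordinates with [sg i] are reversed. *)
Fixpoint lexpos s a : bool :=
  if s is i :: s' then
    if a 0 i == 0 then lexpos s' a else (0 < a 0 i) (+) sg i
  else false.

Lemma lexposD s a b : lexpos s a -> lexpos s b -> lexpos s (a + b).
Proof.
elim: s => [//|i s IHs] /=; rewrite mxE; move: (a 0 i) (b 0 i) => x y.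
have [->|x0] := eqVneq x 0; have [->|y0] := eqVneq y 0; rewrite ?add0r ?addr0 ?eqxx //.
- by rewrite (negPf y0).
- by rewrite (negPf x0).
have xyE : (0 < x) (+) sg i -> (0 < y) (+) sg i -> (x + y != 0) && ((0 < x + y) (+) sg i).
  by case: (sg i); rewrite ?addbT ?addbF; lia.
by move=> hx hy; have /andP[/negPf -> ->] := xyE hx hy.
Qed.

Lemma lexposN s a : lexpos s a -> ~~ lexpos s (- a).
Proof.
elim: s => [//|i s IHs] /=; rewrite mxE oppr_eq0; move: (a 0 i) => x.
by case: eqP => // x0; case: (sg i); rewrite ?addbT ?addbF; lia.
Qed.

Lemma lexpos_total s a i : i \in s -> a 0 i != 0 -> lexpos s a || lexpos s (- a).
Proof.
elim: s => [//|j s IHs] /=; rewrite inE mxE oppr_eq0.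
case: (eqVneq i j) => [<- _ ai|_ /= si ai].
  rewrite (negPf ai); move: (a 0 i) ai => x.
  by case: (sg i); rewrite ?addbT ?addbF; lia.
case: eqP => [_|/eqP]; first exact: IHs.
move: (a 0 j) => x; by case: (sg j); rewrite ?addbT ?addbF; lia.
Qed.

End LexOrder.

(** * Leading terms *)

Section LeadingTerms.
Variables (k : fieldType) (N : nat) (q : 'I_N -> 'I_N -> k).
Hypothesis q0 : forall i j, q i j != 0.
Variable y : 'I_N.
Local Notation A := 'rV[int]_N.
Local Notation T := (torus q0).
Implicit Types (F G : T) (a b c : A) (o : bool).

(* Two lexicographic orders whose most significant coordinate is [y]; they
   differ only in the direction of [y], and so agree on exponents free of [y]. *)
Definition pos o : A -> bool := lexpos (fun i => o && (i == y)) (y :: enum 'I_N).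

Lemma posD o a b : pos o a -> pos o b -> pos o (a + b).
Proof. exact: lexposD. Qed.

Lemma posN o a : pos o a -> ~~ pos o (- a).
Proof. exact: lexposN. Qed.

Lemma pos_total o a : a != 0 -> pos o a || pos o (- a).
Proof.
move=> a0; have [i ai] : exists i, a 0 i != 0.
  apply: contrapT => h; case/negP: a0; apply/eqP/rowP => i; rewrite mxE.
  by apply: contrapT => ai; apply: h; exists i; apply/eqP.
by apply: lexpos_total ai; rewrite inE mem_enum orbT.
Qed.

Lemma pos_trans o a b c : pos o (a - b) -> pos o (b - c) -> pos o (a - c).
Proof. by move=> ab bc; rewrite -(subrK b a) -addrA; apply: posD. Qed.

Lemma pos_y o a : pos o a -> if o then a 0 y <= 0 else 0 <= a 0 y.
Proof.
rewrite /pos /= eqxx andbT; move: (a 0 y) => x.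
by case: eqP => [->|x0]; case: o; rewrite ?addbT ?addbF //; lia.
Qed.

Lemma pos_agree a : a 0 y = 0 -> pos true a = pos false a.
Proof.
move=> ay; rewrite /pos /= ay eqxx; elim: (enum _) => [//|i s IHs] /=.
by have [->|iy] := eqVneq i y; rewrite ?ay ?eqxx // IHs.
Qed.

Definition is_lead o F a : Prop :=
  coef F a != 0 /\ forall b, coef F b != 0 -> b != a -> pos o (a - b).

Lemma lead_exists o F : F != 0 -> exists a, is_lead o F a.
Proof.
have maxs (s : seq A) : s != [::] ->
    exists2 a, a \in s & forall b, b \in s -> b != a -> pos o (a - b).
  elim: s => [//|a [|a' s] IHs] _.
    exists a; first by rewrite inE.
    by move=> b; rewrite inE => /eqP -> /eqP.
  have [//|c cs cmax] := IHs; have [->|ac] := eqVneq a c.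
    exists c; first by rewrite inE eqxx.
    move=> b; rewrite inE.
    by case/orP => [/eqP-> /eqP//|]; apply: cmax.
  have /orP[acp|acn] : pos o (a - c) || pos o (- (a - c)).
  - by apply: pos_total; rewrite subr_eq0.
  - exists a; first by rewrite inE eqxx.
    move=> b; rewrite inE => /orP[/eqP-> /eqP//|bs _].
    have [->//|bc] := eqVneq b c; apply: pos_trans acp _; exact: cmax.
  exists c; first by rewrite inE cs orbT.
  move=> b; rewrite inE => /orP[/eqP-> _|].
    by rewrite -opprB.
  exact: cmax.
move=> /torus0P[a Fa]; have [|c cF cmax] := maxs (supp F).
  by apply: contraTneq Fa => Fs; rewrite -mem_supp Fs.
exists c; split; first by rewrite -mem_supp.
by move=> b; rewrite -mem_supp; apply: cmax.
Qed.

Definition lead o F : A := xget 0 [set a | is_lead o F a].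

Lemma leadP o F : F != 0 -> is_lead o F (lead o F).
Proof. by move=> /(lead_exists o)[a aF]; apply: (xgetI 0 aF). Qed.

Lemma lead_unique o F a : is_lead o F a -> lead o F = a.
Proof.
move=> [Fa amax]; have [|Fl lmax] := @leadP o F; first by apply/torus0P; exists a.
have [//|la] := eqVneq (lead o F) a; have := amax _ Fl la.
by move=> /posN/negP; rewrite opprB => /(_ (lmax a Fa _)); rewrite eq_sym => /(_ la).
Qed.

Definition lcoef o F : k := coef F (lead o F).

Lemma lcoef_neq0 o F : F != 0 -> lcoef o F != 0.
Proof. by move=> /(leadP o)[]. Qed.

(** The sum of the two largest exponents arises in one way only, so nothing cancels. This is also
    why the torus is a domain. *)
Lemma coef_lead_mul o F G : F != 0 -> G != 0 ->
  coef (F * G) (lead o F + lead o G) =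
    lcoef o F * cocycle q (lead o F) (lead o G) * lcoef o G.
Proof.
move=> F0 G0; have [Fa amax] := leadP o F0; have [Gb bmax] := leadP o G0.
rewrite (tcoefM _ _ (supp_uniq F)) // (bigD1_seq (lead o F)) ?supp_uniq ?mem_supp //=.
rewrite [_ + lead o G - _]addrAC subrr add0r big1_seq ?addr0 // => c /andP[ca].
rewrite mem_supp => Fc; set d := _ - c.
have [->|Gd] := eqVneq (coef G d) 0; first by rewrite mulr0.
have dE : lead o G - d = - (lead o F - c).
  by rewrite /d opprB addrCA [_ + lead o G]addrC opprD addNKr addrC opprB addrC.
have [/eqP|dG] := eqVneq d (lead o G).
  rewrite -subr_eq0 -opprB oppr_eq0 dE oppr_eq0 subr_eq0 => /eqP la.
  by rewrite la eqxx in ca.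
have := bmax _ Gd dG; rewrite dE => /posN; rewrite opprK amax //.
Qed.

Lemma is_leadM o F G : F != 0 -> G != 0 -> is_lead o (F * G) (lead o F + lead o G).
Proof.
move=> F0 G0; split.
  by rewrite coef_lead_mul // !mulf_neq0 ?lcoef_neq0 ?cocycle_neq0.
have [Fa amax] := leadP o F0; have [Gb bmax] := leadP o G0.
move=> c /tcoefM_neq0[a [b [Fa' Gb' ->]]] abne; rewrite opprD addrACA.
have [ea|na] := eqVneq a (lead o F); have [eb|nb] := eqVneq b (lead o G).
- by rewrite ea eb eqxx in abne.
- by rewrite ea subrr add0r; apply: bmax.
- by rewrite eb subrr addr0; apply: amax.
- by apply: posD; [apply: amax | apply: bmax].
Qed.

Lemma leadM o F G : F != 0 -> G != 0 -> lead o (F * G) = lead o F + lead o G.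
Proof. by move=> F0 G0; apply/lead_unique/is_leadM. Qed.

Lemma torus_mulf_neq0 F G : F != 0 -> G != 0 -> F * G != 0.
Proof. by move=> F0 G0; have [FG _] := is_leadM false F0 G0; apply/torus0P; eexists; exact: FG. Qed.

Lemma torus_mulf_eq0 F G : F * G = 0 -> F = 0 \/ G = 0.
Proof.
move=> FG; have [|F0] := eqVneq F 0; [by left | right].
by apply/eqP; apply: contraPT FG => G0; apply/eqP/torus_mulf_neq0.
Qed.

Lemma lcoefM o F G : F != 0 -> G != 0 ->
  lcoef o (F * G) = lcoef o F * cocycle q (lead o F) (lead o G) * lcoef o G.
Proof. by move=> F0 G0; rewrite /lcoef leadM // coef_lead_mul. Qed.

Definition yhi F : int := lead false F 0 y.
Definition ylo F : int := lead true F 0 y.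
(** The degree in [Y] once the unit [Y^ylo] is removed: the Euclidean size for division. *)
Definition width F : nat := `|yhi F - ylo F|%N.

Lemma y_range F a : coef F a != 0 -> ylo F <= a 0 y <= yhi F.
Proof.
move=> Fa; have F0 : F != 0 by apply/torus0P; exists a.
have [_ hi] := leadP false F0; have [_ lo] := leadP true F0.
apply/andP; split; rewrite /ylo /yhi.
  have [<-//|na] := eqVneq a (lead true F).
  by have := pos_y (lo a Fa na); rewrite !mxE; move: (lead true F 0 y) (a 0 y) => u v; lia.
have [<-//|na] := eqVneq a (lead false F).
by have := pos_y (hi a Fa na); rewrite !mxE; move: (lead false F 0 y) (a 0 y) => u v; lia.
Qed.

Lemma width_eq F : F != 0 -> yhi F = ylo F + (width F)%:Z.
Proof.
move=> /torus0P[a /y_range]; rewrite /width.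
by move: (a 0 y) (ylo F) (yhi F) => u v w; lia.
Qed.

Lemma yloM F G : F != 0 -> G != 0 -> ylo (F * G) = ylo F + ylo G.
Proof. by move=> F0 G0; rewrite /ylo leadM // mxE. Qed.

Lemma widthM F G : F != 0 -> G != 0 -> width (F * G) = (width F + width G)%N.
Proof.
move=> F0 G0; have FG0 := torus_mulf_neq0 F0 G0.
have := width_eq F0; have := width_eq G0; have := width_eq FG0; rewrite yloM //.
rewrite {1}/yhi leadM // mxE -/(yhi F) -/(yhi G).
by move: (ylo F) (ylo G) (yhi F) (yhi G) => u v w x; lia.
Qed.

(** Half open, [m] layers from [lo] on: an element of width [w] occupies a window of [w + 1]
    layers. *)
Definition y_window (lo : int) (m : nat) a : Prop := lo <= a 0 y < lo + m%:Z.

Lemma width_window F lo m : F != 0 -> supp_in (y_window lo m) F -> (width F < m)%N.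
Proof.
move=> F0 Fw; have [/Fw hi _] := leadP false F0; have [/Fw lo' _] := leadP true F0.
have := width_eq F0; move: hi lo'; rewrite /y_window -/(yhi F) -/(ylo F).
by move: (yhi F) (ylo F) => u v; lia.
Qed.

Lemma window_width F : F != 0 -> supp_in (y_window (ylo F) (width F).+1) F.
Proof.
move=> F0 a /y_range; rewrite (width_eq F0) /y_window.
by move: (ylo F) (a 0 y) => u v; lia.
Qed.

(** The scalar shadow of the determinant. Taking leading coefficients of the two orders makes it
    multiplicative up to cocycle values, and an element of width 0, a unit over [D], gets ratio 1
    since the orders agree in the absence of [y]. *)
Definition lratio F : k := lcoef false F / lcoef true F.

Lemma lratio_neq0 F : F != 0 -> lratio F != 0.
Proof. by move=> F0; rewrite mulf_neq0 ?invr_eq0 ?lcoef_neq0. Qed.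

Lemma lratio_width0 F : F != 0 -> width F = 0%N -> lratio F = 1.
Proof.
move=> F0 w0; suff E : lead false F = lead true F.
  by rewrite /lratio /lcoef E divff //; apply: (lcoef_neq0 true F0).
have [Fh hi] := leadP false F0; have [Fl lo] := leadP true F0.
apply/eqP; apply: contrapT => /negP ne.
have := hi _ Fl; rewrite eq_sym => /(_ ne); rewrite -pos_agree.
  by move=> /posN; rewrite opprB lo.
have := width_eq F0; rewrite w0 !mxE -/(yhi F) -/(ylo F).
by move: (yhi F) (ylo F) => u v; lia.
Qed.

Lemma is_lead_twist o i m F : F != 0 -> lead o (twist i m F) = lead o F.
Proof.
have tw a : coef (twist i m F) a != 0 <-> coef F a != 0.
  by rewrite coef_twist mulf_eq0 (negPf (xcomm_neq0 q0 _ _ _)).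
move=> F0; have [Fa amax] := leadP o F0; apply: lead_unique; split; first exact/tw.
by move=> b /tw; apply: amax.
Qed.

Lemma width_twist i m F : F != 0 -> width (twist i m F) = width F.
Proof. by move=> F0; rewrite /width /yhi /ylo !is_lead_twist. Qed.

(** Powers of [q i y] enter here: the two leading exponents differ in the coordinate [y] by the
    width of [F]. *)
Lemma lratio_twist i m F : F != 0 -> lratio (twist i m F) =
  xcomm q i m (lead false F) / xcomm q i m (lead true F) * lratio F.
Proof.
by move=> F0; rewrite /lratio /lcoef !is_lead_twist // !coef_twist invfM mulrACA.
Qed.

Variables (C : {set 'I_N}) (Gam : set k).
Hypotheses (sG : subgroup Gam) (Gq : forall i j, i \in C -> j \in C -> Gam (q i j)).

Lemma subgroup_cocycle_on a b : on_coords C a -> on_coords C b -> Gam (cocycle q a b).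
Proof.
move=> aC bC; apply: subgroup_cocycle => // i j ai bj.
by apply: Gq; [apply: contraNT ai => /aC -> | apply: contraNT bj => /bC ->].
Qed.

Definition cgr (x z : k) : Prop := Gam (x / z).

Lemma cgr_refl x : x != 0 -> cgr x x.
Proof. by case: sG => G1 _ _ x0; rewrite /cgr divff. Qed.

Lemma cgr_sym x z : cgr x z -> cgr z x.
Proof. by case: sG => _ _ GV /GV; rewrite invf_div. Qed.

Lemma cgr_trans x z w : z != 0 -> cgr x z -> cgr z w -> cgr x w.
Proof.
case: sG => _ GM _ z0 xz zw; rewrite /cgr.
have -> : x / w = (x / z) * (z / w) by rewrite mulrA divfK.
exact: GM.
Qed.

Lemma lratioM F G : supp_in (on_coords C) F -> supp_in (on_coords C) G ->
  F != 0 -> G != 0 -> cgr (lratio (F * G)) (lratio F * lratio G).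
Proof.
move=> FC GC F0 G0; have [_ GM GV] := sG.
have Glead o : Gam (cocycle q (lead o F) (lead o G)).
  by apply: subgroup_cocycle_on; [apply: FC; case: (leadP o F0)
                                 |apply: GC; case: (leadP o G0)].
rewrite /cgr /lratio !lcoefM //.
have hF o := lcoef_neq0 o F0; have hG o := lcoef_neq0 o G0.
have cT := cocycle_neq0 q0 (lead true F) (lead true G).
rewrite (_ : _ / _ = cocycle q (lead false F) (lead false G) /
                     cocycle q (lead true F) (lead true G)).
  by apply: GM => //; apply: GV.
by field; rewrite !hF !hG cT.
Qed.

End LeadingTerms.

(** * Ore conditions and the Euclidean algorithm *)

(** Enlarging the side of a box by a constant multiplies its size by a factor that tends to 1, so a
    strict inequality between [M] and [M'] survives for large boxes. *)
Lemma polynomial_growth_gap e K M M' : (M < M')%N ->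
  exists r, (M * (r + K) ^ e < M' * r ^ e)%N.
Proof.
move=> MM'.
(* The estimate [((r + K) / r) ^ e <= 1 + c / r], with denominators cleared. *)
have [c cP] : exists c, forall r, (0 < r)%N -> ((r + K) ^ e * r <= r ^ e * (r + c))%N.
  elim: e => [|e [c IHc]]; first by exists 0%N => r _; rewrite !expn0; lia.
  exists (K + c + K * c)%N => r r0; rewrite !expnS.
  have := IHc r r0; move: (r ^ e)%N ((r + K) ^ e)%N => u v uv.
  apply: (@leq_trans ((r + K) * (u * (r + c)))); first by nia.
  have : (u * ((r + K) * (r + c)) <= u * (r * (r + (K + c + K * c))))%N.
    by rewrite leq_mul2l; apply/orP; right; nia.
  by nia.
exists (M * c).+1; set r := (M * c).+1.
have r0 : (0 < r)%N by [].
have re0 : (0 < r ^ e)%N by rewrite expn_gt0.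
have := cP r r0; move: (r ^ e)%N re0 ((r + K) ^ e)%N => u u0 v uv.
have lt : (M * (r + c) < M' * r)%N by rewrite /r; nia.
rewrite -(ltn_pmul2r r0); apply: (@leq_ltn_trans (u * (M * (r + c)))); first by nia.
by rewrite mulnAC [X in (_ < X)%N]mulnC ltn_pmul2l.
Qed.

Section OreDomain.
Variables (k : fieldType) (N : nat) (q : 'I_N -> 'I_N -> k).
Hypothesis q0 : forall i j, q i j != 0.
Variables (y : 'I_N) (J : {set 'I_N}).
Hypothesis yJ : y \notin J.
Local Notation E := 'rV[int]_N.
Local Notation T := (torus q0).
Local Notation C := (y |: J)%SET.
Local Notation onC := (supp_in (on_coords C)).
Local Notation onJ := (supp_in (on_coords J)).
Implicit Types (F G H P R : T) (a b c : E).

Lemma onJ_C a : on_coords J a -> on_coords C a.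
Proof. by move=> aJ i; rewrite in_setU1 negb_or => /andP[_ /aJ]. Qed.

Lemma onC_J a : on_coords C a -> a 0 y = 0 -> on_coords J a.
Proof.
move=> aC ay i iJ; have [->//|iy] := eqVneq i y.
by apply: aC; rewrite in_setU1 negb_or iy.
Qed.

Lemma onJ_window F : onC F -> supp_in (y_window y 0 1) F -> onJ F.
Proof.
move=> FC Fw a Fa; apply: onC_J; first exact: FC.
by have := Fw a Fa; rewrite /y_window; move: (a 0 y) => x; lia.
Qed.

Lemma width_onJ F : onJ F -> width y F = 0%N.
Proof.
have [->|F0] := eqVneq F 0 => FJ.
  rewrite /width /yhi /ylo /lead; suff nl o : [set a | is_lead y o (0 : T) a] = set0.
    by rewrite !nl !xgetPN ?subrr // => x [].
  by rewrite -subset0 => a []; rewrite tcoef0 eqxx.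
apply/eqP; rewrite -leqn0 -ltnS; apply: (@width_window _ _ _ q0 y F 0 1) => // a.
by move=> /FJ aJ; rewrite /y_window (aJ _ yJ).
Qed.

(* Linear algebra over the quotient division ring of [k[X_j : j in J]], made
   fraction free: [mA + mB] unknown coefficients, [M] equations. *)
Lemma common_combination P R (sA sB lo : int) (mA mB M : nat) :
  onC P -> onC R -> (M < mA + mB)%N ->
  exists A B : T,
    [/\ onC A /\ supp_in (y_window y sA mA) A,
        onC B /\ supp_in (y_window y sB mB) B,
        A != 0 \/ B != 0
      & forall c, y_window y lo M c -> coef (A * P + B * R) c = 0].
Proof.
move=> PC RC lt_M.
have [L LP] : exists L, forall a, a \in supp P ++ supp R -> forall i, (`|(a 0%R i : int)| <= L)%N.
  exists (\max_(a <- supp P ++ supp R) l1norm a)%N => a aPR i.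
  apply: leq_trans (leq_bigmax_seq a aPR isT).
  by rewrite /l1norm (bigD1 i) //=; apply: leq_addr.
(* [L] bounds the exponents of [P] and [R], so the products of box monomials with them lie in a box
   of side [r + (L + L)]; this [r] keeps more unknowns than equations. *)
have [r rP] := polynomial_growth_gap #|J| (L + L) lt_M.
pose bx n := {ffun {i : 'I_N | i \in J} -> 'I_n}.
pose ex (s : int) (f : bx r) : E := unit_exp y s + box f.
have ex_y s f : ex s f 0 y = s by rewrite mxE box_out // addr0 mxE eqxx.
have ex_inj s s' f f' : ex s f = ex s' f' -> s = s' /\ f = f'.
  move=> E1; have ss : s = s' by rewrite -(ex_y s f) E1 ex_y.
  by split=> //; apply: box_inj; move: E1; rewrite /ex ss => /addrI.
have exC s f : on_coords C (ex s f).
  move=> i; rewrite in_setU1 negb_or => /andP[iy iJ].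
  by rewrite mxE box_out // addr0 mxE (negPf iy).
pose U : finType := ('I_mA + 'I_mB)%type.
pose sU (u : U) : int := match u with inl i => sA + i%:Z | inr i => sB + i%:Z end.
pose PU (u : U) : T := match u with inl _ => P | inr _ => R end.
pose sh : E := \row_i (if i \in J then L%:Z else 0).
pose tg (t : 'I_M * bx (r + (L + L))%N) : E := unit_exp y (lo + (t.1 : nat)%:Z) + (box t.2 - sh).
have [] := @underdetermined_system k (U * bx r)%type ('I_M * bx (r + (L + L))%N)%type
  (fun s t => coef (mono q0 1 (ex (sU s.1) s.2) * PU s.1) (tg t)).
  by rewrite !card_prod card_sum !card_box !card_ord.
move=> c [[s0 cs0] cK].
pose A : T := \sum_(x : 'I_mA * bx r) mono q0 (c (inl x.1, x.2)) (ex (sA + (x.1 : nat)%:Z) x.2).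
pose B : T := \sum_(x : 'I_mB * bx r) mono q0 (c (inr x.1, x.2)) (ex (sB + (x.1 : nat)%:Z) x.2).
have ABE : A * P + B * R = \sum_(s : U * bx r) mono q0 (c s) (ex (sU s.1) s.2) * PU s.1.
  transitivity (\sum_(p : U * bx r) mono q0 (c (p.1, p.2)) (ex (sU p.1) p.2) * PU p.1); last first.
    by apply: eq_bigr => -[].
  rewrite /A /B !mulr_suml -(pair_bigA _ (fun i f => mono q0 (c (inl i, f)) (ex (sA + (i : nat)%:Z) f) * P)).
  rewrite -(pair_bigA _ (fun i f => mono q0 (c (inr i, f)) (ex (sB + (i : nat)%:Z) f) * R)).
  by rewrite -(pair_bigA _ (fun u f => mono q0 (c (u, f)) (ex (sU u) f) * PU u)) big_sumType.
exists A, B; split.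
- split; first by apply: supp_in_sum => x _; apply: supp_in_mono.
  apply: supp_in_sum => -[[i ip] f] _; apply: supp_in_mono; rewrite /y_window ex_y /=.
  by lia.
- split; first by apply: supp_in_sum => x _; apply: supp_in_mono.
  apply: supp_in_sum => -[[i ip] f] _; apply: supp_in_mono; rewrite /y_window ex_y /=.
  by lia.
- case: s0 cs0 => [[i|i] f] cif; [left|right]; apply/torus0P.
  + exists (ex (sA + (i : nat)%:Z) f); rewrite tcoef_sum (bigD1 (i, f)) //=.
    rewrite coef_mono eqxx big1 ?addr0 // => -[i' f'] ne; rewrite coef_mono.
    case: eqP => // /ex_inj[/addrI[ii] ff]; case/negP: ne; rewrite ff.
    by apply/eqP; congr pair; apply: val_inj.
  + exists (ex (sB + (i : nat)%:Z) f); rewrite tcoef_sum (bigD1 (i, f)) //=.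
    rewrite coef_mono eqxx big1 ?addr0 // => -[i' f'] ne; rewrite coef_mono.
    case: eqP => // /ex_inj[/addrI[ii] ff]; case/negP: ne; rewrite ff.
    by apply/eqP; congr pair; apply: val_inj.
move=> d dw; rewrite ABE; apply: contrapT => /eqP dn0.
(* A nonzero coefficient in the window can only sit at one of the targets [tg], where the system
   made it vanish. *)
have [t tE] : exists t, tg t = d.
  have [s sd] : exists s, coef (mono q0 (c s) (ex (sU s.1) s.2) * PU s.1) d != 0.
    apply: contrapT => h; case/negP: dn0; rewrite tcoef_sum big1 // => s _.
    by apply: contrapT => /eqP sd; apply: h; exists s.
  have [a [b [ea eb dE]]] := tcoefM_neq0 sd.
  have {ea} aE : a = ex (sU s.1) s.2.
    by move: ea; rewrite coef_mono; have [//|_] := eqVneq a (ex (sU s.1) s.2); rewrite eqxx.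
  have bPR : b \in supp P ++ supp R.
    by rewrite mem_cat !mem_supp; move: eb; rewrite /PU; case: s.1 => _ ->; rewrite ?orbT.
  have bC : on_coords C b by move: eb; rewrite /PU; case: s.1 => _; [apply: PC|apply: RC].
  have dC : on_coords C d by rewrite dE aE; apply: on_coordsD.
  have [||g gE] := @box_onto N J (r + (L + L)) (d - unit_exp y (d 0 y) + sh).
  - move=> i iJ; rewrite !mxE (negPf iJ) addr0.
    have [->|iy] := eqVneq i y; first by rewrite subrr.
    by rewrite subr0; apply: dC; rewrite in_setU1 negb_or iy.
  - move=> i iJ; have iy : i != y by apply: contraNneq yJ => <-.
    have := LP b bPR i; have := box_bounds s.2 i.
    rewrite !mxE iJ (negPf iy) dE aE !mxE (negPf iy).
    have [z ->] : exists z : {i : 'I_N | i \in J}, i = val z by exists (exist _ i iJ).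
    rewrite valK; have := ltn_ord (s.2 z).
    by move: (nat_of_ord (s.2 z)) (b 0 (val z)) => w u; lia.
  have dM : (`|(d 0 y - lo)%R| < M)%N.
    by move: dw; rewrite /y_window; move: (d 0 y) => u; lia.
  exists (Ordinal dM, g); rewrite /tg gE /= addrK.
  have -> : lo + (`|(d 0 y - lo)%R|%N)%:Z = d 0 y.
    by move: dw; rewrite /y_window; move: (d 0 y) => u; lia.
  by rewrite subrKC.
case/negP: dn0; apply/eqP; rewrite -tE -[RHS](cK t) tcoef_sum; apply: eq_bigr => s _.
by rewrite !tcoef_monoM mul1r mulrA.
Qed.

Lemma y_windowM (s lo : int) (m w : nat) A F :
  supp_in (y_window y s m.+1) A -> supp_in (y_window y lo w.+1) F ->
  supp_in (y_window y (s + lo) (m + w).+1) (A * F).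
Proof.
apply: supp_inM => a b; rewrite /y_window mxE.
by move: (a 0 y) (b 0 y) => u v; lia.
Qed.

Lemma window_vanish F (lo : int) (w m : nat) :
  supp_in (y_window y lo w) F ->
  (forall c, y_window y (lo + m%:Z) (w - m) c -> coef F c = 0) ->
  supp_in (y_window y lo m) F.
Proof.
move=> Fw Fv a Fa; have aw := Fw a Fa.
have [la|al] := leP (lo + m%:Z) (a 0 y).
  case/negP: (Fa); apply/eqP/Fv; move: aw; rewrite /y_window.
  by move: (a 0 y) la => u; lia.
by move: aw al; rewrite /y_window; move: (a 0 y) => u; lia.
Qed.

Lemma window0 F (lo : int) : supp_in (y_window y lo 0) F -> F = 0.
Proof.
move=> Fw; apply: torusP => a; apply: contrapT => /eqP /Fw.
by rewrite /y_window; move: (a 0 y) => u; lia.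
Qed.

(** Counted in layers, there are [(width y G).+1] unknowns in [A] and [(width y F).+1] in [B]
    against [(width y F + width y G).+1] equations. The shift of [B] aligns the lowest layers of
    both products. *)
Lemma ore_left F G : onC F -> onC G -> F != 0 -> G != 0 ->
  exists A B, [/\ onC A, onC B, A != 0, (width y A <= width y G)%N & A * F = B * G].
Proof.
move=> FC GC F0 G0.
have [|A [B [[AC Aw] [BC Bw] AB0 ABv]]] := @common_combination F G 0 (ylo y F - ylo y G)
  (ylo y F) (width y G).+1 (width y F).+1 (width y F + width y G).+1 FC GC.
  by lia.
have AB : A * F + B * G = 0.
  apply: (@window0 _ (ylo y F)); apply: window_vanish => [|c cw]; last first.
    by apply: ABv; move: cw; rewrite subn0 addr0; apply.
  apply: supp_inD.
    have := y_windowM Aw (window_width y F0); rewrite add0r addnC; exact.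
  by have := y_windowM Bw (window_width y G0); rewrite subrK.
have A0 : A != 0.
  apply: contraPneq AB => A0; rewrite A0 mul0r add0r => BG.
  case: (torus_mulf_eq0 y BG) => [B0|G0']; last by rewrite G0' eqxx in G0.
  by move: AB0; rewrite A0 B0 eqxx => -[].
exists A, (- B); split => //; first exact: supp_inN.
  by rewrite -ltnS; apply: width_window A0 Aw.
by apply/eqP; rewrite mulNr -addr_eq0 AB.
Qed.

(** The width bound of [ore_left] makes the left factor of [F] have width 0; the unit [s] then
    removes its power of [Y]. This moves a denominator across [F]. *)
Lemma ore_coefficients F (a : T) : onC F -> onJ a -> F != 0 -> a != 0 ->
  exists b G : T, [/\ onJ b, b != 0, onC G & b * F = G * a].
Proof.
move=> FC aJ F0 a0; have aC : onC a by apply: supp_in_sub aJ => ?; apply: onJ_C.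
have [A [B [AC BC A0 wA AB]]] := ore_left FC aC F0 a0.
have wA0 : width y A = 0%N by move: wA; rewrite (width_onJ aJ); lia.
pose s : T := mono q0 1 (unit_exp y (- ylo y A)).
have sC : onC s.
  apply: supp_in_mono => i; rewrite in_setU1 negb_or => /andP[iy _].
  by rewrite mxE (negPf iy).
have s0 : s != 0 by apply: mono_neq0; apply: oner_neq0.
exists (s * A), (s * B); split.
- apply: onJ_window; first exact: on_coordsM.
  have := window_width y A0; rewrite wA0; apply: supp_inM (_ : supp_in (eq^~ (unit_exp y (- ylo y A))) s) => [c d ->|].
    by rewrite /y_window !mxE eqxx; move: (d 0 y) (ylo y A) => u v; lia.
  exact: supp_in_mono.
- exact: (torus_mulf_neq0 y).
- exact: on_coordsM.
by rewrite -!mulrA AB.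
Qed.

(** One layer for [a] and [m.+1] for the quotient outnumber the [m.+1] top layers to be cancelled,
    where [m] is the difference of widths; what is left occupies [width y F] layers. *)
Lemma pseudo_division F G : onC F -> onC G -> F != 0 -> G != 0 ->
  exists a Q R : T, [/\ onJ a, a != 0, onC Q, onC R &
    a * G = Q * F + R /\ (R = 0 \/ (width y R < width y F)%N)].
Proof.
move=> FC GC F0 G0; have [ltGF|leFG] := ltnP (width y G) (width y F).
  exists 1, 0, G; split => //; [|exact: torus1_neq0|exact: supp_in0|].
    by apply: supp_in_mono => i _; rewrite mxE.
  by rewrite mul1r mul0r add0r; split => //; right.
pose m := (width y G - width y F)%N.
have [|a [B [[aC aw] [BC Bw] aB0 aBv]]] := @common_combination G F 0 (ylo y G - ylo y F)
  (ylo y G + (width y F)%:Z) 1 m.+1 m.+1 GC FC; first by lia.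
have Rw : supp_in (y_window y (ylo y G) (width y F)) (a * G + B * F).
  apply: (@window_vanish _ _ (width y G).+1) => [|c cw]; last first.
    by apply: aBv; move: cw; rewrite /m subSn.
  apply: supp_inD.
    by have := y_windowM aw (window_width y G0); rewrite !add0r; apply.
  by have := y_windowM Bw (window_width y F0); rewrite subrK subnK.
have Rwidth : a * G + B * F = 0 \/ (width y (a * G + B * F)%R < width y F)%N.
  have [->|R0] := eqVneq (a * G + B * F) 0; first by left.
  by right; apply: width_window R0 Rw.
exists a, (- B), (a * G + B * F); split.
- exact: onJ_window aC aw.
(* With [a = 0] the remainder would be a nonzero multiple of [F], which is too wide. *)
- apply: contraPneq Rwidth => a0; rewrite a0 mul0r add0r.
  have B0 : B != 0 by case: aB0; rewrite ?a0 ?eqxx.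
  case=> [/(torus_mulf_eq0 y)[/eqP|/eqP]|]; rewrite ?(negPf B0) ?(negPf F0) //.
  by rewrite widthM //; lia.
- exact: supp_inN.
- by apply: supp_inD; apply: on_coordsM => //; apply: supp_in_sub aC => ?.
by split=> //; rewrite mulNr addrC addrK.
Qed.

Variable Gam : set k.
Hypotheses (sG : subgroup Gam) (Gq : forall i j, i \in C -> j \in C -> Gam (q i j)).

Local Notation "x ~ z" := (cgr Gam x z) (at level 70).

(* A fraction-free Euclidean algorithm: if [F' G = G' F] is a least common left
   multiple, then [F] and [F'] have the same ratio of extreme coefficients (in
   [D[Y]], similar polynomials have the same determinant). *)
Lemma similar_lratio F G F' G' : onC F -> onC G -> onC F' -> onC G' ->
  F != 0 -> G != 0 -> F' != 0 -> F' * G = G' * F -> width y F' = width y F ->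
  (forall A B, onC A -> onC B -> A != 0 -> A * G = B * F -> (width y F <= width y A)%N) ->
  lratio y F' ~ lratio y F.
Proof.
have [n] := ubnP (width y F + width y G); elim: n F G F' G' => // n IHn.
have lr0 H : H != 0 -> lratio y H != 0 by apply: lratio_neq0.
have lrM H H' : onC H -> onC H' -> H != 0 -> H' != 0 ->
  lratio y (H * H') ~ lratio y H * lratio y H' by apply: lratioM.
have lrJ H (a : T) : onC H -> onJ a -> H != 0 -> a != 0 ->
    (lratio y (H * a) ~ lratio y H) /\ (lratio y (a * H) ~ lratio y H).
  move=> HC aJ H0 a0; have aC : onC a by apply: supp_in_sub aJ => ?; apply: onJ_C.
  have a1 : lratio y a = 1 by apply: lratio_width0 => //; apply: width_onJ.
  by split; [have := lrM _ _ HC aC H0 a0 | have := lrM _ _ aC HC a0 H0]; rewrite a1 ?mulr1 ?mul1r.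
(* The division step, for [width y F <= width y G]; the other case exchanges the two sides of the
   common multiple. *)
have step F G F' G' : onC F -> onC G -> onC F' -> onC G' ->
    F != 0 -> G != 0 -> F' != 0 -> F' * G = G' * F -> width y F' = width y F ->
    (forall A B, onC A -> onC B -> A != 0 -> A * G = B * F -> (width y F <= width y A)%N) ->
    (width y F <= width y G)%N -> (width y F + width y G < n.+1)%N ->
    lratio y F' ~ lratio y F.
  move=> FC GC F'C G'C F0 G0 F'0 E wF' minF wFG wn.
  have [w0|w0] := posnP (width y F).
    rewrite !lratio_width0 ?wF' //; exact: (cgr_refl sG (oner_neq0 k)).
  have [a [Q [R [aJ a0 QC RC [aG wR]]]]] := pseudo_division FC GC F0 G0.
  have aC : onC a by apply: supp_in_sub aJ => ?; apply: onJ_C.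
  have R0 : R != 0.
    apply: contraPneq aG => ->; rewrite addr0 => aG.
    by have := minF a Q aC QC a0 aG; rewrite (width_onJ aJ); lia.
  case: wR => [/eqP|wR]; first by rewrite (negPf R0).
  (* [G] is replaced by the remainder [R], and [F'] by [F2] with [F2 * a = b * F']; since [a] and
     [b] do not involve [Y], the class of the ratio is unchanged. *)
  have [b [F2 [bJ b0 F2C bF']]] := ore_coefficients F'C aJ F'0 a0.
  have bC : onC b by apply: supp_in_sub bJ => ?; apply: onJ_C.
  have F20 : F2 != 0.
    apply: contra_eq_neq bF' => ->; rewrite mul0r; exact: torus_mulf_neq0.
  have wF2 : width y F2 = width y F.
    have := congr1 (@width _ _ _ q0 y) bF'.
    by rewrite !widthM // (width_onJ aJ) (width_onJ bJ) add0n addn0 wF' => ->.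
  have E2 : F2 * R = (b * G' - F2 * Q) * F.
    have -> : R = a * G - Q * F by rewrite aG addrAC subrr add0r.
    by rewrite mulrBr mulrBl !mulrA -bF' -!mulrA E.
  have F2F : lratio y F2 ~ lratio y F.
    apply: (IHn F R F2 (b * G' - F2 * Q)) => //.
    - by lia.
    - by apply: supp_inD; [|apply: supp_inN]; apply: on_coordsM.
    (* A common multiple of [R] and [F] gives one of [G] and [F], so minimality passes to the
       remainder. *)
    move=> A B AC BC A0 AB; have := minF (A * a) (B + A * Q).
    rewrite widthM // (width_onJ aJ) addn0; apply.
    - exact: on_coordsM.
    - by apply: supp_inD => //; apply: on_coordsM.
    - exact: torus_mulf_neq0.
    by rewrite -mulrA aG mulrDr AB mulrDl -mulrA addrC.
  have [F2a _] := lrJ F2 a F2C aJ F20 a0; have [_ bF] := lrJ F' b F'C bJ F'0 b0.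
  apply: (cgr_trans sG _ (cgr_sym sG bF)); first by apply/lr0/torus_mulf_neq0.
  by rewrite bF'; apply: (cgr_trans sG _ F2a F2F); apply: lr0.
move=> F G F' G' wn FC GC F'C G'C F0 G0 F'0 E wF' minF.
have [leFG|ltGF] := leqP (width y F) (width y G); first exact: step E wF' minF leFG wn.
have G'0 : G' != 0.
  apply: contra_eq_neq E => ->; rewrite mul0r; exact: torus_mulf_neq0.
have wG' : width y G' = width y G.
  by have := congr1 (@width _ _ _ q0 y) E; rewrite !widthM //; lia.
have GG : lratio y G' ~ lratio y G.
  apply: (step G F G' F') => //; [|exact: ltnW|by rewrite addnC].
  move=> A B AC BC A0 AF; have B0 : B != 0.
    apply: contra_eq_neq AF => ->; rewrite mul0r; exact: torus_mulf_neq0.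
  have := minF B A BC AC B0 (esym AF).
  by have := congr1 (@width _ _ _ q0 y) AF; rewrite !widthM //; lia.
(* The ratios of the equal products [F' * G] and [G' * F] agree, and the classes of [G'] and [G]
   cancel. *)
have FG := lrM F' G F'C GC F'0 G0; have GF := lrM G' F G'C FC G'0 F0.
have FGGF : lratio y F' * lratio y G ~ lratio y G' * lratio y F.
  apply: (cgr_trans sG _ (cgr_sym sG FG)); first by apply/lr0/torus_mulf_neq0.
  by rewrite E.
have [_ GM _] := sG; have := GM _ _ FGGF GG; rewrite /cgr.
suff -> : lratio y F' / lratio y F = lratio y F' * lratio y G /
    (lratio y G' * lratio y F) * (lratio y G' / lratio y G) by [].
by field; rewrite !lr0.
Qed.

End OreDomain.

(** * Simple modules: the torsion case *)

Section SimpleModules.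
Variables (k : fieldType) (N : nat) (q : 'I_N -> 'I_N -> k).
Hypothesis q0 : forall i j, q i j != 0.
Variables (V : lmodType k) (X Xi : 'I_N -> V -> V).
Hypotheses (q_as : mult_antisym q) (XM : qtorus_module q X Xi).
Variable gens : seq (V -> V).
Hypothesis gensP : forall g, List.In g gens <-> exists i, g = X i \/ g = Xi i.
Hypothesis simV : simple_module gens.
Variable y : 'I_N.
Local Notation E := 'rV[int]_N.
Local Notation T := (torus q0).
Local Notation Xmon := (monomial X Xi).
Local Notation act := (act X Xi).
Implicit Types (F G H P Q R : T) (a b c : E) (u v w : V) (J : {set 'I_N}).

Definition torsion_free J : Prop :=
  forall v F, v != 0 -> supp_in (on_coords J) F -> act F v = 0 -> F = 0.

Lemma gens_xpow g : List.In g gens -> exists i m, g = xpow X Xi i m.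
Proof. by move=> /gensP[i [->|->]]; exists i; [exists 1|exists (-1)]. Qed.

Lemma xpow_neq0 i m v : v != 0 -> xpow X Xi i m v != 0.
Proof.
rewrite -(monomial_unit_exp X Xi i m v); apply: contraNneq.
by move=> /(monomial_eq0 q_as XM) ->.
Qed.

(** Torsion vectors form a submodule: the Ore condition handles sums, conjugation handles
    generators. Simplicity leaves all or nothing, and [v] excludes all. *)
Lemma torsion_free_of_one J v : y \notin J ->
  free_monomials X Xi J v -> torsion_free J.
Proof.
move=> yJ /(free_monomialsP q0)-fv.
pose W := [set u | exists F, [/\ supp_in (on_coords J) F, F != 0 & act F u = 0]].
have sW : subspace W.
  split.
    exists 1; split; [|exact: torus1_neq0|exact: lin_map0 (lin_act XM _)].
    by apply: supp_in_mono => i _; rewrite mxE.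
  move=> c u w [F [FJ F0 Fu]] [G [GJ G0 Gw]].
  have FC : supp_in (on_coords (y |: J)%SET) F by apply: supp_in_sub FJ => a; apply: onJ_C.
  have [b [H [bJ b0 HC bF]]] := ore_coefficients yJ FC GJ F0 G0.
  exists (b * F); split; [exact: on_coordsM|exact: (torus_mulf_neq0 y)|].
  rewrite (lin_act XM) (actM q_as XM) Fu (lin_map0 (lin_act XM _)) scaler0 add0r.
  by rewrite bF (actM q_as XM) Gw (lin_map0 (lin_act XM _)).
have [_ /(_ W sW)[|W0|WT]] := simV.
- move=> g u /gens_xpow[i [m ->]] [F [FJ F0 Fu]]; exists (twist i m F); split.
  + exact: twist_supp.
  + by rewrite twist_eq0.
  + by rewrite (act_twist q_as XM) Fu (lin_map0 (lin_xpow XM _ _)).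
- move=> u F u0 FJ Fu; apply/eqP/negPn/negP => F0; case/negP: u0; apply/eqP.
  by have : W u; [exists F | rewrite W0].
have : W v by rewrite WT.
by move=> [F [FJ /eqP F0 Fv]]; case: F0; apply: fv.
Qed.

Lemma free_of_torsion_free J v : torsion_free J -> v != 0 -> free_monomials X Xi J v.
Proof. by move=> tf v0; apply/(free_monomialsP q0) => F FJ; apply: tf. Qed.

Lemma maximal_torsion_free : exists J, [/\ y \notin J, torsion_free J &
  forall J' v, y \notin J' -> (#|J| < #|J'|)%N -> ~ free_monomials X Xi J' v].
Proof.
have [[v v0] _] := simV.
pose P J := `[< y \notin J /\ exists u, free_monomials X Xi J u >].
have P0 : P finset.set0.
  apply/asboolP; split; first by rewrite finset.in_set0.
  by exists v; apply: (free_monomials_set0 q0).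
case: (@arg_maxnP _ _ P (fun J => #|J|) P0) => J /asboolP[yJ [u fu]] Jmax.
exists J; split => //; first exact: torsion_free_of_one fu.
move=> J' w yJ' JJ' fw; have /Jmax le : P J' by apply/asboolP; split => //; exists w.
by have := leq_ltn_trans le JJ'; rewrite ltnn.
Qed.

Section TorsionCase.
Variable J : {set 'I_N}.
Hypotheses (yJ : y \notin J) (tfJ : torsion_free J).
Local Notation C := (y |: J)%SET.
Local Notation onC := (supp_in (on_coords C)).
Local Notation onJ := (supp_in (on_coords J)).
Variables (Gam : set k) (sG : subgroup Gam).
Hypothesis Gq : forall i j, i \in C -> j \in C -> Gam (q i j).
Variables (i : 'I_N) (v : V) (F : T).
Hypotheses (iC : i \notin C) (Gi : forall j, j \in J -> Gam (q i j)).
Hypotheses (v0 : v != 0) (FC : onC F) (F0 : F != 0) (Fv : act F v = 0).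
(** Minimality over every nonzero vector of [V], not only [v], stands in for simplicity of the
    cyclic [D[Y]]-modules. *)
Hypothesis minF : forall u G, u != 0 -> onC G -> G != 0 -> act G u = 0 ->
  (width y F <= width y G)%N.

Let vs (l : int) := xpow X Xi i l v.
Let Fs (l : int) := twist i l F.

Let vs_neq0 l : vs l != 0. Proof. exact: xpow_neq0. Qed.
Let Fs_neq0 l : Fs l != 0. Proof. by rewrite twist_eq0. Qed.
Let Fs_onC l : onC (Fs l). Proof. exact: twist_supp. Qed.
Let Fs_vs l : act (Fs l) (vs l) = 0.
Proof. by rewrite (act_twist q_as XM) Fv (lin_map0 (lin_xpow XM _ _)). Qed.
Let width_Fs l : width y (Fs l) = width y F. Proof. exact: width_twist. Qed.

Lemma width_gt0 : (0 < width y F)%N.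
Proof.
rewrite lt0n; apply/eqP => w0.
have s0 : mono q0 1 (unit_exp y (- ylo y F)) != 0 by apply: mono_neq0; apply: oner_neq0.
have sF0 := torus_mulf_neq0 y s0 F0; case/eqP: (sF0); apply: (tfJ v0).
  apply: (onJ_window yJ).
    apply: on_coordsM => //; apply: supp_in_mono => j.
    by rewrite in_setU1 negb_or mxE => /andP[/negPf ->].
  have := window_width y F0; rewrite w0.
  apply: supp_inM (_ : supp_in (eq^~ (unit_exp y (- ylo y F))) _) => [c d ->|].
    by rewrite /y_window !mxE eqxx; move: (d 0 y) (ylo y F) => s t; lia.
  exact: supp_in_mono.
by rewrite (actM q_as XM) Fv (lin_map0 (lin_act XM _)).
Qed.

(** Division of [Q * H] by [Fs l] leaves a remainder killing [vs l], hence 0 by minimality. The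
    resulting identity [a * Q * H = G * Fs l] is a least common multiple, because a shorter one
    would annihilate the nonzero vector [act H (vs l)]. *)
Lemma annihilator_lratio l H Q : onC H -> act H (vs l) != 0 -> onC Q -> Q != 0 ->
  width y Q = width y F -> act (Q * H) (vs l) = 0 ->
  cgr Gam (lratio y Q) (lratio y (Fs l)).
Proof.
move=> HC Hv QC Q0 wQ QHv.
have H0 : H != 0 by apply: contraNneq Hv => ->; rewrite act0.
have QHC : onC (Q * H) by apply: on_coordsM.
have QH0 := torus_mulf_neq0 y Q0 H0.
have [a [G [R [aJ a0 GC RC [aE wR]]]]] := pseudo_division yJ (@Fs_onC l) QHC (Fs_neq0 l) QH0.
have aC : onC a by apply: supp_in_sub aJ => ?; apply: onJ_C.
have Rv : act R (vs l) = 0.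
  have -> : R = a * (Q * H) - G * Fs l by rewrite aE addrAC subrr add0r.
  by rewrite actB !(actM q_as XM a) QHv (actM q_as XM G) Fs_vs !(lin_map0 (lin_act XM _)) subrr.
have R0 : R = 0.
  case: wR => // wR; apply/eqP; apply: contraLR wR => R0; rewrite -leqNgt width_Fs.
  exact: minF Rv.
have aQF : cgr Gam (lratio y (a * Q)) (lratio y (Fs l)).
  apply: (@similar_lratio _ _ _ q0 y J yJ Gam sG Gq (Fs l) H (a * Q) G) => //.
  - exact: on_coordsM.
  - exact: torus_mulf_neq0.
  - by rewrite -mulrA aE R0 addr0.
  - by rewrite widthM // (width_onJ yJ aJ) width_Fs.
  move=> A B AC BC A0 AB; rewrite width_Fs; apply: (minF Hv) => //.
  by rewrite -(actM q_as XM) AB (actM q_as XM) Fs_vs (lin_map0 (lin_act XM _)).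
apply: (cgr_trans sG _ _ aQF); first by apply: lratio_neq0; apply: torus_mulf_neq0.
apply: (cgr_sym sG); have := lratioM y sG Gq aC QC a0 Q0.
by rewrite (lratio_width0 a0 (width_onJ yJ aJ)) mul1r.
Qed.

(** All terms are nonzero. A shortest such relation is the substitute for an isomorphism between two
    of the cyclic modules. *)
Let relation (n : nat) := exists (Ls : seq int) (H : int -> T),
  [/\ uniq Ls, (0 < size Ls <= n)%N,
      forall l, l \in Ls -> onC (H l) /\ act (H l) (vs l) != 0
    & \sum_(l <- Ls) act (H l) (vs l) = 0].

Lemma relation_filter (Ls : seq int) (H : int -> T) : uniq Ls ->
  (forall l, l \in Ls -> onC (H l)) -> \sum_(l <- Ls) act (H l) (vs l) = 0 ->
  (exists2 l, l \in Ls & act (H l) (vs l) != 0) -> relation (size Ls).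
Proof.
move=> uL HC sum0 [l lL Hl].
exists [seq l <- Ls | act (H l) (vs l) != 0], H; split.
- exact: filter_uniq.
- rewrite size_filter count_size andbT -has_count; apply/hasP; by exists l.
- by move=> j; rewrite mem_filter => /andP[Hj /HC].
rewrite big_filter -[RHS]sum0 [RHS](bigID (fun l => act (H l) (vs l) != 0)) /=.
by rewrite [X in _ = _ + X]big1 ?addr0 // => j; rewrite negbK => /eqP.
Qed.

Hypothesis torsion_i : ~ free_monomials X Xi (i |: J)%SET v.

(** A torsion relation over [i |: J] is sorted by the exponent of [X_i]: each group is an element of
    [L_J] applied to some [vs l], and nonzero groups act without kernel. *)
Lemma relation_exists : exists n, relation n.
Proof.
have [G [GJ [Gv G0]]] : exists G,
    supp_in (on_coords (i |: J)%SET) G /\ act G v = 0 /\ G != 0.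
  apply: contrapT => h; apply: torsion_i; apply/(free_monomialsP q0) => G GJ Gv.
  by apply/eqP/negPn/negP => G0; apply: h; exists G.
pose Ls := undup [seq a 0 i | a <- supp G].
pose H (l : int) : T := \sum_(a <- supp G | a 0 i == l)
  mono q0 (coef G a * (cocycle q (a - unit_exp i l) (unit_exp i l))^-1) (a - unit_exp i l).
have HJ l : onJ (H l).
  rewrite /H big_seq_cond; apply: supp_in_sum => a /andP[]; rewrite mem_supp => Ga /eqP ai.
  apply: supp_in_mono => j jJ; rewrite !mxE; have [->|ji] := eqVneq j i.
    by rewrite ai subrr.
  by rewrite subr0; apply: (GJ _ Ga); rewrite in_setU1 negb_or ji.
have HC l : onC (H l) by apply: supp_in_sub (HJ l) => ?; apply: onJ_C.
have actH l : act (H l) (vs l) = \sum_(a <- supp G | a 0 i == l) coef G a *: Xmon a v.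
  rewrite /H -big_filter act_sum big_filter; apply: eq_bigr => a _.
  rewrite act_mono /vs -(monomial_unit_exp X Xi i l v) (monomialD q_as XM) scalerA.
  by rewrite mulfVK ?cocycle_neq0 // subrK.
exists (size Ls); apply: (@relation_filter Ls H (undup_uniq _)) => //.
  under eq_bigr do rewrite actH.
  rewrite (exchange_big_dep xpredT) //= -[RHS]Gv [RHS]actE big_seq [RHS]big_seq.
  apply: eq_bigr => a aG; rewrite -big_filter.
  have aL : a 0 i \in Ls by rewrite mem_undup; apply/mapP; exists a.
  have -> : [seq l <- Ls | a 0 i == l] = [:: a 0 i].
    rewrite -(filter_pred1_uniq (undup_uniq _) aL); apply: eq_filter => l /=.
    exact: eq_sym.
  by rewrite big_seq1.
have /torus0P[a Ga] := G0; exists (a 0 i); first by rewrite mem_undup; apply/mapP; exists a; rewrite ?mem_supp.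
apply/eqP => Hv0; have := tfJ (vs_neq0 _) (HJ _) Hv0.
move/(congr1 (fun F => coef F (a - unit_exp i (a 0 i)))); rewrite tcoef0 tcoef_sum.
rewrite big_mkcond (bigD1_seq a) ?supp_uniq ?mem_supp //= eqxx coef_mono eqxx.
rewrite big1 ?addr0 => [/eqP|a' aa'].
  by rewrite mulf_eq0 invr_eq0 (negPf Ga) (negPf (cocycle_neq0 q0 _ _)).
by case: ifP => // _; rewrite coef_mono (inj_eq (addIr _)) eq_sym (negPf aa').
Qed.

Lemma commutation_power : exists2 M : int, M != 0 & Gam (q i y ^ M).
Proof.
have [n [rn nmin]] : exists n, relation n /\ forall m, relation m -> (n <= m)%N.
  have exn : exists n, `[< relation n >].
    by have [n rn] := relation_exists; exists n; apply/asboolP.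
  case: (ex_minnP exn) => n /asboolP rn nmin; exists n; split => // m rm.
  by apply: nmin; apply/asboolP.
have [Ls [H [uL sL HL sum0]]] := rn.
case: Ls uL sL HL sum0 => [//|l Ls] /= /andP[lLs uL] sL HL.
rewrite big_cons => sum0; have [HlC Hl0] := HL l (mem_head _ _).
case: Ls lLs uL sL HL sum0 => [|s Ls] lLs uL sL HL sum0.
  by move: sum0; rewrite big_nil addr0 => /eqP; rewrite (negPf Hl0).
have [HsC Hs0] : onC (H s) /\ act (H s) (vs s) != 0 by apply: HL; rewrite !inE eqxx orbT.
have nz j : act (H j) (vs j) != 0 -> H j != 0 by apply: contraNneq => ->; rewrite act0.
have [Q [B [QC BC Q0 wQ QH]]] := ore_left yJ HlC (@Fs_onC l) (nz _ Hl0) (Fs_neq0 l).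
have QHl : act (Q * H l) (vs l) = 0.
  by rewrite QH (actM q_as XM) Fs_vs (lin_map0 (lin_act XM _)).
have {}wQ : width y Q = width y F.
  apply/eqP; rewrite eqn_leq -{1}(width_Fs l) wQ /=; apply: (minF Hl0) => //.
  by rewrite -(actM q_as XM).
(* Otherwise [Q], which kills the term of [l], would turn the relation into a shorter one. So a
   single [Q] annihilates nonzero vectors of both modules. *)
have QHs : act (Q * H s) (vs s) = 0.
  apply/eqP/negPn/negP => nQHs.
  have : relation (size (s :: Ls)).
    apply: (@relation_filter _ (fun j => Q * H j)) => //.
    - by move=> j jLs; apply: on_coordsM => //; have [] := HL j _; rewrite // inE jLs orbT.
    - have := congr1 (act Q) sum0; rewrite (lin_map0 (lin_act XM _)).
      rewrite (lin_mapD (lin_act XM _)) -(actM q_as XM) QHl add0r => Q0E.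
      rewrite -[RHS]Q0E (lin_map_sum (lin_act XM _)); apply: eq_bigr => j _.
      by rewrite (actM q_as XM).
    - by exists s; rewrite ?inE ?eqxx.
  by move=> /nmin; move: sL => /=; lia.
have cl := annihilator_lratio HlC Hl0 QC Q0 wQ QHl.
have cs := annihilator_lratio HsC Hs0 QC Q0 wQ QHs.
have := cgr_trans sG (lratio_neq0 y Q0) (cgr_sym sG cl) cs.
rewrite /cgr !lratio_twist //; set d1 := lead y false F; set d2 := lead y true F.
have [_ GM GV] := sG; have xn := xcomm_neq0 q0.
have d1C : on_coords C d1 by apply: FC; case: (leadP y false F0).
have d2C : on_coords C d2 by apply: FC; case: (leadP y true F0).
have -> : xcomm q i l d1 / xcomm q i l d2 * lratio y F /
    (xcomm q i s d1 / xcomm q i s d2 * lratio y F) = xcomm q i (l - s) (d1 - d2).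
  have lE d : xcomm q i l d = xcomm q i (l - s) d * xcomm q i s d.
    by rewrite -xcommDl // subrK.
  have dE m : xcomm q i m d1 = xcomm q i m (d1 - d2) * xcomm q i m d2.
    by rewrite -xcommDr // subrK.
  rewrite !lE !dE; field.
  by rewrite !xn lratio_neq0.
(* All factors but that of [y] lie in [Gam]; the exponent of [q i y] is [l - s] times the width of
   [F], hence nonzero. *)
rewrite /xcomm (bigD1 y) //=; set z := \prod_(j | _) _ => Gz.
exists ((l - s) * (d1 - d2) 0 y).
  rewrite mulf_neq0 //; first by rewrite subr_eq0; apply: contraNneq lLs => ->; rewrite inE eqxx.
  have := width_gt0; have := width_eq y F0; rewrite /yhi /ylo -/d1 -/d2 !mxE.
  by move: (d1 0 y) (d2 0 y) => u w; lia.
have Gz' : Gam z.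
  apply: subgroup_prod => // j _ jy; have [jJ|jJ] := boolP (j \in J).
    by apply: subgroupX => //; apply: Gi.
  have jC : j \notin C by rewrite in_setU1 negb_or jy.
  by rewrite !mxE d1C // d2C // subrr mulr0 expr0z; case: sG.
have z0 : z != 0 by apply/prodf_neq0 => j _; rewrite expfz_neq0.
by have := GM _ _ Gz (GV _ Gz'); rewrite mulfK.
Qed.

End TorsionCase.
End SimpleModules.

(** * Simple modules: the torsion-free case *)

Section Slices.
Variables (k : fieldType) (N : nat) (q : 'I_N -> 'I_N -> k).
Hypothesis q0 : forall i j, q i j != 0.
Variable y : 'I_N.
Local Notation E := 'rV[int]_N.
Local Notation T := (torus q0).
Implicit Types (F G H : T) (a b c : E).

(** The component of degree [j] in [Y], still carrying its power of [Y]. *)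
Definition slice (j : int) F : T := tfilter (fun a => a 0 y == j) F.

Lemma coef_slice j F a : coef (slice j F) a = if a 0 y == j then coef F a else 0.
Proof. exact: coef_tfilter. Qed.

Lemma slice_window j F : supp_in (y_window y j 1) (slice j F).
Proof.
move=> a; rewrite coef_slice; have [<- _|_] := eqVneq (a 0 y) j; last by rewrite eqxx.
by rewrite /y_window; move: (a 0 y) => u; lia.
Qed.

Lemma slice_supp (P : E -> Prop) j F : supp_in P F -> supp_in P (slice j F).
Proof. by move=> FP a; rewrite coef_slice; case: ifP => [_ /FP//|_]; rewrite eqxx. Qed.

Lemma slice_rest_window F : F != 0 ->
  supp_in (y_window y (ylo y F) (width y F)) (F - slice (yhi y F) F).
Proof.
move=> F0 a; rewrite tcoefB coef_slice; have [_|ah] := eqVneq (a 0 y) (yhi y F).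
  by rewrite subrr eqxx.
rewrite subr0 => /(y_range y); move: ah; rewrite (width_eq y F0) /y_window.
by move: (a 0 y) (ylo y F) => u v; lia.
Qed.

Lemma window_mul (lo lo' : int) (m : nat) F G :
  supp_in (y_window y lo 1) F -> supp_in (y_window y lo' m) G ->
  supp_in (y_window y (lo + lo') m) (F * G).
Proof.
apply: supp_inM => a b; rewrite /y_window mxE.
by move: (a 0 y) (b 0 y) => s t; lia.
Qed.

Lemma window_mono (j : int) x : supp_in (y_window y j 1) (mono q0 x (unit_exp y j)).
Proof. by apply: supp_in_mono; rewrite /y_window mxE eqxx; lia. Qed.

End Slices.

Section DirectSum.
Variables (k : fieldType) (N : nat) (q : 'I_N -> 'I_N -> k).
Hypothesis q0 : forall i j, q i j != 0.
Variables (V : lmodType k) (X Xi : 'I_N -> V -> V).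
Hypotheses (q_as : mult_antisym q) (XM : qtorus_module q X Xi).
Hypothesis V_neq0 : exists v : V, v != 0.
Variables (y : 'I_N) (J : {set 'I_N}).
Hypothesis yJ : y \notin J.
Local Notation E := 'rV[int]_N.
Local Notation T := (torus q0).
Local Notation Xmon := (monomial X Xi).
Local Notation act := (act X Xi).
Local Notation C := (y |: J)%SET.
Local Notation onJ := (supp_in (on_coords J)).
Implicit Types (F G H : T) (a b c : E) (u v w : V).

Hypothesis tfC : torsion_free q0 X Xi C.
Hypothesis maxJ : forall (J' : {set 'I_N}) v, y \notin J' -> (#|J| < #|J'|)%N ->
  ~ free_monomials X Xi J' v.

(** The sum of the [Y^j U] for [lo <= j < lo + m], where [U] is the cyclic module of [v] over the
    torus of the [X_i]. *)
Definition layers v (lo : int) (m : nat) : set V :=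
  [set u | exists2 F : T, supp_in (y_window y lo m) F & u = act F v].

(** Independence over [D] with denominators cleared. *)
Definition independent m (u : 'I_m -> V) : Prop :=
  forall x : 'I_m -> T, (forall l, onJ (x l)) ->
    \sum_l act (x l) (u l) = 0 -> forall l, x l = 0.

Lemma onJ_y0 F : onJ F -> supp_in (y_window y 0 1) F.
Proof. by move=> FJ a /FJ aJ; rewrite /y_window aJ. Qed.

(** [m] independent vectors carry [m * r ^ D] independent monomials from a box, while maximality of
    [J] away from [y] lets each of the [s] layers offer only a constant times [r ^ D] spanning
    ones. *)
Lemma rank_bound v (s : nat) : exists K, forall m (u : 'I_m -> V),
  (forall l, layers v 0 s (u l)) -> independent u -> (m <= K)%N.
Proof.
have [C0 growth] : exists C0, forall n, exists (S : finType) (w : S -> V),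
    (#|S| <= C0 * n.+1 ^ #|J|)%N /\
    forall a : E, (forall i, i \notin (~: [set y])%SET -> a 0 i = 0) ->
      (l1norm a <= n)%N -> lspan (range w) (Xmon a v).
  apply: (monomial_growth q_as XM) => J' J'y cJ'; apply: maxJ; last by rewrite cJ'.
  by apply/negP => /(fintype.subsetP J'y); rewrite !inE eqxx.
exists (s * C0 * #|J|.+1 ^ #|J|)%N => m u uW uind.
have /choice[F_ F_P] : forall l, exists F : T, supp_in (y_window y 0 s) F /\ u l = act F v.
  by move=> l; have [F Fw ul] := uW l; exists F.
pose L := (\max_(l < m) \max_(a <- supp (F_ l)) l1norm a)%N.
have LP l a : coef (F_ l) a != 0 -> (l1norm a <= L)%N.
  rewrite -mem_supp => aF; apply: leq_trans (leq_bigmax l).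
  exact: (leq_bigmax_seq a aF isT).
(* This [r] gives [(D * r + L).+1 = D.+1 * r], so [r ^ D] cancels in the final comparison. *)
pose D := #|J|; pose r := L.+1.
have [S [w [cS wP]]] := growth (D * r + L)%N.
pose fam (p : 'I_m * {ffun {i : 'I_N | i \in J} -> 'I_r}) := Xmon (box p.2) (u p.1).
pose gen (p : 'I_s * S) := xpow X Xi y (p.1 : nat)%:Z (w p.2).
have fam_free : free_family fam.
  move=> c sum0.
  pose x l : T := \sum_(f : {ffun {i : 'I_N | i \in J} -> 'I_r}) mono q0 (c (l, f)) (box f).
  have x0 : forall l, x l = 0.
    apply: uind => [l|].
      by apply: supp_in_sum => f _; apply: supp_in_mono => i; apply: box_out.
    transitivity (\sum_l \sum_f c (l, f) *: Xmon (box f) (u l)); last first.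
      by rewrite pair_bigA -[RHS]sum0; apply: eq_bigr => -[].
    apply: eq_bigr => l _; rewrite act_sum; apply: eq_bigr => f _.
    by rewrite act_mono.
  move=> [l f]; have := congr1 (fun F => coef F (box f)) (x0 l).
  rewrite tcoef0 tcoef_sum (bigD1 f) //= coef_mono eqxx big1 ?addr0 // => f' ff'.
  by rewrite coef_mono (inj_eq (@box_inj _ _ _)) eq_sym (negPf ff').
have fam_gen p : lspan (range gen) (fam p).
  case: p => l f; rewrite /fam /=; have [Fw ->] := F_P l.
  have -> : Xmon (box f) (act (F_ l) v) = act (mono q0 1 (box f) * F_ l) v.
    by rewrite (actM q_as XM) act_mono scale1r.
  pose B : set E := [set a : E | 0 <= a 0 y < s%:Z /\ (l1norm a <= D * r + L)%N].
  have FB : supp_in B (mono q0 1 (box f) * F_ l).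
    apply: supp_inM (_ : supp_in (eq^~ (box f)) _)
                    (_ : supp_in (fun a => coef (F_ l) a != 0) _) => //; last first.
      exact: supp_in_mono.
    move=> _ b -> Fb /=; split.
      by have := Fw b Fb; rewrite mxE /y_window box_out //; move: (b 0 y) => z; lia.
    apply: leq_trans (l1normD _ _) _; apply: leq_add; last exact: (LP l b Fb).
    exact: l1norm_box.
  have FBv := act_lspan (X := X) (Xi := Xi) (v := v) FB; apply: lspan_mono FBv.
  move=> _ [a [ay aL] <-].
  pose a' := a - unit_exp y (a 0 y).
  have a'y : a' 0 y = 0 by rewrite !mxE eqxx subrr.
  have a'P : forall i, i \notin (~: [set y])%SET -> a' 0 i = 0.
    by move=> i; rewrite !inE negbK => /eqP ->.
  have a'L : (l1norm a' <= D * r + L)%N.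
    apply: leq_trans aL; rewrite /l1norm; apply: leq_sum => i _; rewrite !mxE.
    by have [->|_] := eqVneq i y; rewrite ?subrr ?subr0.
  have -> : Xmon a v = (cocycle q (unit_exp y (a 0 y)) a')^-1 *:
      xpow X Xi y (a 0 y) (Xmon a' v).
    rewrite -(monomial_unit_exp X Xi) (monomialD q_as XM) scalerA.
    by rewrite mulVf ?cocycle_neq0 // scale1r /a' addrC subrK.
  apply: lspanZ; apply: lspan_image (wP a' a'P a'L); first exact: (lin_xpow XM).
  move=> _ [t _ <-]; apply: sub_lspan.
  have jlt : (`|(a 0 y)%R| < s)%N by move: ay; move: (a 0 y) => z; lia.
  exists (Ordinal jlt, t) => //; apply: (congr1 (fun z => xpow X Xi y z (w t))) => /=.
  by move: ay; move: (a 0 y) => z; lia.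
have := steinitz fam_free fam_gen.
rewrite !card_prod card_box !card_ord -/D => le1.
have rD : (0 < r ^ D)%N by rewrite expn_gt0.
rewrite -(leq_pmul2r rD); apply: leq_trans le1 _.
apply: (@leq_trans (s * (C0 * (D * r + L).+1 ^ D))); first by rewrite leq_mul2l cS orbT.
rewrite -!mulnA !leq_mul2l -expnMn; apply/orP; right; apply/orP; right.
by apply: eq_leq; congr (_ ^ _)%N; rewrite /r; lia.
Qed.

(** Ranks being bounded, some [v] has the least bound; a nonzero [w] in its module cannot have a
    smaller one, so it reaches the same rank. *)
Lemma minimal_rank : exists v m, [/\ v != 0,
  forall m' (u : 'I_m' -> V), (forall l, layers v 0 1 (u l)) -> independent u -> (m' <= m)%N
  & forall w, w != 0 -> layers v 0 1 w -> exists u : 'I_m -> V,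
      (forall l, layers w 0 1 (u l)) /\ independent u].
Proof.
pose P v m := forall m' (u : 'I_m' -> V),
  (forall l, layers v 0 1 (u l)) -> independent u -> (m' <= m)%N.
have [v1 v10] := V_neq0.
have exm : exists m, `[< exists2 v, v != 0 & P v m >].
  by have [K KP] := rank_bound v1 1; exists K; apply/asboolP; exists v1.
case: (ex_minnP exm) => m /asboolP[v v0 vm] mmin; exists v, m; split=> // w w0 wv.
case: m => [|m] in mmin vm *; first by exists (fun=> 0); split=> [[]//|x _ _ []].
(* [m] is too small a bound for [w], so more than [m] independent vectors exist; [io] keeps [m.+1]
   of them. *)
have [m' [u [uw uind mm']]] : exists m' (u : 'I_m' -> V),
    [/\ forall l, layers w 0 1 (u l), independent u & (m < m')%N].
  apply: contrapT => h; suff : (m.+1 <= m)%N by rewrite ltnn.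
  apply: mmin; apply/asboolP; exists w => // m' u uw uind; rewrite leqNgt.
  by apply/negP => lt; apply: h; exists m', u.
pose io := widen_ord mm'; exists (fun l => u (io l)); split=> // x xJ sum0 l.
pose x' (l' : 'I_m') : T := \sum_(l < m.+1 | io l == l') x l.
have ioinj : injective io by move=> l1 l2 /(congr1 val) /= ?; apply: val_inj.
have x'io l1 : x' (io l1) = x l1.
  by rewrite /x' (big_pred1 l1) // => l2; rewrite (inj_eq ioinj).
rewrite -x'io; apply: uind => [l'|]; first exact: supp_in_sum.
transitivity (\sum_(l' < m') \sum_(l1 < m.+1 | io l1 == l') act (x l1) (u (io l1))).
  apply: eq_bigr => l' _; rewrite /x'.
  rewrite -!(big_filter _ (fun l1 => io l1 == l')) act_sum !big_filter.
  by apply: eq_bigr => l1 /eqP ->.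
rewrite (exchange_big_dep xpredT) //= -[RHS]sum0; apply: eq_bigr => l1 _.
by rewrite (big_pred1 (io l1)) // => l'; rewrite eq_sym.
Qed.

Lemma layersD v lo m u u' : layers v lo m u -> layers v lo m u' -> layers v lo m (u + u').
Proof.
move=> [F Fw ->] [G Gw ->]; exists (F + G); last by rewrite actD.
exact: supp_inD.
Qed.

Lemma layers_act v lo m u F : onJ F -> layers v lo m u -> layers v lo m (act F u).
Proof.
move=> FJ [G Gw ->]; exists (F * G); last by rewrite (actM q_as XM).
by rewrite -[lo]add0r; apply: window_mul => //; apply: onJ_y0.
Qed.

Lemma layers_le v (lo lo' : int) (m m' : nat) u : lo' <= lo -> lo + m%:Z <= lo' + m'%:Z ->
  layers v lo m u -> layers v lo' m' u.
Proof.
move=> h1 h2 [F Fw ->]; exists F => //; apply: supp_in_sub Fw => a.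
by rewrite /y_window; move: (a 0 y) => z; lia.
Qed.

Lemma layers_xpow v (lo j : int) m u :
  layers v lo m u -> layers v (j + lo) m (xpow X Xi y j u).
Proof.
move=> [F Fw ->]; exists (mono q0 1 (unit_exp y j) * F).
  by apply: window_mul => //; apply: window_mono.
by rewrite (actM q_as XM) act_mono scale1r monomial_unit_exp.
Qed.

Lemma layers_trans v w (lo lo' : int) m u :
  layers v lo m w -> layers w lo' 1 u -> layers v (lo' + lo) m u.
Proof.
move=> [F Fw ->] [G Gw ->]; exists (G * F); last by rewrite (actM q_as XM).
exact: window_mul.
Qed.

Lemma layers_sum v lo m (I : Type) (r : seq I) (f : I -> V) :
  (forall i, layers v lo m (f i)) -> layers v lo m (\sum_(i <- r) f i).
Proof.
move=> fl; elim/big_rec : _ => [|i u _ ul]; last exact: layersD.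
by exists 0; rewrite ?act0 //; apply: supp_in0.
Qed.

(** [w] has full rank in the module of [v], so adjoining [u] creates a dependence, and [u] must
    occur in it. *)
Lemma common_multiple v m w u :
  (forall m' (u : 'I_m' -> V), (forall l, layers v 0 1 (u l)) -> independent u -> (m' <= m)%N) ->
  (exists u : 'I_m -> V, (forall l, layers w 0 1 (u l)) /\ independent u) ->
  layers v 0 1 w -> layers v 0 1 u ->
  exists al : T, [/\ onJ al, al != 0 & layers w 0 1 (act al u)].
Proof.
move=> vmax [uu [uuw uuind]] wv uv.
pose u' (l : 'I_m.+1) := if unlift ord0 l is Some l' then uu l' else u.
have u'v l : layers v 0 1 (u' l).
  rewrite /u'; case: unliftP => [l' _|_ //].
  by rewrite -[0]addr0; apply: layers_trans (uuw l').
have nind : ~ independent u' by move=> /(vmax _ _ u'v); rewrite ltnn.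
have [x [xJ sum0 [l xl]]] : exists x : 'I_m.+1 -> T, [/\ forall l, onJ (x l),
    \sum_l act (x l) (u' l) = 0 & exists l, x l != 0].
  apply: contrapT => h; apply: nind => x xJ sum0 l; apply/eqP/negPn/negP => xl.
  by apply: h; exists x; split => //; exists l.
move: sum0; rewrite big_ord_recl /u' unlift_none.
under eq_bigr do rewrite liftK; move=> sum0.
have x0 : x ord0 != 0.
  apply: contraNneq xl => x0; move: sum0; rewrite x0 act0 add0r => /uuind h.
  have {}h := h (fun l' => xJ (lift ord0 l')).
  by case: (unliftP ord0 l) => [l' ->|->]; rewrite ?x0 // h.
exists (x ord0); split => //.
have -> : act (x ord0) u = \sum_(l' < m) act (- x (lift ord0 l')) (uu l').
  apply/eqP; rewrite -subr_eq0 -sumrN -[X in _ == X]sum0; apply/eqP; congr (_ + _).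
  by apply: eq_bigr => l' _; rewrite actN opprK.
by apply: layers_sum => l'; apply: layers_act => //; apply: supp_inN.
Qed.

Lemma independent_powers v (n : nat) : v != 0 ->
  independent (fun l : 'I_n => xpow X Xi y (l : nat)%:Z v).
Proof.
move=> v0 x xJ sum0.
pose G : T := \sum_(l < n) x l * mono q0 1 (unit_exp y (l : nat)%:Z).
have G0 : G = 0.
  apply: (tfC v0).
    apply: supp_in_sum => l _; apply: on_coordsM.
      by apply: supp_in_sub (xJ l) => a; apply: onJ_C.
    apply: supp_in_mono => i; rewrite in_setU1 negb_or mxE => /andP[/negPf -> _] //.
  rewrite act_sum -[RHS]sum0; apply: eq_bigr => l _.
  by rewrite (actM q_as XM) act_mono scale1r monomial_unit_exp.
move=> l; apply/eqP/negPn/negP => /torus0P[a xa].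
have ay : a 0 y = 0 by apply: (xJ l a xa).
have := congr1 (fun F => coef F (a + unit_exp y (l : nat)%:Z)) G0.
rewrite tcoef0 tcoef_sum (bigD1 l) //= tcoef_Mmono big1 => [|l' ll'].
  by apply/eqP; rewrite addr0 mulr1 mulf_neq0 ?cocycle_neq0.
apply/eqP; apply: contraNT ll' => /tcoefM_neq0[b [c [xb]]]; rewrite coef_mono.
have [-> _|] := eqVneq c (unit_exp y (l' : nat)%:Z); last by rewrite eqxx.
have by0 : b 0 y = 0 by apply: (xJ l' b xb).
move=> /(congr1 (fun d : E => d 0 y)); rewrite !mxE eqxx ay by0 !add0r => -[] ll.
by apply/eqP/val_inj.
Qed.

(* If a relation did not split, some [Y^j U] would meet the sum of the previous
   ones in a submodule of full rank, so all the sums of layers would have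
   bounded rank, against the freeness of the powers of [Y]. *)
Lemma direct_generator : exists2 v, v != 0 &
  forall F, act F v = 0 -> forall j, act (slice y j F) v = 0.
Proof.
have [v [m [v0 vmax vmin]]] := minimal_rank; exists v => // F1 F1v j1.
apply/eqP/negPn/negP => sl1.
pose P n := `[< exists F j, [/\ act F v = 0, act (slice y j F) v != 0 & width y F = n] >].
have exP : exists n, P n by exists (width y F1); apply/asboolP; exists F1, j1.
case: (ex_minnP exP) => n /asboolP[F [j [Fv slj wF]]] nmin.
have F0 : F != 0.
  apply: contraNneq slj => ->; suff -> : slice y j (0 : T) = 0 by rewrite act0.
  by apply: torusP => a; rewrite coef_slice tcoef0 if_same.
pose top := slice y (yhi y F) F; pose low := F - top.
have Flow : F = low + top by rewrite subrK.
(* [w0] lies in the top layer and, as [- low] applied to [v], in the [width y F] layers below it.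
   Minimality of the width keeps it nonzero. *)
set w0 := act top v.
have w0E : w0 = act (- low) v.
  by apply/eqP; rewrite actN -addr_eq0 addrC -actD -Flow Fv.
have w00 : w0 != 0.
  apply: contraNneq slj => w00.
  have [->|jh] := eqVneq j (yhi y F); first by rewrite -/top -/w0 w00.
  have slE : slice y j low = slice y j F.
    apply: torusP => a; rewrite !coef_slice tcoefB coef_slice.
    by have [aj|//] := eqVneq (a 0 y) j; rewrite aj (negPf jh) subr0.
  have lowv : act low v = 0 by move: w0E; rewrite w00 actN => /eqP; rewrite eq_sym oppr_eq0 => /eqP.
  apply: contraPT isT => slF.
  have low0 : low != 0.
    apply: contraNneq slF => l0; rewrite -slE l0.
    suff -> : slice y j (0 : T) = 0 by rewrite act0.
    by apply: torusP => a; rewrite coef_slice tcoef0 if_same.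
  have := width_window low0 (slice_rest_window F0); rewrite wF ltnNge; case/negP.
  by apply: nmin; apply/asboolP; exists low, j; rewrite slE.
pose s := width y F; pose h := yhi y F.
have topw : layers v h 1 w0 by exists top => //; apply: slice_window.
have loww : layers v (ylo y F) s w0.
  by exists (- low) => //; apply: supp_inN; apply: slice_rest_window.
pose w := xpow X Xi y (- h) w0.
have w_neq0 : w != 0 by apply: (xpow_neq0 q_as XM).
have wv : layers v 0 1 w by rewrite -(addNr h); apply: layers_xpow.
have ww0 : xpow X Xi y h w = w0 by rewrite -(xpowD XM) subrr.
(* A multiple of the part of [u] in layer [R] comes from [w0], so it lies in the layers [R - s] to
   [R - 1]; [s <= R] keeps these nonnegative. *)
have step R u : (s <= R)%N -> layers v 0 R.+1 u ->
    exists al : T, [/\ onJ al, al != 0 & layers v 0 R (act al u)].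
  move=> sR [G Gw ->].
  pose G2 := slice y R%:Z G; pose G1 := G - G2.
  have G1w : layers v 0 R (act G1 v).
    exists G1 => // a; rewrite tcoefB coef_slice.
    have [_|aR] := eqVneq (a 0 y) R%:Z; first by rewrite subrr eqxx.
    rewrite subr0 => /Gw; move: aR; rewrite /y_window; move: (a 0 y) => z; lia.
  pose u' := xpow X Xi y (- R%:Z) (act G2 v).
  have u'v : layers v 0 1 u'.
    rewrite -(addNr R%:Z); apply: layers_xpow; exists G2 => //.
    exact: slice_window.
  have G2E : act G2 v = xpow X Xi y R%:Z u' by rewrite -(xpowD XM) subrr.
  have [al [alJ al0 alw]] := common_multiple vmax (vmin w w_neq0 wv) wv u'v.
  exists (twist y R%:Z al); split; [exact: twist_supp|by rewrite twist_eq0|].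
  have -> : act G v = act G1 v + act G2 v by rewrite -actD subrK.
  rewrite (lin_mapD (lin_act XM _)); apply: layersD.
    by apply: layers_act => //; apply: twist_supp.
  rewrite G2E (act_twist q_as XM).
  have : layers w0 (R%:Z - h) 1 (xpow X Xi y R%:Z (act al u')).
    have : layers w0 (- h) 1 w by rewrite -[- h]addr0; apply: layers_xpow; exists 1;
      [apply: supp_in_mono; rewrite /y_window mxE | rewrite act1].
    move=> /layers_trans/(_ alw); rewrite add0r => /layers_xpow-/(_ R%:Z); exact.
  move=> /(layers_trans loww); apply: layers_le.
    by rewrite /h (width_eq y F0) -/s; lia.
  by rewrite /h (width_eq y F0) -/s; lia.
(* Nonzero coefficients preserve independence, so any independent family is pushed down into [s]
   layers. *)
have reduce R m' (u : 'I_m' -> V) : (s <= R)%N -> (forall l, layers v 0 R (u l)) ->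
    independent u -> exists u' : 'I_m' -> V,
    (forall l, layers v 0 s (u' l)) /\ independent u'.
  elim: R u => [|R IHR] u sR uR uind.
    by exists u; split => // l; apply: layers_le (uR l) => //; lia.
  have [Rs|Rs] := ltnP R s; first by exists u; split => // l; apply: layers_le (uR l) => //; lia.
  have /choice[al alP] : forall l, exists al : T,
      [/\ onJ al, al != 0 & layers v 0 R (act al (u l))] by move=> l; apply: step.
  apply: (IHR (fun l => act (al l) (u l))) => // [l|x xJ sum0 l].
    by have [] := alP l.
  have [alJ al0 _] := alP l.
  have : x l * al l = 0.
    apply: (uind (fun l => x l * al l)) => [l'|].
      by apply: on_coordsM => //; have [] := alP l'.
    by rewrite -[RHS]sum0; apply: eq_bigr => l' _; rewrite (actM q_as XM).
  by case/(torus_mulf_eq0 y) => // /eqP; rewrite (negPf al0).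
have [K KP] := rank_bound v s.
(* More powers of [Y] than the bound [K] allows, and at least [s] layers for [reduce] to apply. *)
pose R := maxn s K.+1.
have [|||u' [u'w u'ind]] := reduce R R (fun l => xpow X Xi y (l : nat)%:Z v).
- exact: leq_maxl.
- move=> l; exists (mono q0 1 (unit_exp y (l : nat)%:Z)).
    by apply: supp_in_mono; rewrite /y_window mxE eqxx; have := ltn_ord l; lia.
  by rewrite act_mono scale1r monomial_unit_exp.
- exact: independent_powers.
by have := KP _ _ u'w u'ind; rewrite /R leqNgt leq_maxr.
Qed.

End DirectSum.

(** * Skew Laurent extensions *)

Section Restriction.
Variables (k : fieldType) (V : lmodType k) (W : set V) (sW : subspace W).

Definition to_submod x (Wx : W x) : submod sW :=
  exist (fun x => x \in submod_pred sW) x (asboolT Wx).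

Lemma submodP (u : submod sW) : W (val u).
Proof. exact: asboolW (valP u). Qed.

Variables (f : V -> V) (fW : forall x, W x -> W (f x)).

Definition submod_map (u : submod sW) : submod sW := to_submod (fW (submodP u)).

End Restriction.

(** * The skew extension as a quantum torus in one more variable *)

Section SkewTorus.
Variables (k : fieldType) (n : nat) (q : 'I_n -> 'I_n -> k) (p : 'I_n -> k).
Hypotheses (q_as : mult_antisym q) (p0 : forall i, p i != 0).

(** [ord0] stands for [Y] and [lift ord0 i] for [X_i]; the rule [Y X_i = p_i X_i Y] gives the entry
    [p i]. *)
Definition skew_q (i j : 'I_n.+1) : k :=
  match unlift ord0 i, unlift ord0 j with
  | Some i', Some j' => q i' j'
  | None, Some j' => p j'
  | Some i', None => (p i')^-1
  | None, None => 1
  end.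

Lemma skew_q_as : mult_antisym skew_q.
Proof.
have [qn0 qii qV] := q_as; split=> [i j|i|i j]; rewrite /skew_q.
- by case: unliftP => [i' _|_]; case: unliftP => [j' _|_]; rewrite ?invr_eq0 ?oner_neq0.
- by case: unliftP => [i' _|_].
by case: unliftP => [i' _|_]; case: unliftP => [j' _|_]; rewrite ?invr1 ?invrK.
Qed.

Lemma skew_q_neq0 i j : skew_q i j != 0.
Proof. by case: skew_q_as. Qed.

Section Module.
Variables (V : lmodType k) (X Xi : 'I_n -> V -> V) (Y Yi : V -> V).
Hypothesis XY : skew_laurent_module q p X Xi Y Yi.

Definition skew_X (i : 'I_n.+1) : V -> V := if unlift ord0 i is Some i' then X i' else Y.
Definition skew_Xi (i : 'I_n.+1) : V -> V := if unlift ord0 i is Some i' then Xi i' else Yi.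

Lemma skew_torus_module : qtorus_module skew_q skew_X skew_Xi.
Proof.
have [[linX XK XX] linY YK YX] := XY; rewrite /skew_q /skew_X /skew_Xi.
split=> [i|i|i j v]; case: unliftP => [i' _|_] //.
  case: unliftP => [j' _|_]; first exact: XX.
  by rewrite YX scalerA mulVf // scale1r.
by case: unliftP => [j' _|_]; rewrite ?scale1r.
Qed.

End Module.

Definition lift_exp (a : 'rV[int]_n) : 'rV[int]_n.+1 :=
  \row_i (if unlift ord0 i is Some j then a 0 j else 0).

Lemma lift_exp0 a : lift_exp a 0 ord0 = 0.
Proof. by rewrite mxE unlift_none. Qed.

Lemma lift_expS a j : lift_exp a 0 (lift ord0 j) = a 0 j.
Proof. by rewrite mxE liftK. Qed.

Lemma lift_exp_inj : injective lift_exp.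
Proof. by move=> a b ab; apply/rowP => j; rewrite -!lift_expS ab. Qed.

End SkewTorus.

Lemma List_In_map (S : eqType) (T : Type) (f : S -> T) (s : seq S) (g : T) :
  List.In g [seq f i | i <- s] <-> exists2 i, i \in s & g = f i.
Proof.
elim: s => [|i s IHs] /=; first by split=> // -[].
split=> [[<-|/IHs[j js gj]]|[j]].
- by exists i; rewrite ?inE ?eqxx.
- by exists j; rewrite // inE js orbT.
rewrite inE => /orP[/eqP->|js] gj; first by left.
by right; apply/IHs; exists j.
Qed.

Lemma qtorus_gensP (k : fieldType) n (V : lmodType k) (X Xi : 'I_n -> V -> V) g :
  List.In g (qtorus_gens X Xi) <-> exists i, g = X i \/ g = Xi i.
Proof.
rewrite /qtorus_gens List.in_app_iff !List_In_map.
split=> [[[i _ ->]|[i _ ->]]|[i [->|->]]]; try by exists i; [left|right].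
- by exists i; left.
- by exists i; right.
- by left; exists i; rewrite ?mem_enum.
- by right; exists i; rewrite ?mem_enum.
Qed.

Lemma skew_gensP (k : fieldType) n (V : lmodType k) (X Xi : 'I_n -> V -> V) (Y Yi : V -> V) g :
  List.In g (qtorus_gens X Xi ++ [:: Y; Yi]) <->
  exists i, g = skew_X X Y i \/ g = skew_Xi Xi Yi i.
Proof.
rewrite List.in_app_iff qtorus_gensP /skew_X /skew_Xi /=; split.
  case=> [[i gi]|gY]; first by exists (lift ord0 i); rewrite liftK.
  exists ord0; rewrite unlift_none.
  by case: gY => [->|[->|[]]]; [left|right].
move=> [i]; case: unliftP => [j _ gj|_]; first by left; exists j.
by case=> ->; right; [left|right; left].
Qed.

(** * Ranks of the groups of scalars *)

Section Rank.
Variables (k : fieldType) (n : nat) (p : 'I_n -> k).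
Hypothesis p0 : forall i, p i != 0.

Lemma group_p_subgroup : subgroup (group_p p).
Proof.
split=> [|x z [a ->] [b ->]|x [a ->]].
- by exists (fun=> 0); rewrite big1 // => i _; rewrite expr0z.
- exists (fun i => a i + b i); rewrite -big_split; apply: eq_bigr => i _.
  by rewrite expfzDr.
exists (fun i => - a i); rewrite -prodfV; apply: eq_bigr => i _.
by rewrite invr_expz.
Qed.

(** The group [H_J], described by exponent vectors so that ranks reduce to integer linear
    algebra. *)
Definition subgroup_on (J : {set 'I_n}) : set k :=
  [set x | exists2 b : 'I_n -> int, (forall j, j \notin J -> b j = 0) &
     x = \prod_(j < n) p j ^ b j].

Lemma subgroup_onP J : subgroup (subgroup_on J).
Proof.
split=> [|x z [a aJ ->] [b bJ ->]|x [a aJ ->]].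
- by exists (fun=> 0) => //; rewrite big1 // => i _; rewrite expr0z.
- exists (fun i => a i + b i); first by move=> j jJ; rewrite aJ // bJ.
  by rewrite -big_split; apply: eq_bigr => i _; rewrite expfzDr.
exists (fun i => - a i); first by move=> j jJ; rewrite aJ // oppr0.
by rewrite -prodfV; apply: eq_bigr => i _; rewrite invr_expz.
Qed.

Lemma subgroup_on_gen (J : {set 'I_n}) j : j \in J -> subgroup_on J (p j).
Proof.
move=> jJ; exists (fun i => (i == j)%:Z); first by move=> i iJ; have /negPf -> : i != j by apply: contraNneq iJ => ->.
rewrite (bigD1 j) //= eqxx expr1z big1 ?mulr1 // => i /negPf ->.
by rewrite expr0z.
Qed.

(** A rational solution exists by counting; multiplication by all its denominators makes it
    integral. *)
Lemma integer_relation (r : nat) (J : {set 'I_n}) (b : 'I_r -> 'I_n -> int) :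
  (#|J| < r)%N -> exists z : 'I_r -> int,
    (exists l, z l != 0) /\ forall j, j \in J -> \sum_l z l * b l j = 0.
Proof.
move=> ltJ.
have [|c [[l0 cl0] cb]] := @underdetermined_system rat 'I_r {j | j \in J}
  (fun l j => (b l (val j))%:~R); first by rewrite card_sig card_ord; apply: leq_ltn_trans ltJ; apply: eq_leq; apply: eq_card.
pose D l := \prod_(l' < r | l' != l) denq (c l').
have zE l : (numq (c l) * D l)%:~R = c l * (\prod_(l' < r) denq (c l'))%:~R :> rat.
  by rewrite (bigD1 l) //= !intrM numqE mulrA.
exists (fun l => numq (c l) * D l); split.
  exists l0; rewrite mulf_neq0 ?numq_eq0 //; apply/prodf_neq0 => l _; exact: denq_neq0.
move=> j jJ; apply: (@intr_inj rat); rewrite rmorph_sum /=.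
under eq_bigr do rewrite intrM zE mulrAC.
by rewrite -mulr_suml (cb (exist _ j jJ)) mul0r.
Qed.

(** The elements with a nontrivial power in [H_J] are closed under products and powers and contain
    every [p_i]. Suitable powers of an independent family thus become integer vectors indexed by
    [J], and more than [#|J|] of these are dependent. *)
Lemma rank_le (J : {set 'I_n}) r : tf_rank (group_p p) r ->
  (forall i, exists2 M : int, M != 0 & subgroup_on J (p i ^ M)) -> (r <= #|J|)%N.
Proof.
move=> [[h [hH hind]] _] pJ; have [J1 JM JV] := subgroup_onP J.
pose S : set k := [set x | exists2 M : int, M != 0 & subgroup_on J (x ^ M)].
have S1 : S 1 by exists 1; rewrite ?expr1z.
have SM x z : S x -> S z -> S (x * z).
  move=> [M M0 xM] [M' M'0 zM']; exists (M * M'); first by rewrite mulf_neq0.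
  rewrite expfzMl; apply: JM; first by rewrite -exprz_exp; apply: subgroupX (subgroup_onP J) xM.
  by rewrite mulrC -exprz_exp; apply: subgroupX (subgroup_onP J) zM'.
have SX x (m : int) : S x -> S (x ^ m).
  move=> [M M0 xM]; exists M => //.
  by rewrite exprz_exp mulrC -exprz_exp; apply: subgroupX (subgroup_onP J) xM.
have HS x : group_p p x -> S x.
  move=> [a ->]; elim/big_rec : _ => // i x' _ Sx'; apply: SM => //.
  by apply: SX; apply: pJ.
have /choice[M MP] : forall l, exists M : int, M != 0 /\ subgroup_on J (h l ^ M).
  by move=> l; have [M M0 hM] := HS _ (hH l); exists M.
have /choice[b bP] : forall l, exists b : 'I_n -> int, (forall j, j \notin J -> b j = 0) /\
    h l ^ M l = \prod_(j < n) p j ^ b j.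
  by move=> l; have [_ [b bJ hb]] := MP l; exists b.
rewrite leqNgt; apply/negP => /(integer_relation b)[z [[l zl] zb]].
have : M l * z l = 0.
  apply: (hind (fun l => M l * z l)).
  transitivity (\prod_(l' < r) \prod_(j < n) p j ^ (z l' * b l' j)).
    apply: eq_bigr => l' _; have [_ hb] := bP l'; rewrite -exprz_exp hb.
    rewrite (big_morph (fun x => x ^ z l') (fun x x' => expfzMl x x' _) (exp1rz k (z l'))).
    by apply: eq_bigr => j _; rewrite exprz_exp mulrC.
  rewrite exchange_big big1 //= => j _.
  have -> : \prod_(l' < r) p j ^ (z l' * b l' j) = p j ^ (\sum_(l' < r) z l' * b l' j).
    by elim/big_rec2 : _ => [|l' x x' _ ->]; rewrite ?expr0z // expfzDr.
  have [jJ|jJ] := boolP (j \in J); first by rewrite zb.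
  by rewrite big1 // => l' _; have [-> //] := bP l'; rewrite mulr0.
by have [M0 _] := MP l; move/eqP; rewrite mulf_eq0 (negPf M0) (negPf zl).
Qed.

End Rank.

(** * The torsion case over the skew extension *)

Section TorsionCaseGK.
Variables (k : fieldType) (n : nat) (q : 'I_n -> 'I_n -> k) (p : 'I_n -> k).
Hypotheses (q_as : mult_antisym q) (p0 : forall i, p i != 0).

Let qn0 i j : q i j != 0. Proof. by case: q_as. Qed.
Local Notation qs0 := (skew_q_neq0 q_as p0).

Lemma group_q_subgroup : subgroup (group_q q).
Proof.
split=> [|x z [a ->] [b ->]|x [a ->]].
- by exists (fun _ _ => 0); rewrite big1 // => i _; rewrite big1.
- exists (fun i j => a i j + b i j); rewrite -big_split; apply: eq_bigr => i _.
  by rewrite -big_split; apply: eq_bigr => j _; rewrite expfzDr.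
exists (fun i j => - a i j); rewrite -prodfV; apply: eq_bigr => i _.
by rewrite -prodfV; apply: eq_bigr => j _; rewrite invr_expz.
Qed.

Lemma group_q_gen i j : group_q q (q i j).
Proof.
exists (fun i' j' => ((i' == i) && (j' == j))%:Z).
rewrite (bigD1 i) //= [X in _ * X]big1 ?mulr1 => [|i' /negPf ->]; last first.
  by rewrite big1 // => j' _; rewrite expr0z.
rewrite (bigD1 j) //= !eqxx expr1z big1 ?mulr1 // => j' /negPf ->.
by rewrite expr0z.
Qed.

Lemma subgroup_prod2 (G H : set k) : subgroup G -> subgroup H ->
  subgroup [set x | exists g h, [/\ G g, H h & x = g * h]].
Proof.
move=> [G1 GM GV] [H1 HM HV]; split.
- by exists 1, 1; rewrite mulr1.
- move=> _ _ [g [h [Gg Hh ->]]] [g' [h' [Gg' Hh' ->]]].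
  by exists (g * g'), (h * h'); rewrite mulrACA; split; [apply: GM|apply: HM|].
move=> _ [g [h [Gg Hh ->]]]; exists g^-1, h^-1; rewrite invfM.
by split; [apply: GV|apply: HV|].
Qed.

Hypothesis trivI : forall x, group_q q x -> group_p p x -> x = 1.
Variables (V : lmodType k) (X Xi : 'I_n -> V -> V) (Y Yi : V -> V).
Hypothesis XY : skew_laurent_module q p X Xi Y Yi.
Local Notation gens := (qtorus_gens X Xi ++ [:: Y; Yi]).
Hypothesis simV : simple_module gens.

Local Notation qs := (skew_q q p).
Local Notation Xs := (skew_X X Y).
Local Notation Xis := (skew_Xi Xi Yi).
Local Notation y := (ord0 : 'I_n.+1).

Let qs_as : mult_antisym qs. Proof. exact: skew_q_as. Qed.
Let XsM : qtorus_module qs Xs Xis. Proof. exact: skew_torus_module XY. Qed.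
Let gensP g : List.In g gens <-> exists i, g = Xs i \/ g = Xis i.
Proof. exact: skew_gensP. Qed.

Variable J : {set 'I_n.+1}.
Hypotheses (yJ : y \notin J) (tfJ : torsion_free qs0 Xs Xis J).
Hypothesis maxJ : forall (J' : {set 'I_n.+1}) v, y \notin J' -> (#|J| < #|J'|)%N ->
  ~ free_monomials Xs Xis J' v.
Local Notation C := (y |: J)%SET.
Local Notation onC := (supp_in (on_coords C)).

Lemma GKdim_torsion_case r : tf_rank (group_p p) r ->
  (exists v F, [/\ v != 0, onC F, F != 0 & act (q0 := qs0) Xs Xis F v = 0]) ->
  exists m : nat, (r <= m <= n)%N /\ GKdim gens = (m%:R)%:E.
Proof.
move=> rk torsC.
pose P w := `[< exists v F, [/\ [/\ v != 0, onC F, F != 0 & act (q0 := qs0) Xs Xis F v = 0]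
  & width y F = w] >].
have exP : exists w, P w.
  by have [v [F vF]] := torsC; exists (width y F); apply/asboolP; exists v, F.
case: (ex_minnP exP) => w /asboolP[v [F [[v0 FC F0 Fv] wF]]] wmin.
have minF u G : u != 0 -> onC G -> G != 0 -> act (q0 := qs0) Xs Xis G u = 0 ->
    (width y F <= width y G)%N.
  by move=> u0 GC G0 Gu; rewrite wF; apply: wmin; apply/asboolP; exists u, G.
pose Jn : {set 'I_n} := [set j | lift ord0 j \in J]%SET.
have cJn : (#|Jn| <= #|J|)%N.
  rewrite -(card_imset _ (@lift_inj _ ord0)); apply/subset_leq_card.
  by apply/fintype.subsetP => x /imsetP[j]; rewrite inE => jJ ->.
have power i : exists2 M : int, M != 0 & subgroup_on p Jn (p i ^ M).
  have sH := subgroup_onP p0 Jn; have sG := group_q_subgroup.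
  have [iJ|iJ] := boolP (lift ord0 i \in J).
    by exists 1 => //; rewrite expr1z; apply: subgroup_on_gen; rewrite inE.
  (* [G . H_J] contains every commutation scalar except possibly those between [Y] and an [X_i]
     outside [J]. *)
  pose Gam := [set x | exists g h, [/\ group_q q g, subgroup_on p Jn h & x = g * h]].
  have sGam : subgroup Gam by apply: subgroup_prod2.
  have [G1 GM GV] := sG; have [H1 HM HV] := sH.
  have Gamq a b : Gam (q a b) by exists (q a b), 1; rewrite mulr1; split => //; apply: group_q_gen.
  have Gamp a : lift ord0 a \in J -> Gam (p a).
    move=> aJ; exists 1, (p a); rewrite mul1r; split => //.
    by apply: subgroup_on_gen; rewrite inE.
  have Gq a b : a \in C -> b \in C -> Gam (qs a b).
    have [Gam1 _ GamV] := sGam; rewrite /skew_q.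
    have liftC c : lift ord0 c \in C -> lift ord0 c \in J.
      by rewrite in_setU1 eq_sym (negPf (neq_lift _ _)).
    case: (unliftP ord0 a) => [a' ->|->]; case: (unliftP ord0 b) => [b' ->|->] aC bC.
    - exact: Gamq.
    - by apply: GamV; apply: Gamp; apply: liftC.
    - by apply: Gamp; apply: liftC.
    - exact: Gam1.
  have Gi b : b \in J -> Gam (qs (lift ord0 i) b).
    rewrite /skew_q liftK; case: (unliftP ord0 b) => [b' ->|->] //.
    by rewrite (negPf yJ).
  have iC : lift ord0 i \notin C.
    by rewrite in_setU1 negb_or iJ eq_sym neq_lift.
  have nfree : ~ free_monomials Xs Xis (lift ord0 i |: J)%SET v.
    apply: maxJ; last by rewrite cardsU1 iJ.
    by rewrite in_setU1 negb_or yJ neq_lift.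
  have [M M0] := commutation_power qs_as XsM yJ tfJ sGam Gq iC Gi v0 FC F0 Fv minF nfree.
  rewrite /skew_q liftK unlift_none => -[g [h [Gg Hh pE]]].
  exists M => //; have pp : group_p p (p i).
    exists (fun j => (j == i)%:Z); rewrite (bigD1 i) //= eqxx expr1z big1 ?mulr1 //.
    by move=> j /negPf ->; rewrite expr0z.
  have hp : group_p p h by case: Hh => b _ ->; exists b.
  have [_ pM pV] := group_p_subgroup p0.
  have h0 : h != 0.
    case: (Hh) => b _ ->; apply/prodf_neq0 => j _; exact: expfz_neq0.
  (* The relation reads [p_i ^ (- M) = g * h], so [g] lies in both groups. *)
  have g1 : g = 1.
    apply: trivI => //; have -> : g = (p i)^-1 ^ M * h^-1 by rewrite pE mulfK.
    by apply: pM; [apply: subgroupX (group_p_subgroup p0) (pV _ pp)|apply: pV].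
  move: pE; rewrite g1 mul1r exprz_inv -invr_expz => /(congr1 GRing.inv).
  by rewrite invrK => ->; apply: HV.
have rJ : (r <= #|J|)%N := leq_trans (rank_le p0 rk power) cJn.
have fJ := free_of_torsion_free tfJ v0.
(* A largest free set at [v] may involve [Y] and be larger than [J], hence the inequality
   [#|J| <= #|I|]. *)
pose Q I := `[< free_monomials Xs Xis I v >].
have QJ : Q J by apply/asboolP.
case: (@arg_maxnP _ J Q (fun I => #|I|) QJ) => I /asboolP fI Imax.
exists #|I|; split; last first.
  apply: (GKdim_free_monomials qs_as XsM gensP (v := v)) => //.
    exact: (simple_cyclic qs_as XsM gensP).
  by move=> J' fJ'; apply: Imax; apply/asboolP.
rewrite (leq_trans rJ (Imax J QJ)) /= -ltnS -[X in (_ < X)%N](card_ord n.+1).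
(* If all [n.+1] indices were free at [v], the annihilator [F] would vanish. *)
rewrite ltn_neqAle max_card andbT; apply: contraNneq F0 => cI.
have IT i : i \in I.
  suff -> : I = [set: 'I_n.+1]%SET by rewrite finset.in_setT.
  by apply/eqP; rewrite eqEcard finset.subsetT cardsT cI leqnn.
move/(free_monomialsP qs0): fI => /(_ F) -> // a _ i; rewrite IT //.
Qed.

End TorsionCaseGK.

(** * The direct sum case over the skew extension *)

Section DirectCaseGK.
Variables (k : fieldType) (n : nat) (q : 'I_n -> 'I_n -> k) (p : 'I_n -> k).
Hypotheses (q_as : mult_antisym q) (p0 : forall i, p i != 0).

Let qn0 i j : q i j != 0. Proof. by case: q_as. Qed.
Local Notation qs0 := (skew_q_neq0 q_as p0).

Variables (V : lmodType k) (X Xi : 'I_n -> V -> V) (Y Yi : V -> V).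
Hypothesis XY : skew_laurent_module q p X Xi Y Yi.
Local Notation gens := (qtorus_gens X Xi ++ [:: Y; Yi]).
Hypothesis simV : simple_module gens.

Local Notation qs := (skew_q q p).
Local Notation Xs := (skew_X X Y).
Local Notation Xis := (skew_Xi Xi Yi).
Local Notation y := (ord0 : 'I_n.+1).
Local Notation E := 'rV[int]_n.+1.
Local Notation T := (torus qs0).
Local Notation act := (act (q0 := qs0) Xs Xis).

Let qs_as : mult_antisym qs. Proof. exact: skew_q_as. Qed.
Let XsM : qtorus_module qs Xs Xis. Proof. exact: skew_torus_module XY. Qed.
Let gensP g : List.In g gens <-> exists i, g = Xs i \/ g = Xis i.
Proof. exact: skew_gensP. Qed.

Variable v : V.
Hypotheses (v0 : v != 0)
  (direct : forall F : T, act F v = 0 -> forall j, act (slice y j F) v = 0).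

(** The layer [U], reached from [v] without using [Y]. *)
Let W : set V := [set u | exists2 F : T, (forall a, coef F a != 0 -> a 0 y = 0) & u = act F v].

Lemma layer_subspace : subspace W.
Proof.
split; first by exists 0; rewrite ?act0 // => a; rewrite tcoef0 eqxx.
move=> c _ _ [F FW ->] [G GW ->]; exists (c *: F + G); last by rewrite actD actZ.
exact: (supp_inD (supp_inZ FW) GW).
Qed.

Lemma layer_xpow i m u : W u -> W (xpow Xs Xis (lift ord0 i) m u).
Proof.
move=> [F FW ->]; exists (mono qs0 1 (unit_exp (lift ord0 i) m) * F); last first.
  by rewrite (actM qs_as XsM) act_mono scale1r monomial_unit_exp.
apply: supp_inM (_ : supp_in (fun a : E => a 0 y = 0) _) FW => [a b|].
  by rewrite mxE => -> ->; rewrite addr0.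
by apply: supp_in_mono; rewrite mxE.
Qed.

Lemma layer_X i u : W u -> W (X i u).
Proof. by move=> /(layer_xpow i 1); rewrite /= /skew_X liftK. Qed.

Lemma layer_Xi i u : W u -> W (Xi i u).
Proof. by move=> /(layer_xpow i (-1)); rewrite /= /skew_Xi liftK. Qed.

Local Notation U := (submod layer_subspace).
Let XU i : U -> U := submod_map (@layer_X i).
Let XiU i : U -> U := submod_map (@layer_Xi i).

Lemma layer_module : qtorus_module q XU XiU.
Proof.
have [[linX XK XX] _ _ _] := XY.
split=> [i a u w|i|i j u].
- by apply: val_inj; rewrite /= (linX i).
- by split=> u; apply: val_inj => /=; have [XKi XiK] := XK i; rewrite ?XKi ?XiK.
by apply: val_inj; rewrite /= XX.
Qed.

Lemma layer_v : W v.
Proof.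
exists 1; last by rewrite act1.
by move=> a; rewrite torus_oneE coef_mono; have [-> _|_] := eqVneq a 0; rewrite ?mxE ?eqxx.
Qed.

Let vU : U := to_submod layer_subspace layer_v.

(** The enumeration of ['I_n.+1] starts with [ord0], whose exponent is 0, so ordered monomials on
    [U] are ordered monomials of the larger torus. *)
Lemma val_monomial a (u : U) :
  val (monomial XU XiU a u) = monomial Xs Xis (lift_exp a) (val u).
Proof.
have iterE (f : U -> U) (g : V -> V) : (forall u, val (f u) = g (val u)) ->
    forall m u, val (iter m f u) = iter m g (val u).
  by move=> fg; elim=> [//|m IHm] w /=; rewrite fg IHm.
have xpowE i m w : val (xpow XU XiU i m w) = xpow Xs Xis (lift ord0 i) m (val w).
  case: m => m; apply: iterE => z; first by rewrite /skew_X liftK.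
  by rewrite /skew_Xi liftK.
rewrite /monomial enum_ordSl /= lift_exp0 /=.
by elim: (enum 'I_n) => [//|i s IHs] /=; rewrite lift_expS -IHs; apply: xpowE.
Qed.

Lemma val_sumU (I : finType) (f : I -> U) : val (\sum_i f i) = \sum_i val (f i).
Proof. exact: (raddf_sum (val : U -> V)). Qed.

Lemma free_lift (J : {set 'I_n.+1}) (Jn : {set 'I_n}) :
  (forall j, lift ord0 j \in J -> j \in Jn) -> y \notin J ->
  free_monomials XU XiU Jn vU -> free_monomials Xs Xis J v.
Proof.
move=> JJn yJ fU S e einj eJ c sum0.
pose e' t : 'rV[int]_n := \row_j e t 0 (lift ord0 j).
have eE t : lift_exp (e' t) = e t.
  apply/rowP => i; rewrite mxE; case: unliftP => [j ->|->]; first by rewrite mxE.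
  by rewrite eJ.
apply: (fU S e') => [t t' ee|t j jJ|].
- by apply: einj; rewrite -!eE ee.
- by rewrite mxE eJ //; apply: contra jJ; apply: JJn.
apply: val_inj; rewrite val_sumU -[RHS]sum0; apply: eq_bigr => t _.
by rewrite -eE -(val_monomial (e' t) vU).
Qed.

Lemma free_unlift (J : {set 'I_n.+1}) (Jn : {set 'I_n}) :
  (forall j, j \in Jn -> lift ord0 j \in J) ->
  free_monomials Xs Xis J v -> free_monomials XU XiU Jn vU.
Proof.
move=> JnJ fJ S e einj eJ c sum0.
apply: (fJ S (fun t => lift_exp (e t))) => [t t' /lift_exp_inj /einj //|t i iJ|].
  rewrite mxE; case: unliftP iJ => [j ->|//] jJ; apply: eJ.
  by apply: contra jJ; apply: JnJ.
have := congr1 val sum0; rewrite val_sumU => sum0'; rewrite -[RHS]sum0'.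
by apply: eq_bigr => t _; rewrite -(val_monomial (e t) vU).
Qed.

(** If [F] kills [v], so does each slice; multiplied by a power of [Y], a slice becomes an element
    over [J], where [v] is free. *)
Lemma free_add_y (J : {set 'I_n.+1}) : y \notin J ->
  free_monomials Xs Xis J v -> free_monomials Xs Xis (y |: J)%SET v.
Proof.
move=> yJ /(free_monomialsP qs0) fJ; apply/(free_monomialsP qs0) => F FC Fv.
have sl0 j : slice y j F = 0.
  pose s : T := mono qs0 1 (unit_exp y (- j)).
  have s0 : s != 0 by apply: mono_neq0; apply: oner_neq0.
  have : s * slice y j F = 0.
    apply: fJ; last first.
      by rewrite (actM qs_as XsM) (direct Fv) (lin_map0 (lin_act XsM _)).
    apply: (onJ_window yJ).
      apply: on_coordsM; last exact: slice_supp.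
      apply: supp_in_mono => i; rewrite in_setU1 negb_or mxE => /andP[/negPf -> _] //.
    have sw : supp_in (y_window y (- j) 1) s by apply: window_mono.
    by have := window_mul sw (@slice_window _ _ _ _ y j F); rewrite addNr; apply.
  by case/(torus_mulf_eq0 y) => // /eqP; rewrite (negPf s0).
apply: torusP => a; have := congr1 (fun F => coef F a) (sl0 (a 0 y)).
by rewrite coef_slice eqxx.
Qed.

Lemma act_layer_stable (S : set U) : subspace S ->
  (forall g u, List.In g (qtorus_gens XU XiU) -> S u -> S (g u)) ->
  forall (F : T) (u : U), (forall a, coef F a != 0 -> a 0 y = 0) -> S u ->
  exists2 u', S u' & val u' = act F (val u).
Proof.
move=> sS Sg F u FW Su.
have SX m i w : S w -> S (xpow XU XiU i m w).
  move=> Sw; have Sit g : List.In g (qtorus_gens XU XiU) -> forall l, S (iter l g w).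
    by move=> gg; elim=> [//|l IHl] /=; apply: Sg.
  by case: m => l; apply: Sit; apply/qtorus_gensP; exists i; [left|right].
have Smon a : S (monomial XU XiU a u).
  by rewrite /monomial; elim: (enum _) => [//|i s IHs] /=; apply: SX.
pose drop (a : E) : 'rV[int]_n := \row_j a 0 (lift ord0 j).
exists (\sum_(a <- supp F) coef F a *: monomial XU XiU (drop a) u).
  by apply: subspace_sum => // a _; apply: subspaceZ.
rewrite (raddf_sum (val : U -> V)) actE big_seq [RHS]big_seq; apply: eq_bigr => a.
rewrite mem_supp => /FW ay; rewrite -[LHS]/(coef F a *: val (monomial XU XiU (drop a) u)).
rewrite val_monomial; congr (_ *: monomial _ _ _ _); apply/rowP => i.
by rewrite mxE; case: unliftP => [j ->|->]; rewrite ?mxE.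
Qed.

(** In [V], any [u] of [U] is [K] applied to a nonzero [u0] of the submodule [S]. Directness allows
    only the part of [K] of degree 0 in [Y] to be kept, and that part preserves [S]. *)
Lemma layer_simple : simple_module (qtorus_gens XU XiU).
Proof.
split; first by exists vU; apply: contraNneq v0 => /(congr1 val) /= ->.
move=> S sS Sg; have [Sz|[u0 [Su0 u00]]] : (forall u, S u -> u = 0) \/ exists u, S u /\ u != 0.
- have [ex|nex] := pselect (exists u, S u /\ u != 0); [by right | left => u Su].
  by apply/eqP/negPn/negP => u0; apply: nex; exists u.
- left; apply/seteqP; split=> u; first exact: Sz.
  by move=> ->; apply: subspace0.
right; apply/seteqP; split=> // u _.
have [H HW u0E] := submodP u0; have [P PW uE] := submodP u.
have w0 : val u0 != 0 by apply: contraNneq u00 => h; apply/eqP/val_inj.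
have [R uR] := simple_cyclic qs_as XsM gensP simV w0 (val u).
have [K _ uK] := lspan_act qs0 uR.
have KHP : act (K * H - P) v = 0.
  by rewrite actB (actM qs_as XsM) -u0E -uK uE subrr.
(* [H] and [P] do not involve [Y], so taking the slice of degree 0 affects only [K]. *)
have sl : slice y 0 (K * H - P) = slice y 0 K * H - P.
  have sub0 : slice y 0 (K * H) = slice y 0 K * H.
    have KE : K = slice y 0 K + (K - slice y 0 K) by rewrite subrKC.
    have in0 a : coef (slice y 0 K * H) a != 0 -> a 0 y = 0.
      move=> /tcoefM_neq0[b [c [+ /HW cy ->]]]; rewrite coef_slice mxE cy.
      by have [-> _|_] := eqVneq (b 0 y) 0; rewrite ?addr0 ?eqxx.
    have out0 a : coef ((K - slice y 0 K) * H) a != 0 -> a 0 y != 0.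
      move=> /tcoefM_neq0[b [c [+ /HW cy ->]]]; rewrite tcoefB coef_slice mxE cy addr0.
      by have [_|//] := eqVneq (b 0 y) 0; rewrite subrr eqxx.
    apply: torusP => a; rewrite coef_slice {1}KE mulrDl tcoefD.
    have [ay|ay] := eqVneq (a 0 y) 0.
      suff -> : coef ((K - slice y 0 K) * H) a = 0 by rewrite addr0.
      by apply/eqP; apply: contraPT isT => /out0; rewrite ay eqxx.
    by apply/esym/eqP; apply: contraNT ay => /in0 ->.
  apply: torusP => a; rewrite coef_slice tcoefB [RHS]tcoefB -sub0 coef_slice.
  case: ifP => // /eqP ay; rewrite sub0r; apply/esym/eqP; rewrite oppr_eq0.
  by apply: contraPT isT => /PW.
have := direct KHP 0; rewrite sl actB (actM qs_as XsM) -u0E -uE => /eqP.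
rewrite subr_eq0 => /eqP uK0.
have slW a : coef (slice y 0 K) a != 0 -> a 0 y = 0.
  by rewrite coef_slice; have [//|_] := eqVneq (a 0 y) 0; rewrite eqxx.
have [u' Su' u'E] := act_layer_stable sS Sg slW Su0.
by have <- : u' = u by apply: val_inj; rewrite u'E.
Qed.

(** [Y] together with a largest free set for [U] is a largest free set for [V]. *)
Lemma GKdim_direct_case :
  exists u : \bar GKR, GK_values_qtorus q u /\ GKdim gens = (u + 1)%E.
Proof.
have vU0 : vU != 0 by apply: contraNneq v0 => /(congr1 val) /= ->.
pose Q I := `[< free_monomials XU XiU I vU >].
have Q0 : Q finset.set0 by apply/asboolP/(free_monomials_set0 qn0).
case: (@arg_maxnP _ finset.set0 Q (fun I => #|I|) Q0) => I /asboolP fI Imax.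
exists (#|I|%:R)%:E; split.
  exists U, XU, XiU; split; [exact: layer_module|exact: layer_simple|].
  apply: (GKdim_free_monomials q_as layer_module (@qtorus_gensP _ _ _ _ _) (v := vU)) => //.
    apply: (simple_cyclic q_as layer_module (@qtorus_gensP _ _ _ _ _)) => //.
    exact: layer_simple.
  by move=> J' fJ'; apply: Imax; apply/asboolP.
pose J0 : {set 'I_n.+1} := lift ord0 @: I.
have yJ0 : y \notin J0.
  by apply/negP => /imsetP[j _ /eqP]; rewrite (negPf (neq_lift _ _)).
have cJ0 : #|J0| = #|I| by apply: card_imset; apply: lift_inj.
rewrite (_ : (#|I|%:R)%:E + 1 = (#|(y |: J0)%SET|%:R)%:E)%E; last first.
  by rewrite cardsU1 yJ0 cJ0 -EFinD natrD addrC.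
apply: (GKdim_free_monomials qs_as XsM gensP (v := v)).
- exact: (simple_cyclic qs_as XsM gensP).
- apply: free_add_y => //; apply: free_lift fI => // j.
  by rewrite (mem_imset _ _ (@lift_inj _ _)).
move=> J' fJ'; pose Jn : {set 'I_n} := [set j | lift ord0 j \in J']%SET.
have cJn : (#|Jn| <= #|I|)%N.
  apply: Imax; apply/asboolP; apply: free_unlift fJ' => j; by rewrite inE.
(* [J'] is contained in [y] together with its indices among the [X_i], and these are free for
   [U]. *)
rewrite cardsU1 yJ0 cJ0; apply: leq_trans (_ : #|y |: (lift ord0 @: Jn)|%SET <= _)%N.
  apply/subset_leq_card/fintype.subsetP => i iJ'; rewrite in_setU1.
  case: (unliftP ord0 i) => [j ij|->]; last by rewrite eqxx.
  by rewrite ij (mem_imset _ _ (@lift_inj _ _)) inE -ij iJ' orbT.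
apply: leq_trans (leq_card_setU _ _) _; rewrite cards1 leq_add2l.
by rewrite card_imset //; apply: lift_inj.
Qed.

End DirectCaseGK.

Theorem theorem2 (k : fieldType) (n : nat) (q : 'I_n -> 'I_n -> k) (p : 'I_n -> k) :
  mult_antisym q -> (forall i, p i != 0) ->
  (forall x, group_q q x -> group_p p x -> x = 1) ->
  forall r : nat, tf_rank (group_p p) r ->
  forall d : \bar GKR, GK_values_skew q p d ->
    (exists m : nat, (r <= m <= n)%N /\ d = (m%:R)%:E) \/
    (exists u : \bar GKR, GK_values_qtorus q u /\ d = (u + 1)%E).
Proof.
move=> q_as p0 trivI r rk d [V [X [Xi [Y [Yi [XY simV <-]]]]]].
have qs_as := skew_q_as q_as p0.
have XsM := skew_torus_module p0 XY.
have gensP := skew_gensP X Xi Y Yi.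
have [J [yJ tfJ maxJ]] :=
  maximal_torsion_free (skew_q_neq0 q_as p0) qs_as XsM gensP simV ord0.
(* The dichotomy: whether [V] remains torsion-free when [Y] joins [J]. *)
have [torsC|tfC] := pselect (exists v F, [/\ v != 0,
    supp_in (on_coords (ord0 |: J)%SET) F, F != 0 &
    act (q0 := skew_q_neq0 q_as p0) (skew_X X Y) (skew_Xi Xi Yi) F v = 0]).
  by left; apply: (GKdim_torsion_case trivI XY simV yJ tfJ maxJ rk torsC).
have {}tfC : torsion_free (skew_q_neq0 q_as p0) (skew_X X Y) (skew_Xi Xi Yi) (ord0 |: J)%SET.
  by move=> v F v0 FC Fv; apply/eqP/negPn/negP => F0; apply: tfC; exists v, F.
right; have [v v0 direct] := direct_generator qs_as XsM (proj1 simV) yJ tfC maxJ.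
exact: (GKdim_direct_case XY simV v0 direct).
Qed.
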